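(* Let $\Omega\subset\mathbb{C}$ be a bounded, convex and simply connected domain. Let $a_f:\mathbb{D}\to\mathbb{D}$ be an analytic function and let $f$ be a univalent harmonic mapping from $\mathbb{D}$ onto $\Omega$ that is a solution of $\overline{f_{\overline z}}=a_f f_z$ in $\mathbb{D}$. Let $\zeta\in\partial\mathbb{D}$. If for each $m$ with $0<m<1/\pi$ $$\mathcal{L}(m):=\int_{\Gamma_{\zeta,m}}\frac{1-|a_f(z)|^2}{1-|z|^2}\,|dz|=\infty,$$ then the boundary function $f^*$ of $f$ is continuous at $\zeta$.
   Context: $\mathbb{D}$ is the open unit disk in $\mathbb{C}$; univalent means injective. A harmonic mapping is a complex-valued function $f=u+iv$ with $u,v$ real harmonic. For $\zeta=e^{i\theta_0}\in\partial\mathbb{D}$ and $m>0$, $\Gamma_{\zeta,m}$ is the curve in $\mathbb{D}$ given by $\Gamma_{\zeta,m}(\theta)=(1-m|\theta-\theta_0|)e^{i\theta}$, $0<|\theta-\theta_0|\le\min\{\pi,1/m\}$; it tends to $\zeta$ as $\theta\to\theta_0$. The boundary function $f^*$ is the complex Lebesgue integrable function on $\partial\mathbb{D}$ having $f$ as its Poisson integral. In this setting (a known result of Hengartner and Schober), the essential one-sided limits $f^*(e^{it-})=\operatorname{ess}\lim_{s\uparrow t}f^*(e^{is})$ and $f^*(e^{it+})=\operatorname{ess}\lim_{s\downarrow t}f^*(e^{is})$ exist at every $e^{it}\in\partial\mathbb{D}$ and are equal outside a countable set $E$; for $e^{it}\notin E$ the unrestricted limit $\lim_{z\to e^{it}}f(z)$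 exists and equals $f^*(e^{it})$. The function $f^*$ has a jump discontinuity at $e^{it}$ if the two one-sided essential limits differ, and otherwise it is said to be continuous at $e^{it}$. *)

(* Defs.v *)
(* Built on MathComp-Analysis. The complex plane is R[i]^o for R : realType, where
   the alias ^o selects the topology and norm of R[i] as a normed module over
   itself (the norm `|z| is then a nonnegative real element of R[i], and
   Normc.normc z is the same modulus as an element of R). *)
From HB Require Import structures.
From mathcomp Require Import all_boot all_order all_algebra.
From mathcomp Require Import complex.
From mathcomp Require Import all_classical all_reals all_analysis.

Set Implicit Arguments.
Unset Strict Implicit.
Unset Printing Implicit Defensive.

Import Order.TTheory GRing.Theory Num.Theory.
Import numFieldNormedType.Exports.

Local Open Scope classical_set_scope.
Local Open Scope ring_scope.
Local Open Scope complex_scope.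

Definition unit_disk (R : realType) : set R[i]^o := [set z | `|z| < 1].
Arguments unit_disk {R}.

Definition expi (R : realType) (t : R) : R[i]^o := cos t +i* sin t.

Definition re_part (R : realType) (f : R[i]^o -> R[i]^o) : R[i]^o -> R :=
  fun z => complex.Re (f z).
Definition im_part (R : realType) (f : R[i]^o -> R[i]^o) : R[i]^o -> R :=
  fun z => complex.Im (f z).

Definition domain (R : realType) (D : set R[i]^o) : Prop :=
  [/\ open D, connected D & D !=set0].

Definition simply_connected (R : realType) (D : set R[i]^o) : Prop :=
  (forall x y, D x -> D y ->
    exists gamma : R -> R[i]^o,
      [/\ {within `[0, 1], continuous gamma}, gamma @` `[0, 1] `<=` D,
          gamma 0 = x & gamma 1 = y]) /\
  (forall gamma : R -> R[i]^o,
    {within `[0, 1], continuous gamma} -> gamma @` `[0, 1] `<=` D ->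
    gamma 0 = gamma 1 ->
    exists H : R * R -> R[i]^o,
      [/\ {within `[0, 1] `*` `[0, 1], continuous H},
          H @` (`[0, 1] `*` `[0, 1]) `<=` D,
          {in `[0, 1], forall t, H (0, t) = gamma t},
          {in `[0, 1], forall t, H (1, t) = gamma 0} &
          {in `[0, 1], forall s, H (s, 0) = gamma 0 /\ H (s, 1) = gamma 0}]).

(* Derivability at z in the direction 1 over the field R[i] is complex
   differentiability at z. *)
Definition analytic (R : realType) (D : set R[i]^o) (g : R[i]^o -> R[i]^o) :=
  forall z, D z -> derivable g z 1.

Section real_partial_derivatives.
Variable R : realType.
Implicit Types (D : set R[i]^o) (u : R[i]^o -> R) (f : R[i]^o -> R[i]^o).

Definition slice_x u (z : R[i]^o) : R -> R := fun x => u (x +i* complex.Im z).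
Definition slice_y u (z : R[i]^o) : R -> R := fun y => u (complex.Re z +i* y).

Definition partial_x u : R[i]^o -> R :=
  fun z => derive1 (slice_x u z) (complex.Re z).
Definition partial_y u : R[i]^o -> R :=
  fun z => derive1 (slice_y u z) (complex.Im z).

Definition C1_on D u : Prop := forall z, D z ->
  [/\ derivable (slice_x u z) (complex.Re z) 1,
      derivable (slice_y u z) (complex.Im z) 1,
      {for z, continuous (partial_x u)} & {for z, continuous (partial_y u)}].

Definition C2_on D u : Prop :=
  [/\ C1_on D u, C1_on D (partial_x u) & C1_on D (partial_y u)].

Definition harmonic D u : Prop :=
  C2_on D u /\
  forall z, D z -> partial_x (partial_x u) z + partial_y (partial_y u) z = 0.

Definition harmonic_mapping D f : Prop :=
  harmonic D (re_part f) /\ harmonic D (im_part f).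

Definition cpartial_x f : R[i]^o -> R[i]^o :=
  fun z => partial_x (re_part f) z +i* partial_x (im_part f) z.
Definition cpartial_y f : R[i]^o -> R[i]^o :=
  fun z => partial_y (re_part f) z +i* partial_y (im_part f) z.

Definition wirtinger f : R[i]^o -> R[i]^o :=
  fun z => (cpartial_x f z - 'i * cpartial_y f z) / 2.
Definition wirtinger_bar f : R[i]^o -> R[i]^o :=
  fun z => (cpartial_x f z + 'i * cpartial_y f z) / 2.

End real_partial_derivatives.

Section boundary_function.
Variable R : realType.
Implicit Types (f fstar : R[i]^o -> R[i]^o).

Definition poisson_kernel (z : R[i]^o) (t : R) : R :=
  (1 - Normc.normc z ^+ 2) / Normc.normc (expi t - z) ^+ 2.

Definition poisson_integral (g : R -> R) (z : R[i]^o) : R :=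
  (2 * pi)^-1 *
  \int[@lebesgue_measure R]_(t in `[0, 2 * pi]) (poisson_kernel z t * g t).

(* fstar is a total function on R[i], but only its values on the unit circle
   are ever used. *)
Definition is_boundary_function f fstar : Prop :=
  [/\ (@lebesgue_measure R).-integrable `[0, 2 * pi]
        (fun t => (re_part fstar (expi t))%:E),
      (@lebesgue_measure R).-integrable `[0, 2 * pi]
        (fun t => (im_part fstar (expi t))%:E) &
      forall z, unit_disk z ->
        f z = poisson_integral (fun t => re_part fstar (expi t)) z +i*
              poisson_integral (fun t => im_part fstar (expi t)) z].

Definition ess_lim_left (g : R -> R[i]^o) (t : R) (l : R[i]^o) : Prop :=
  forall eps : R, 0 < eps -> exists2 delta : R, 0 < delta &
    {ae @lebesgue_measure R,
      forall s, t - delta < s < t -> Normc.normc (g s - l) < eps}.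

Definition ess_lim_right (g : R -> R[i]^o) (t : R) (l : R[i]^o) : Prop :=
  forall eps : R, 0 < eps -> exists2 delta : R, 0 < delta &
    {ae @lebesgue_measure R,
      forall s, t < s < t + delta -> Normc.normc (g s - l) < eps}.

(* Continuity of fstar at the boundary point expi t: both one-sided essential
   limits exist and they coincide. *)
Definition ess_continuous_at fstar (t : R) : Prop :=
  exists l, ess_lim_left (fstar \o @expi R) t l /\
            ess_lim_right (fstar \o @expi R) t l.

End boundary_function.

Section line_integral.
Variable R : realType.

Definition speed (gamma : R -> R[i]^o) (t : R) : R :=
  Num.sqrt (derive1 (fun s => complex.Re (gamma s)) t ^+ 2 +
            derive1 (fun s => complex.Im (gamma s)) t ^+ 2).

Definition arclength_integral (I : set R) (gamma : R -> R[i]^o)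
    (h : R[i]^o -> R) : \bar R :=
  (\int[@lebesgue_measure R]_(t in I) (h (gamma t) * speed gamma t)%:E)%E.

(* theta0 is an argument of the end point zeta = expi theta0 of the curve. *)
Definition Gamma (theta0 m : R) : R -> R[i]^o :=
  fun theta => (1 - m * `|theta - theta0|)%:C * expi theta.

Definition Gamma_range (theta0 m : R) : set R :=
  [set theta | 0 < `|theta - theta0| <= Num.min pi m^-1].

Definition calL (a : R[i]^o -> R[i]^o) (theta0 m : R) : \bar R :=
  arclength_integral (Gamma_range theta0 m) (Gamma theta0 m)
    (fun z => (1 - Normc.normc (a z) ^+ 2) / (1 - Normc.normc z ^+ 2)).

End line_integral.

(* Main.v *)
(* Since f is a homeomorphism onto a convex domain, the preimages of segments are
   arcs of the disk, and two such arcs with interlacing endpoints must cross, so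
   Re f and Im f cannot oscillate at the boundary; with Fatou's theorem this gives
   one-sided essential limits of f^* at zeta.

   Suppose that V, one of Re f and Im f, has a jump at zeta, and let U be the other
   one, with the sign making the Jacobian J of (U, V) equal to that of f. In
   the coordinates (m, t), where z is the point of Gamma_{zeta,m} at angular
   distance t from zeta, V is a Poisson integral asymptotic to a function of m only
   which is strictly monotone, so that |V_m| >= c0 > 0 for small t. Applying Green's
   formula to the form U chi(V) dV, with chi cutting off the two extreme curves,
   bounds the integral of chi(V) J over t >= eps independently of eps. Beltrami's
   equation gives (1 - |a|^2) |grad V|^2 <= 4 J, and |grad V| >= c0 / t, hence the
   integral of (1 - |a|^2) / t over the strip is finite: the integral over
   Gamma_{zeta,m} cannot be infinite for all m. *)
Require Import Defs.
From HB Require Import structures.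
From mathcomp Require Import all_boot all_order all_algebra.
From mathcomp Require Import complex.
From mathcomp Require Import all_classical all_reals all_analysis.
From mathcomp Require Import measurable_realfun.
From mathcomp Require Import ring lra.
Set Implicit Arguments.
Unset Strict Implicit.
Unset Printing Implicit Defensive.
Import Order.TTheory GRing.Theory Num.Theory.
Import numFieldNormedType.Exports.
Local Open Scope classical_set_scope.
Local Open Scope ring_scope.
Local Open Scope complex_scope.

(** * Crossing parity of closed loops in the plane *)

(** Winding numbers enter only modulo 2, counted on fine grids. This parity already gives both
    topological facts about a univalent f: its inverse is continuous, because an odd loop has odd
    parity as in Borsuk's theorem, and arcs with interlacing ends cross.

    Near a jump the boundary function is an explicit step plus a remainder with small averages. It
    is V_m, not only V, that must be controlled. The Poisson kernel changes with the distance x to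
    the circle by at most a multiple of |x - x'| / x of itself; with x = m t the factor t cancels,
    so the remainder perturbs V_m by a small amount uniformly in t.

    The strip estimate bounds only an integral over m, uniformly in eps. If the integral were
    infinite on every curve, compactness of the interval of m would give a single eps for which all
    truncated integrals are large, and the mean value theorem applied to an antiderivative in m
    would contradict the bound; no double integral is needed. The curves 1 / 20 <= m <= 1 / 5 are
    all below 1 / pi because pi < 4; those with m < 1 / 10 or m > 3 / 20 are the room needed by the
    cutoff. *)

Section parity.
Context {R : realType}.
Implicit Types p q r s : R * R.

(** The half-open convention on the real axis makes exactly one of p and -p [upper] whenever p is
    nonzero; see [upperN]. *)
Definition upper p : bool := (0 < p.2) || ((p.2 == 0) && (0 < p.1)).

(* Whether the edge from p to q crosses the positive real half-line. *)
Definition crossing p q : bool := (upper p (+) upper q) && (0 < p.1).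

Definition close (d : R) p q : bool :=
  (`|p.1 - q.1| < d) && (`|p.2 - q.2| < d).

(** The factor 2 works against [close d]: if a point within d of p lies on the other side, then p is
    within d of the real axis, so its first coordinate is at least 2 d in absolute value and its
    sign is shared by all points within d. *)
Definition large (d : R) p : bool := (2 * d <= `|p.1|) || (2 * d <= `|p.2|).

Lemma closeC d p q : close d p q = close d q p.
Proof. by rewrite /close distrC [X in _ && (X < _)]distrC. Qed.

Lemma upper_close d p q : close d p q -> upper p != upper q -> `|p.2| < d.
Proof.
rewrite /close /upper => /andP[_]; rewrite ltr_norml => /andP[h1 h2].
rewrite ltr_norml; case: (ltrgt0P p.2) => hp; case: (ltrgt0P q.2) => hq /=;
  rewrite ?orbT //= => _; try (apply/andP; split; lra).
all: apply/andP; split; lra.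
Qed.

Lemma crossing_sameside d p q r : close d p q -> close d p r -> large d p ->
  upper p != upper q -> (0 < r.1) = (0 < p.1).
Proof.
move=> pq pr lp upq; have := upper_close pq upq.
move: pr lp; rewrite /close /large => /andP[+ _] + hp.
rewrite [X in _ || X]leNgt (lt_le_trans hp) ?orbF; last first.
  have : 0 <= `|p.2| by []; move: hp; lra.
rewrite ltr_norml; case: (ltrgt0P p.1) => h; move=> /andP[h1 h2] h3.
- by apply/idP; lra.
- by apply/negbTE; rewrite -leNgt; lra.
- have := normr_ge0 p.2; lra.
Qed.

(** If no edge changes side, nothing is crossed. Otherwise an end of such an edge fixes the sign of
    the first coordinate on the whole cell, and the changes of side add up to zero modulo 2 round
    the cell. *)
Lemma crossing_cell d p q r s :
  large d p -> large d q -> large d r -> large d s ->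
  close d p q -> close d p r -> close d p s ->
  close d q r -> close d q s -> close d r s ->
  crossing p q (+) crossing s r = crossing p s (+) crossing q r.
Proof.
move=> lp lq lr ls pq pr ps qr qs rs.
have := pq; rewrite closeC => qp; have := pr; rewrite closeC => rp.
have := ps; rewrite closeC => sp; have := qr; rewrite closeC => rq.
have := qs; rewrite closeC => sq; have := rs; rewrite closeC => sr.
have same b1 b2 b3 b4 c1 c2 c3 : c2 = c1 -> c3 = c1 ->
    ((b1 (+) b2) && c1) (+) ((b4 (+) b3) && c2) =
    ((b1 (+) b4) && c1) (+) ((b2 (+) b3) && c3) :> bool.
  by move=> -> ->; case: b1; case: b2; case: b3; case: b4; case: c1.
rewrite /crossing.
case: (eqVneq (upper p) (upper q)) => [e1|n1]; last first.
  by apply: same; [exact: (crossing_sameside pq ps lp n1) |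
                   exact: (crossing_sameside pq pq lp n1)].
case: (eqVneq (upper q) (upper r)) => [e2|n2]; last first.
  have e := crossing_sameside qr qp lq n2.
  by apply: same; rewrite e ?(crossing_sameside qr qs lq n2).
case: (eqVneq (upper r) (upper s)) => [e3|n3].
  by rewrite e1 e2 e3 addbb.
have e := crossing_sameside rs rp lr n3.
by apply: same; rewrite e ?(crossing_sameside rs rq lr n3) ?(crossing_sameside rs rs lr n3).
Qed.

Definition loop_parity (g : nat -> R * R) (n : nat) : bool :=
  \big[addb/false]_(i < n) crossing (g i) (g i.+1).

Lemma loop_parityS g n :
  loop_parity g n.+1 = loop_parity g n (+) crossing (g n) (g n.+1).
Proof. by rewrite /loop_parity big_ord_recr. Qed.

Lemma eq_loop_parity g h n : (forall i, (i <= n)%N -> g i = h i) ->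
  loop_parity g n = loop_parity h n.
Proof.
move=> gh; apply: eq_bigr => i _; rewrite !gh //; exact: ltnW.
Qed.

Section grid.
Variables (d : R) (G : nat -> nat -> R * R) (M N : nat).
Hypothesis G_large : forall i j, (i <= M)%N -> (j <= N)%N -> large d (G i j).
Hypothesis G_close : forall i j i' j', (i <= M)%N -> (j <= N)%N ->
  (i' <= M)%N -> (j' <= N)%N -> (i <= i' <= i.+1)%N ->
  (j <= j'.+1)%N -> (j' <= j.+1)%N -> close d (G i j) (G i' j').

Lemma grid_strip j : (j < N)%N -> forall m, (m <= M)%N ->
  loop_parity (G ^~ j) m (+) loop_parity (G ^~ j.+1) m =
  crossing (G 0%N j) (G 0%N j.+1) (+) crossing (G m j) (G m j.+1).
Proof.
move=> jN; elim=> [|m IH] mM; first by rewrite /loop_parity !big_ord0 !addbb.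
rewrite !loop_parityS.
have := IH (ltnW mM); have lm := ltnW mM; have lj := ltnW jN.
have := @crossing_cell d (G m j) (G m.+1 j) (G m.+1 j.+1) (G m j.+1).
move=> /(_ (G_large lm lj) (G_large mM lj) (G_large mM jN)
  (G_large lm jN)).
have cl i j1 i' j2 : (i <= M)%N -> (j1 <= N)%N ->
  (i' <= M)%N -> (j2 <= N)%N -> (i <= i' <= i.+1)%N ->
  (j1 <= j2.+1)%N -> (j2 <= j1.+1)%N -> close d (G i j1) (G i' j2).
  exact: G_close.
have l1 := leqnSn m; have l2 := leqnSn j; have l3 := leqW l2.
rewrite (closeC d (G m.+1 j.+1)) (closeC d (G m.+1 j) (G m j.+1)).
rewrite !cl ?leqnn ?l1 ?l2 ?l3 //.
move=> /(_ erefl erefl erefl erefl erefl erefl).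
case: (crossing _ _); case: (crossing _ _); case: (crossing _ _);
case: (crossing _ _); case: (crossing _ _); case: (loop_parity _ _);
case: (loop_parity _ _) => //=.
Qed.

(** A discrete Stokes formula: [crossing_cell] is summed over all cells, and inner edges occur
    twice, hence cancel modulo 2. *)
Lemma grid_parity : loop_parity (G ^~ 0%N) M (+) loop_parity (G ^~ N) M =
  loop_parity (G 0%N) N (+) loop_parity (G M) N.
Proof.
suff: forall n, (n <= N)%N -> loop_parity (G ^~ 0%N) M (+) loop_parity (G ^~ n) M =
  loop_parity (G 0%N) n (+) loop_parity (G M) n by apply.
elim=> [|n IH] nN; first by rewrite /loop_parity !big_ord0 !addbb.
have := @grid_strip _ nN M (leqnn _).
rewrite !loop_parityS; move: (IH (ltnW nN)).
case: (crossing _ _); case: (crossing _ _); case: (loop_parity _ _);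
case: (loop_parity _ _); case: (loop_parity _ _); case: (loop_parity _ _);
case: (loop_parity _ _) => //=.
Qed.

End grid.
End parity.

(** * Fine grids on the unit square *)

Section fine.
Context {R : realType}.

Definition unit_square : set (R * R) := [set p | 0 <= p.1 <= 1 /\ 0 <= p.2 <= 1].

Lemma unit_square_compact : compact unit_square.
Proof.
rewrite (_ : unit_square = `[0, 1]%classic `*` `[0, 1]%classic); last first.
  by apply/seteqP; split=> p /=; rewrite !in_itv.
by apply: compact_setX; exact: segment_compact.
Qed.

(** Heine-Cantor through the near-covering form of compactness. Continuity at a point of the square
    is continuity in the plane, so q may lie outside the square. *)
Lemma uniform_close (Phi : R * R -> R * R) (d : R) : 0 < d ->
  (forall p, unit_square p -> {for p, continuous Phi}) ->
  exists N0 : nat, forall N, (N0 <= N)%N -> forall p q, unit_square p ->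
   `|p.1 - q.1| <= N%:R^-1 -> `|p.2 - q.2| <= N%:R^-1 -> close d (Phi p) (Phi q).
Proof.
move=> d0 cPhi.
have := (compact_near_coveringP _).1 unit_square_compact nat \oo
  (fun N p => forall q, `|p.1 - q.1| <= N%:R^-1 -> `|p.2 - q.2| <= N%:R^-1 ->
     close d (Phi p) (Phi q)).
move=> /(_ _) [].
  move=> p Kp.
  have d2 : 0 < d / 2 by lra.
  have /cvgrPdist_lt/= /(_ _ d2) := cPhi p Kp.
  move=> /nbhs_ballP[e /= e0 he].
  have e2 : 0 < e / 2 by lra.
  exists (ball p (e/2), [set N | N%:R^-1 < e / 2]) => /=.
    split; first exact: nbhsx_ballx.
    have [N _ hN] := near_infty_natSinv_lt (PosNum e2).
    by exists N.+1 => //= -[//|n] nN; exact: hN.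
  move=> [q N] /= [[b1 b2] hN] r h1 h2.
  have bq : ball p e q.
    by split; apply: le_ball; [|exact: b1| |exact: b2]; lra.
  have br : ball p e r.
    split; rewrite /ball/=.
      have := b1; rewrite /ball/= => h; rewrite (_ : p.1 - r.1 = (p.1 - q.1) + (q.1 - r.1)); last by lra.
      apply: le_lt_trans (ler_normD _ _) _; lra.
    have := b2; rewrite /ball/= => h; rewrite (_ : p.2 - r.2 = (p.2 - q.2) + (q.2 - r.2)); last by lra.
    apply: le_lt_trans (ler_normD _ _) _; lra.
  have := he _ bq; have := he _ br; rewrite /Num.norm /= !gt_max.
  move=> /andP[a1 a2] /andP[c1 c2]; rewrite /close.
  apply/andP; split.
    rewrite (_ : _ - _ = ((Phi p).1 - (Phi r).1) - ((Phi p).1 - (Phi q).1)); last by lra.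
    apply: le_lt_trans (ler_normB _ _) _; lra.
  rewrite (_ : _ - _ = ((Phi p).2 - (Phi r).2) - ((Phi p).2 - (Phi q).2)); last by lra.
  apply: le_lt_trans (ler_normB _ _) _; lra.
move=> N0 _ hN0; exists N0 => N N0N p q Kp.
by apply: hN0 => //.
Qed.

Lemma fine_grid (Phi : R * R -> R * R) :
  (forall p, unit_square p -> {for p, continuous Phi}) ->
  (forall p, unit_square p -> Phi p != 0) ->
  exists2 d : R, 0 < d & exists N0 : nat, forall N, (N0 <= N)%N ->
    (forall p, unit_square p -> large d (Phi p)) /\
    (forall p q, unit_square p ->
   `|p.1 - q.1| <= N%:R^-1 -> `|p.2 - q.2| <= N%:R^-1 -> close d (Phi p) (Phi q)).
Proof.
move=> cPhi Phi0.
have [|||c Kc cmin] := @compact_EVT_min _ R (fun p => `|Phi p|) unit_square.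
- by exists 0 => /=; split; lra.
- exact: unit_square_compact.
- apply: continuous_in_subspaceT => p Kp.
  apply: (@cvg_comp _ _ _ Phi Num.norm); first by apply: cPhi; rewrite inE in Kp.
  exact: norm_continuous.
have c0 : 0 < `|Phi c| by rewrite normr_gt0 Phi0 // -inE.
have d0 : 0 < `|Phi c| / 2 by lra.
(* Half the minimum of the sup norm, because [large d] asks for 2 d in some coordinate. *)
exists (`|Phi c| / 2) => //.
have [N0 hN0] := uniform_close d0 cPhi.
exists N0 => N N0N; split; last exact: hN0.
move=> p Kp; have := cmin p; rewrite inE => /(_ Kp).
rewrite [X in _ <= X]/Num.norm /= le_max /large.
by rewrite (_ : 2 * (`|Phi c| / 2) = `|Phi c|) //; lra.
Qed.
End fine.

(** * Parity of sampled paths, homotopy and odd loops *)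

Section winding.
Context {R : realType}.
Implicit Types (p q : R * R).

Definition path_parity (g : R -> R * R) (N : nat) : bool :=
  loop_parity (fun i => g (i%:R / N%:R)) N.

Lemma eq_path_parity g h N : (forall t, 0 <= t <= 1 -> g t = h t) ->
  path_parity g N = path_parity h N.
Proof.
move=> gh; apply: eq_loop_parity => i iN; apply: gh.
(* For N = 0 the sample point 0 / 0 is 0, which still lies in the unit interval. *)
case: N iN => [|N] iN; first by rewrite invr0 mulr0; lra.
by rewrite divr_ge0 //= ler_pdivrMr // mul1r ler_nat.
Qed.

(** Homotopy invariance: for a homotopy of closed loops the two sides on the right coincide and
    cancel, so the first and last loops have equal parity. The threshold depends on Phi;
    applications to several maps take a common large N. *)
Lemma square_parity (Phi : R * R -> R * R) :
  (forall p, unit_square p -> {for p, continuous Phi}) ->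
  (forall p, unit_square p -> Phi p != 0) ->
  exists N0 : nat, forall N, (N0 <= N)%N ->
    path_parity (fun s => Phi (s, 0)) N (+) path_parity (fun s => Phi (s, 1)) N =
    path_parity (fun t => Phi (0, t)) N (+) path_parity (fun t => Phi (1, t)) N.
Proof.
move=> cPhi Phi0; have [d d0 [N0 hN0]] := fine_grid cPhi Phi0.
exists N0.+1 => -[//|N] NN0.
have {hN0}[lPhi clPhi] := hN0 _ (ltnW NN0).
pose x (i : nat) : R := i%:R / N.+1%:R.
have x01 i : (i <= N.+1)%N -> 0 <= x i <= 1.
  by move=> iN; rewrite divr_ge0 //= ler_pdivrMr // mul1r ler_nat.
have xd i j : (i <= j.+1)%N -> (j <= i.+1)%N -> `|x i - x j| <= N.+1%:R^-1.
  move=> ij ji; rewrite /x -mulrBl normrM [X in _ * X]ger0_norm //.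
  rewrite ler_piMl // ler_norml.
  move: ij ji; rewrite -!(ler_nat R) -![_.+1%:R]natr1; lra.
have := @grid_parity R d (fun i j => Phi (x i, x j)) N.+1 N.+1 _ _.
rewrite /path_parity /x mul0r divff ?pnatr_eq0 // => ->.
- by [].

- by move=> i j iN jN; apply: lPhi; split; apply: x01.
- move=> i j i' j' iN jN i'N j'N /andP[ii' i'i] jj' j'j.
  apply: clPhi => /=; [by split; apply: x01|apply: xd => //|exact: xd].
  exact: leqW.
Qed.

Lemma path_parity_cst p N : path_parity (cst p) N = false.
Proof.
by rewrite /path_parity /loop_parity big1 // => i _; rewrite /crossing addbb.
Qed.

Lemma upperN p : p != 0 -> upper (- p) = ~~ upper p.
Proof.
rewrite /upper /= => p0.
have {}p0 : ~~ ((p.1 == 0) && (p.2 == 0)).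
  by apply: contra p0 => /andP[/eqP h1 /eqP h2]; rewrite -pair_eqE /pair_eq /= h1 h2 !eqxx.
move: p0; rewrite oppr_gt0 oppr_eq0 oppr_gt0.
by case: (ltrgt0P p.2) => h2 //=; case: (ltrgt0P p.1) => h1 //=.
Qed.

Lemma large_neq0 d p : 0 < d -> large d p -> p != 0.
Proof.
move=> d0; apply: contraTneq => ->; rewrite /large /= normr0 orbb -ltNge; lra.
Qed.

(* The edges -p -> -q and p -> q together cross the whole real line as often
   as p and q lie in different half-planes. *)
Lemma crossingN d p q : 0 < d -> large d p -> large d q -> close d p q ->
  crossing p q (+) crossing (- p) (- q) = upper p (+) upper q.
Proof.
move=> d0 lp lq pq; rewrite /crossing !upperN ?(large_neq0 d0) //.
have -> : ~~ upper p (+) ~~ upper q = upper p (+) upper q.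
  by case: (upper p); case: (upper q).
case: (eqVneq (upper p) (upper q)) => [->|n]; first by rewrite addbb.
rewrite -andb_addr /= oppr_gt0.
suff : p.1 != 0 by case: (ltrgt0P p.1) => //=; rewrite andbT.
apply: contraL lp => /eqP p10; have := upper_close pq n.
by rewrite /large p10 normr0 => h; rewrite negb_or -!ltNge; lra.
Qed.

(** A discrete Borsuk theorem. Pairing edge i with edge K + i turns the count into a telescoping sum
    of changes of side between [h 0] and [h K], which are opposite points. *)
Lemma odd_loop_parity d (h : nat -> R * R) K : 0 < d ->
  (forall i, (i <= K + K)%N -> large d (h i)) ->
  (forall i, (i < K + K)%N -> close d (h i) (h i.+1)) ->
  (forall i, (i <= K)%N -> h (K + i)%N = - h i) ->
  loop_parity h (K + K) = true.
Proof.
move=> d0 lh ch oh.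
rewrite /loop_parity big_split_ord /= -big_split /=.
transitivity (\big[addb/false]_(i < K) (upper (h i) (+) upper (h i.+1))).
  apply: eq_bigr => i _; rewrite -addnS !oh //; last exact: ltnW.
  have iK : (i < K + K)%N by apply: leq_trans (ltn_ord i) (leq_addr _ _).
  by apply: (@crossingN d) => //; [apply: lh; exact: ltnW|exact: lh|exact: ch].
have -> : \big[addb/false]_(i < K) (upper (h i) (+) upper (h i.+1)) = upper (h 0%N) (+) upper (h K).
  clear; elim: K => [|k IH]; first by rewrite big_ord0 addbb.
  rewrite big_ord_recr /= IH.
  by case: (upper (h 0%N)); case: (upper (h k)); case: (upper (h k.+1)).
rewrite -{1}(addn0 K) oh // upperN; last by apply: large_neq0 d0 _; exact: lh.
by case: upper.
Qed.

End winding.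

(** * Injective continuous maps of the disk *)

Section invariance.
Context {R : realType}.
Implicit Types (p q : R * R).

Lemma continuous_for (T U : topologicalType) (f : T -> U) :
  (forall x, {for x, continuous f}) -> continuous f.
Proof. by []. Qed.

Lemma continuous_sqr (T : topologicalType) (f : T -> R) x :
  {for x, continuous f} -> {for x, continuous (fun t => f t ^+ 2)}.
Proof. by move=> cf; apply: continuousM. Qed.

Lemma continuous_pair (T : topologicalType) (f g : T -> R) x :
  {for x, continuous f} -> {for x, continuous g} ->
  {for x, continuous (fun t => (f t, g t))}.
Proof. by move=> cf cg; exact: (cvg_pair cf cg). Qed.

Lemma continuous_fst2 : continuous (fun p : R * R => p.1).
Proof. by move=> p; exact: cvg_fst. Qed.

Lemma continuous_snd2 : continuous (fun p : R * R => p.2).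
Proof. by move=> p; exact: cvg_snd. Qed.

Definition disk2 : set (R * R) := [set p | p.1 ^+ 2 + p.2 ^+ 2 < 1].

(** A negative k is allowed: half a turn changes its sign, which is how antipodal points enter. *)
Definition polar (p0 : R * R) (k t : R) : R * R :=
  (p0.1 + k * cos (2 * pi * t), p0.2 + k * sin (2 * pi * t)).

Lemma polar_continuous p0 a b : continuous (fun p => polar p0 (a + b * p.2) p.1).
Proof.
rewrite /polar => p; apply: (@continuous_pair _ (fun p : R * R => p0.1 + (a + b * p.2) * cos (2 * pi * p.1))
  (fun p => p0.2 + (a + b * p.2) * sin (2 * pi * p.1)));
 apply: continuousD; try exact: cvg_cst;
 apply: continuousM.
- apply: continuousD; first exact: cvg_cst.
  by apply: continuousM; [exact: cvg_cst|exact: continuous_snd2].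
- apply: (@continuous_comp _ _ _ (fun p : R * R => 2 * pi * p.1) cos).
    by apply: continuousM; [exact: cvg_cst|exact: continuous_fst2].
  exact: continuous_cos.
- apply: continuousD; first exact: cvg_cst.
  by apply: continuousM; [exact: cvg_cst|exact: continuous_snd2].
- apply: (@continuous_comp _ _ _ (fun p : R * R => 2 * pi * p.1) sin).
    by apply: continuousM; [exact: cvg_cst|exact: continuous_fst2].
  exact: continuous_sin.
Qed.

Lemma polar0 p0 t : polar p0 0 t = p0.
Proof. by rewrite /polar !mul0r !addr0; case: p0. Qed.

Lemma polar1 p0 k : polar p0 k 1 = polar p0 k 0.
Proof. by rewrite /polar mulr1 mulr0 cos0 sin0 mulr_natl cos2pi sin2pi. Qed.

Lemma polar_half p0 k t : polar p0 k (t + 1 / 2) = polar p0 (- k) t.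
Proof.
rewrite /polar (_ : 2 * pi * (t + 1 / 2) = 2 * pi * t + pi); last by field.
by rewrite cosDpi sinDpi !mulrN !mulNr.
Qed.

Lemma polar_dist p0 k t :
  ((polar p0 k t).1 - p0.1) ^+ 2 + ((polar p0 k t).2 - p0.2) ^+ 2 = k ^+ 2.
Proof.
have h := cos2Dsin2 (2 * pi * t).
rewrite /polar /=; set c := cos _ in h *; set s := sin _ in h *.
transitivity (k ^+ 2 * (c ^+ 2 + s ^+ 2)); last by rewrite h mulr1.
ring.
Qed.

Lemma polar_inj p0 k k' t : polar p0 k t = polar p0 k' t -> k = k'.
Proof.
move=> [/addrI/eqP h1 /addrI/eqP h2].
have := cos2Dsin2 (2 * pi * t); move: h1 h2.
rewrite -subr_eq0 -mulrBl mulf_eq0 subr_eq0 => /orP[/eqP//|/eqP ->].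
rewrite -subr_eq0 -mulrBl mulf_eq0 subr_eq0 => /orP[/eqP//|/eqP ->].
by rewrite expr0n /= addr0 => /eqP; rewrite eq_sym oner_eq0.
Qed.

Variable F : R * R -> R * R.
Hypothesis cF : forall p, disk2 p -> {for p, continuous F}.
Hypothesis injF : forall p q, disk2 p -> disk2 q -> F p = F q -> p = q.

Section ball.
Variables (p0 : R * R) (r : R).
Hypothesis r0 : 0 < r.
Hypothesis ball_disk : forall q,
  (q.1 - p0.1) ^+ 2 + (q.2 - p0.2) ^+ 2 <= r ^+ 2 -> disk2 q.

Let polar_disk k t : - r <= k <= r -> disk2 (polar p0 k t).
Proof.
move=> kr; apply: ball_disk; rewrite polar_dist.
by rewrite -[X in X <= _]real_normK ?num_real // lerXn2r ?nnegrE ?(ltW r0) // ler_norml.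
Qed.

Let cFpolar a b p : - r <= a + b * p.2 <= r ->
  {for p, continuous (fun p : R * R => F (polar p0 (a + b * p.2) p.1))}.
Proof.
move=> h; apply: (@continuous_comp _ _ _ (fun p => polar p0 (a + b * p.2) p.1) F).
  exact: polar_continuous.
by apply: cF; exact: polar_disk.
Qed.

(** The loop of F on the circle minus its value at the centre is deformed into F (p0 + z) - F (p0 -
    z) with z of modulus r / 2, which is odd. All along, the two points compared have signed radii
    differing by r, so injectivity excludes zeros. *)
Let odd_parity : exists N0, forall K, (N0 <= K)%N ->
  path_parity (fun s => F (polar p0 r s) - F p0) (K + K) = true.
Proof.
have r0' := r0.
pose Phi p := F (polar p0 (r + (- r / 2) * p.2) p.1) -
  F (polar p0 (0 + (- r / 2) * p.2) p.1).
have cPhi p : unit_square p -> {for p, continuous Phi}.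
  move=> [_ /andP[p1 p2]]; have h := mulr_ge0 (ltW r0) p1.
  have h' : r * p.2 <= r by rewrite ger_pMr.
  by apply: continuousB; apply: cFpolar; lra.
have Phi0 p : unit_square p -> Phi p != 0.
  move=> [_ /andP[p1 p2]]; have h := mulr_ge0 (ltW r0) p1.
  have h' : r * p.2 <= r by rewrite ger_pMr.
  rewrite /Phi subr_eq0; apply/eqP => /injF H.
  have /polar_inj : polar p0 (r + - r / 2 * p.2) p.1 = polar p0 (0 + - r / 2 * p.2) p.1.
    by apply: H; apply: polar_disk; lra.
  by move/addIr => h0; move: r0; rewrite h0 ltxx.
have [N1 hN1] := square_parity cPhi Phi0.
have [d d0 [N2 hN2]] := fine_grid cPhi Phi0.
exists (N1 + N2).+1 => -[//|K]; rewrite ltnS => NK.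
have NK1 : (N1 <= K.+1 + K.+1)%N.
  by rewrite addnS leqW // (leq_trans (leq_addr N2 _)) // (leq_trans NK) // addSn leqW // leq_addr.
have NK2 : (N2 <= K.+1 + K.+1)%N.
  by rewrite addnS leqW // (leq_trans (leq_addl N1 _)) // (leq_trans NK) // addSn leqW // leq_addr.
have := hN1 _ NK1.
rewrite (@eq_path_parity _ (fun t => Phi (1, t)) (fun t => Phi (0, t))); last first.
  by move=> t _; rewrite /Phi /= !polar1.
rewrite addbb (@eq_path_parity _ (fun t => Phi (t, 0)) (fun s => F (polar p0 r s) - F p0)); last first.
  by move=> t _; rewrite /Phi /= mulr0 !addr0 polar0.
move=> H; suff : path_parity (fun s => Phi (s, 1)) (K.+1 + K.+1) = true.
  by move=> h; move: H; rewrite h; case: path_parity.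
have [l c] := hN2 _ NK2.
have S i : (i <= K.+1 + K.+1)%N -> unit_square (i%:R / (K.+1 + K.+1)%:R, 1 : R).
  move=> iK; split => /=; last lra.
  by rewrite divr_ge0 //= ler_pdivrMr ?ltr0n // mul1r ler_nat.
apply: (@odd_loop_parity _ d) => //.
- by move=> i iK; apply: l; exact: S.
- move=> i iK; apply: c; first by apply: S; exact: ltnW.
    by rewrite /= distrC -mulrBl -natr1 addrC addKr mul1r ger0_norm.
  by rewrite /= subrr normr0.
- move=> i iK; rewrite natrD mulrDl addrC.
  have -> : K.+1%:R / (K.+1 + K.+1)%:R = 1 / 2 :> R.
    by rewrite natrD; field; rewrite ?pnatr_eq0 // -?natrD ?pnatr_eq0.
  rewrite /Phi /= !polar_half opprB.
  by congr (F (polar _ _ _) - F (polar _ _ _)); lra.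
Qed.

(** Suppose that p is outside the ball while F p is near F p0. Shrinking the circle to its centre
    never meets p, so the loop F - F p on the circle has even parity. Sliding the base value along
    the segment from F p0 to F p avoids the image of the circle, so the parity is also that of
    [odd_parity]. *)
Lemma inverse_near : exists2 d : R, 0 < d & forall p, disk2 p ->
  `|F p - F p0| < d -> (p.1 - p0.1) ^+ 2 + (p.2 - p0.2) ^+ 2 <= r ^+ 2.
Proof.
have r0' := r0.
pose Psi p := F (polar p0 (r + 0 * p.2) p.1) - F p0.
have dp0 : disk2 p0 by apply: ball_disk; rewrite !subrr expr0n /= addr0 sqr_ge0.
have cPsi p : unit_square p -> {for p, continuous Psi}.
  move=> _; apply: continuousB; last exact: cvg_cst.
  by apply: cFpolar; lra.
have Psi0 p : unit_square p -> Psi p != 0.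
  move=> _; rewrite /Psi subr_eq0; apply/eqP => /injF H.
  have /polar_inj : polar p0 (r + 0 * p.2) p.1 = polar p0 0 p.1.
    by rewrite polar0; apply: H => //; apply: polar_disk; lra.
  by rewrite mul0r addr0 => h0; move: r0; rewrite h0 ltxx.
have [d d0 [N1 hN1]] := fine_grid cPsi Psi0.
(* Only the lower bound is kept: the image of the circle stays at sup distance at least 2 d from F
   p0. *)
have {hN1}[lPsi _] := hN1 _ (leqnn _).
exists d => // p Dp Fp.
rewrite leNgt; apply/negP => pr.
pose Phi2 q := F (polar p0 (0 + r * q.2) q.1) - F p.
have cPhi2 q : unit_square q -> {for q, continuous Phi2}.
  move=> [_ /andP[q1 q2]]; have h := mulr_ge0 (ltW r0) q1.
  have h' : r * q.2 <= r by rewrite ger_pMr.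
  by apply: continuousB; [apply: cFpolar; lra|exact: cvg_cst].
have Phi20 q : unit_square q -> Phi2 q != 0.
  move=> [_ /andP[q1 q2]]; have h := mulr_ge0 (ltW r0) q1.
  have h' : r * q.2 <= r by rewrite ger_pMr.
  rewrite /Phi2 subr_eq0; apply/eqP => /injF H.
  have {}H : polar p0 (0 + r * q.2) q.1 = p by apply: H => //; apply: polar_disk; lra.
  move: pr; rewrite -H polar_dist add0r ltNge lerXn2r ?nnegrE //; lra.
pose Phi3 q := F (polar p0 (r + 0 * q.2) q.1) - (F p0 + q.2 *: (F p - F p0)).
have cPhi3 q : unit_square q -> {for q, continuous Phi3}.
  move=> _; apply: continuousB; first by apply: cFpolar; lra.
  apply: continuousD; first exact: cvg_cst.
  by apply: continuousZr_tmp; exact: continuous_snd2.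
have Phi30 q : unit_square q -> Phi3 q != 0.
  move=> Sq; have [_ /andP[q1 q2]] := Sq.
  rewrite /Phi3 opprD addrA subr_eq0; apply/eqP => H.
  have := lPsi _ Sq; rewrite /Psi H /large /=.
  have : `|q.2 *: (F p - F p0)| <= `|F p - F p0|.
    by rewrite normrZ ger0_norm // ler_piMl.
  rewrite [in X in X -> _]/Num.norm /= ge_max => /andP[h1 h2].
  have hm x : x <= `|F p - F p0| -> 2 * d <= x -> False by lra.
  by case/orP; [exact: hm h1|exact: hm h2].
have [N2 hN2] := square_parity cPhi2 Phi20.
have [N3 hN3] := square_parity cPhi3 Phi30.
have [N4 hN4] := odd_parity.
pose K := (N2 + N3 + N4)%N.
have K2 : (N2 <= K + K)%N by apply: leq_trans (leq_addr _ _); rewrite /K -addnA leq_addr.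
have K3 : (N3 <= K + K)%N by apply: leq_trans (leq_addr _ _); rewrite /K addnAC leq_addl.
have K4 : (N4 <= K)%N by rewrite /K leq_addl.
have := hN4 _ K4; have := hN3 _ K3; have := hN2 _ K2.
rewrite (@eq_path_parity _ (fun t => Phi2 (1, t)) (fun t => Phi2 (0, t))); last first.
  by move=> t _; rewrite /Phi2 /= !polar1.
rewrite (@eq_path_parity _ (fun t => Phi3 (1, t)) (fun t => Phi3 (0, t))); last first.
  by move=> t _; rewrite /Phi3 /= !polar1.
rewrite (@eq_path_parity _ (fun t => Phi2 (t, 0)) (cst (F p0 - F p))); last first.
  by move=> t _; rewrite /Phi2 /= mulr0 addr0 polar0.
rewrite (@eq_path_parity _ (fun t => Phi2 (t, 1)) (fun t => Phi3 (t, 1))); last first.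
  by move=> t _; rewrite /Phi2 /Phi3 /= mul0r mulr1 add0r addr0 scale1r [F p0 + _]addrC subrK.
rewrite (@eq_path_parity _ (fun t => Phi3 (t, 0)) (fun s => F (polar p0 r s) - F p0)); last first.
  by move=> t _; rewrite /Phi3 /= mul0r addr0 scale0r addr0.
rewrite path_parity_cst !addbb /= => -> h1 h2.
by move: h1; rewrite h2.
Qed.

End ball.

Lemma inverse_continuous p0 (e : R) : disk2 p0 -> 0 < e ->
  exists2 d : R, 0 < d & forall p, disk2 p -> `|F p - F p0| < d -> `|p - p0| < e.
Proof.
move=> Dp0 e0.
(* The second bound keeps the closed ball of radius r in the disk: Young's inequality gives |q|^2 <=
   |p0|^2 (1 + r) + r^2 + r, which is at most |p0|^2 + 3 r. *)
pose r := Num.min (e / 2) ((1 - (p0.1 ^+ 2 + p0.2 ^+ 2)) / 8).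
have r0 : 0 < r by rewrite lt_min; apply/andP; split; move: Dp0; rewrite /disk2 /=; lra.
have re : r <= e / 2 by rewrite /r ge_min lexx.
have r1 : r <= (1 - (p0.1 ^+ 2 + p0.2 ^+ 2)) / 8 by rewrite /r ge_min lexx orbT.
have [|d d0 hd] := @inverse_near p0 r r0.
  move=> q h; rewrite /disk2 /=.
  have := Dp0; rewrite /disk2 /=.
  move: h r1 r0.
  set a := q.1; set b := q.2; set x := p0.1; set y := p0.2 => h r1 r0 h1.
  have sx : 0 <= (a - x - r * x)^+2 by exact: sqr_ge0.
  have s1 : 0 <= (1 - x) ^+ 2 + (1 - y) ^+ 2 by rewrite addr_ge0 // sqr_ge0.
  have h2 : a ^+ 2 + b ^+ 2 <= (x^+2 + y^+2) * (1 + r) + (r ^+ 2) * (1 + r^-1).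
    have : 0 <= ((r * x - (a - x)) ^+ 2 + (r * y - (b - y)) ^+ 2) * r^-1.
      by rewrite mulr_ge0 ?invr_ge0 ?(ltW r0) // addr_ge0 // sqr_ge0.
    rewrite (_ : _ * r^-1 = (x ^+ 2 + y ^+ 2) * r - 2 * (x * (a - x) + y * (b - y)) +
      ((a - x) ^+ 2 + (b - y) ^+ 2) * r^-1); last by field; lra.
    have : ((a - x) ^+ 2 + (b - y) ^+ 2) * r^-1 <= r ^+ 2 * r^-1.
      by rewrite ler_pM2r // invr_gt0.
    rewrite [r ^+ 2 * (1 + r^-1)]mulrDr mulr1; lra.
  apply: le_lt_trans h2 _.
  rewrite (_ : r ^+ 2 * (1 + r^-1) = r ^+ 2 + r); last by field; lra.
  nra.
exists d => // p Dp /(hd p Dp) h.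
have rr : 0 <= r by exact: ltW.
have sq (z : R) : z ^+ 2 <= r ^+ 2 -> `|z| < e.
  by rewrite -[z ^+ 2]real_normK ?num_real // ler_pXn2r ?nnegrE // => h1; lra.
rewrite [X in X < _]/Num.norm /= gt_max; apply/andP; split; apply: sq => /=;
  have := sqr_ge0 (p.1 - p0.1); have := sqr_ge0 (p.2 - p0.2); lra.
Qed.
End invariance.

(** * Crossing of two arcs of the disk with interlacing ends *)

Section crossing_paths.
Context {R : realType}.
Implicit Types (p q : R * R).

Lemma loop_parity_head (g : nat -> R * R) b n :
  (forall i, (i < n.+1)%N -> upper (g i.+1) = b) ->
  loop_parity g n.+1 = crossing (g 0%N) (g 1%N).
Proof.
elim: n => [|n IH] h; first by rewrite /loop_parity big_ord1.
rewrite loop_parityS IH; last by move=> i ?; apply: h; exact: leqW.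
by rewrite [X in _ (+) X]/crossing !h // addbb addbF.
Qed.

Definition circle (s : R) : R * R := (cos s, sin s).

Section half_plane.
Variable tau : R.

Definition rot1 p := p.1 * cos tau + p.2 * sin tau.
Definition rot2 p := p.2 * cos tau - p.1 * sin tau.
Definition chord2 p := (1 - rot1 p) ^+ 2 + rot2 p ^+ 2.

(* The Cayley transform z |-> i (1 + w) / (1 - w) with w = z e^(-i tau). *)
Definition cayley p : R * R :=
  (- (2 * rot2 p) / chord2 p, (1 - rot1 p ^+ 2 - rot2 p ^+ 2) / chord2 p).

Lemma rot_norm p : rot1 p ^+ 2 + rot2 p ^+ 2 = p.1 ^+ 2 + p.2 ^+ 2.
Proof.
have h := cos2Dsin2 tau; rewrite /rot1 /rot2.
set c := cos _ in h *; set s := sin _ in h *.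
transitivity ((p.1 ^+ 2 + p.2 ^+ 2) * (c ^+ 2 + s ^+ 2)); first by ring.
by rewrite h mulr1.
Qed.

Lemma rot_inj p q : rot1 p = rot1 q -> rot2 p = rot2 q -> p = q.
Proof.
move=> h1 h2; have h := cos2Dsin2 tau; move: h1 h2; rewrite /rot1 /rot2.
set c := cos _ in h *; set s := sin _ in h * => h1 h2.
have e1 (r : R * R) : r.1 = (r.1 * c + r.2 * s) * c - (r.2 * c - r.1 * s) * s.
  transitivity (r.1 * (c ^+ 2 + s ^+ 2)); [by rewrite h mulr1|by ring].
have e2 (r : R * R) : r.2 = (r.1 * c + r.2 * s) * s + (r.2 * c - r.1 * s) * c.
  transitivity (r.2 * (c ^+ 2 + s ^+ 2)); [by rewrite h mulr1|by ring].
have E1 : p.1 = q.1 by rewrite (e1 p) (e1 q) h1 h2.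
have E2 : p.2 = q.2 by rewrite (e2 p) (e2 q) h1 h2.
by rewrite [p]surjective_pairing E1 E2 -surjective_pairing.
Qed.

Lemma rot1_circle s : rot1 (circle s) = cos (s - tau).
Proof. by rewrite cosB. Qed.

Lemma rot2_circle s : rot2 (circle s) = sin (s - tau).
Proof. by rewrite sinB. Qed.

Lemma chord2_disk p : disk2 p -> 0 < chord2 p.
Proof.
rewrite /disk2 /= -rot_norm => h; rewrite /chord2.
have s1 := sqr_ge0 (rot2 p); have s2 := sqr_ge0 (1 - rot1 p).
rewrite lt_neqAle addr_ge0 // andbT eq_sym paddr_eq0 // sqrf_eq0 sqrf_eq0.
by apply/negP => /andP[/eqP h1 _]; nra.
Qed.

Lemma chord2_circle s : tau < s < tau + 2 * pi -> 0 < chord2 (circle s).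
Proof.
move=> h; rewrite /chord2 rot1_circle rot2_circle.
have h1 := cos2Dsin2 (s - tau).
rewrite (_ : _ + _ = 2 - 2 * cos (s - tau)); last by move: h1; set c := cos _; set s' := sin _; nra.
rewrite (_ : s - tau = ((s - tau) / 2) *+ 2); last by rewrite mulr2n; field.
rewrite cos_mulr2n.
have : 0 < sin ((s - tau) / 2) by apply: sin_gt0_pi; lra.
have := cos2Dsin2 ((s - tau) / 2); rewrite mulr2n.
by set c := cos _; set s' := sin _; nra.
Qed.

Lemma cayley_disk p : disk2 p -> 0 < (cayley p).2.
Proof.
move=> Dp; rewrite /cayley /= divr_gt0 ?chord2_disk //.
by move: Dp; rewrite /disk2 /= -rot_norm; lra.
Qed.

Lemma cayley_circle s : tau < s < tau + 2 * pi ->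
  cayley (circle s) = (- (cos ((s - tau) / 2) / sin ((s - tau) / 2)), 0).
Proof.
move=> h; have := chord2_circle h; rewrite /cayley /chord2 rot1_circle rot2_circle.
have h1 := cos2Dsin2 (s - tau).
have h2 : 0 < sin ((s - tau) / 2) by apply: sin_gt0_pi; lra.
have h3 := cos2Dsin2 ((s - tau) / 2).
have c2 : cos (s - tau) = 1 - 2 * sin ((s - tau) / 2) ^+ 2.
  rewrite {1}(_ : s - tau = ((s - tau) / 2) *+ 2); last by rewrite mulr2n; field.
  by rewrite cos_mulr2n; lra.
have s2 : sin (s - tau) = 2 * sin ((s - tau) / 2) * cos ((s - tau) / 2).
  rewrite {1}(_ : s - tau = ((s - tau) / 2) *+ 2); last by rewrite mulr2n; field.
  by rewrite sin_mulr2n; lra.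
move: h1; rewrite c2 s2; move: h2 h3.
set c := cos _; set s' := sin _ => h2 h3 h1 h4.
congr pair; last by rewrite -addrA -opprD h1 subrr mul0r.
have -> : (1 - (1 - 2 * s' ^+ 2)) ^+ 2 + (2 * s' * c) ^+ 2 = 4 * s' ^+ 2.
  by transitivity (4 * s' ^+ 2 * (c ^+ 2 + s' ^+ 2)); [ring|rewrite h3 mulr1].
by field; lra.
Qed.

Lemma cayley_circle_lt s s' : tau < s -> s < s' -> s' < tau + 2 * pi ->
  (cayley (circle s)).1 < (cayley (circle s')).1.
Proof.
move=> h1 h2 h3; rewrite !cayley_circle /=; try lra.
have a1 : 0 < sin ((s - tau) / 2) by apply: sin_gt0_pi; lra.
have a2 : 0 < sin ((s' - tau) / 2) by apply: sin_gt0_pi; lra.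
rewrite ltrN2 ltr_pdivrMr // mulrAC ltr_pdivlMr // -subr_gt0.
rewrite [X in 0 < X - _]mulrC -sinB; apply: sin_gt0_pi; lra.
Qed.

Lemma cayley_inj p q : 0 < chord2 p -> 0 < chord2 q -> cayley p = cayley q -> p = q.
Proof.
rewrite /cayley /chord2 => dp dq [].
set x := rot1 p in dp *; set y := rot2 p in dp *.
set x' := rot1 q in dq *; set y' := rot2 q in dq *.
set d := _ + _ in dp *; set d' := _ + _ in dq * => h1 h2.
have hd : d = (1 - x) ^+ 2 + y ^+ 2 by [].
have hd' : d' = (1 - x') ^+ 2 + y' ^+ 2 by [].
have e1 : y / d = y' / d'.
  have := h1; rewrite !mulNr => /oppr_inj; rewrite -!mulrA => /mulfI; apply.
  by rewrite pnatr_eq0.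
have e2 : (1 - x) / d = (1 - x') / d'.
  have -> : (1 - x) / d = (1 + (1 - x ^+ 2 - y ^+ 2) / d) / 2.
    by rewrite hd; field; rewrite -hd; lra.
  have -> : (1 - x') / d' = (1 + (1 - x' ^+ 2 - y' ^+ 2) / d') / 2.
    by rewrite hd'; field; rewrite -hd'; lra.
  by rewrite h2.
(* With w the rotated point, d is |1 - w|^2 and 1 / (1 - w) has squared modulus 1 / d. The
   coordinates of 1 / (1 - w) are affine functions of those of the image, so the image determines
   d. *)
have e3 : d^-1 = d'^-1.
  have -> : d^-1 = ((1 - x) / d) ^+ 2 + (y / d) ^+ 2.
    by rewrite !expr_div_n -mulrDl -hd expr2 invfM mulrA divff ?mul1r //; lra.
  have -> : d'^-1 = ((1 - x') / d') ^+ 2 + (y' / d') ^+ 2.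
    by rewrite !expr_div_n -mulrDl -hd' expr2 invfM mulrA divff ?mul1r //; lra.
  by rewrite e1 e2.
have {}e3 : d = d' by apply: invr_inj.
have dn : d'^-1 != 0 by rewrite invr_eq0; lra.
apply: rot_inj.
  by move: e2; rewrite e3 => /(mulIf dn)/addrI/oppr_inj.
by move: e1; rewrite e3 => /(mulIf dn).
Qed.

Lemma rot1_continuous : continuous rot1.
Proof.
rewrite /rot1; apply: continuous_for => p; apply: continuousD; apply: continuousM; try exact: cvg_cst.
  exact: continuous_fst2.
exact: continuous_snd2.
Qed.

Lemma rot2_continuous : continuous rot2.
Proof.
rewrite /rot2; apply: continuous_for => p; apply: continuousB; apply: continuousM; try exact: cvg_cst.
  exact: continuous_snd2.
exact: continuous_fst2.
Qed.

Lemma cayley_continuous p : 0 < chord2 p -> {for p, continuous cayley}.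
Proof.
move=> dp; have cd : {for p, continuous chord2}.
  rewrite /chord2; apply: continuousD; apply: continuous_sqr; last exact: rot2_continuous.
  by apply: continuousB; [exact: cvg_cst|exact: rot1_continuous].
have cdV : {for p, continuous (fun p => (chord2 p)^-1)}.
  by apply: continuousV => //; lra.
have r1 := @rot1_continuous p; have r2 := @rot2_continuous p.
apply: (@continuous_pair _ _ (fun p => - (2 * rot2 p) / chord2 p)
  (fun p => (1 - rot1 p ^+ 2 - rot2 p ^+ 2) / chord2 p)).
  apply: continuousM => //; apply: continuousN; apply: continuousM => //.
  exact: cvg_cst.
apply: continuousM => //; apply: continuousB; last exact: continuous_sqr.
by apply: continuousB; [exact: cvg_cst|exact: continuous_sqr].
Qed.

End half_plane.

Opaque cayley.

(** In the half-plane the arcs join real points x1 to x3 and x2 to x4, with x1 < x2 < x3 < x4.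
    Without a common point the difference [Phi] has no zero on the square, yet exactly one of its
    four sides has odd parity: x3 minus the second arc leaves the positive half-line once, while the
    other three sides never cross it. *)
Lemma paths_cross tau (s1 s2 s3 s4 : R) (al be : R -> R * R) :
  tau < s1 -> s1 < s2 -> s2 < s3 -> s3 < s4 -> s4 < tau + 2 * pi ->
  continuous al -> continuous be ->
  al 0 = circle s1 -> al 1 = circle s3 -> be 0 = circle s2 -> be 1 = circle s4 ->
  (forall t, 0 < t < 1 -> disk2 (al t)) -> (forall t, 0 < t < 1 -> disk2 (be t)) ->
  exists s t, [/\ 0 <= s <= 1, 0 <= t <= 1 & al s = be t].
Proof.
move=> h0 h1 h2 h3 h4 cal cbe al0 al1 be0 be1 Dal Dbe.
apply: contrapT => noX.
have xal s : 0 <= s <= 1 -> 0 < chord2 tau (al s).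
  move=> /andP[]; rewrite le_eqVlt => /predU1P[<- _|s0].
    by rewrite al0; apply: chord2_circle; lra.
  rewrite le_eqVlt => /predU1P[->|s1'].
    by rewrite al1; apply: chord2_circle; lra.
  by apply: chord2_disk; apply: Dal; rewrite s0.
have xbe s : 0 <= s <= 1 -> 0 < chord2 tau (be s).
  move=> /andP[]; rewrite le_eqVlt => /predU1P[<- _|s0].
    by rewrite be0; apply: chord2_circle; lra.
  rewrite le_eqVlt => /predU1P[->|s1'].
    by rewrite be1; apply: chord2_circle; lra.
  by apply: chord2_disk; apply: Dbe; rewrite s0.
pose Phi p := cayley tau (al p.1) - cayley tau (be p.2).
have cPhi p : unit_square p -> {for p, continuous Phi}.
  move=> [p1 p2]; apply: continuousB.
    apply: (@continuous_comp _ _ _ (fun p => al p.1) (cayley tau)).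
      by apply: (@continuous_comp _ _ _ fst al); [exact: continuous_fst2|exact: cal].
    by apply: cayley_continuous; exact: xal.
  apply: (@continuous_comp _ _ _ (fun p => be p.2) (cayley tau)).
    by apply: (@continuous_comp _ _ _ snd be); [exact: continuous_snd2|exact: cbe].
  by apply: cayley_continuous; exact: xbe.
have Phi0 p : unit_square p -> Phi p != 0.
  move=> [p1 p2]; rewrite subr_eq0; apply/eqP => /cayley_inj E.
  by apply: noX; exists p.1, p.2; split => //; apply: E; [exact: xal|exact: xbe].
have [N1 hN1] := square_parity cPhi Phi0.
have [d d0 [N2 hN2]] := fine_grid cPhi Phi0.
pose N := (N1 + N2).+1.
have := hN1 N.+1; rewrite /N leqW ?leqW ?leq_addr // => /(_ erefl).
have [|l c] := hN2 N.+1; first by rewrite /N leqW ?leqW ?leq_addl.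
have c1 : (cayley tau (circle s1)).2 = 0 by rewrite cayley_circle //; lra.
have c2 : (cayley tau (circle s2)).2 = 0 by rewrite cayley_circle //; lra.
have c3 : (cayley tau (circle s3)).2 = 0 by rewrite cayley_circle //; lra.
have c4 : (cayley tau (circle s4)).2 = 0 by rewrite cayley_circle //; lra.
have l12 := @cayley_circle_lt tau s1 s2 h0 h1 ltac:(lra).
have l23 := @cayley_circle_lt tau s2 s3 ltac:(lra) h2 ltac:(lra).
have l34 := @cayley_circle_lt tau s3 s4 ltac:(lra) h3 h4.
have x01 i : (i <= N.+1)%N -> 0 <= (i%:R / N.+1%:R : R) <= 1.
  by move=> iN; rewrite divr_ge0 //= ler_pdivrMr // mul1r ler_nat.
have x01' i : (0 < i)%N -> (i < N.+1)%N -> 0 < (i%:R / N.+1%:R : R) < 1.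
  by move=> i0 iN; rewrite divr_gt0 ?ltr0n //= ltr_pdivrMr // mul1r ltr_nat.
have xN : N.+1%:R / N.+1%:R = 1 :> R by rewrite divff.
rewrite -/N.
have -> : path_parity (fun s => Phi (s, 0)) N.+1 = false.
  rewrite /path_parity (@loop_parity_head _ true).
    rewrite /crossing /Phi /= mul0r al0 be0.
    by rewrite [0 < _](_ : _ = false) ?andbF //; apply/negbTE; rewrite -leNgt; lra.
  move=> i iN; rewrite /upper /Phi /= be0 c2 subr0.
  move: (iN); rewrite leq_eqVlt => /predU1P[[->]|iN'].
    by rewrite xN al1 c3 ltxx eqxx /= subr_gt0 l23.
  by rewrite cayley_disk //; apply: Dal; exact: x01'.
have -> : path_parity (fun s => Phi (0, s)) N.+1 = false.
  rewrite /path_parity (@loop_parity_head _ false).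
    rewrite /crossing /Phi /= mul0r al0 be0.
    by rewrite [0 < _](_ : _ = false) ?andbF //; apply/negbTE; rewrite -leNgt; lra.
  move=> i iN; rewrite /upper /Phi /= al0 c1 sub0r.
  move: (iN); rewrite leq_eqVlt => /predU1P[[->]|iN'].
    rewrite xN be1 c4 oppr0 ltxx eqxx /=.
    by apply/negbTE; rewrite -leNgt; lra.
  have : 0 < (cayley tau (be (i.+1%:R / N.+1%:R))).2.
    by rewrite cayley_disk //; apply: Dbe; exact: x01'.
  by move=> H; rewrite oppr_gt0 oppr_eq0 gt_eqF // ltNge ltW.
have -> : path_parity (fun s => Phi (1, s)) N.+1 = true.
  rewrite /path_parity (@loop_parity_head _ false).
    rewrite /crossing [upper _](_ : _ = true); last first.
      by rewrite /upper /Phi /= mul0r al1 be0 c2 c3 subrr ltxx eqxx /= subr_gt0.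
    rewrite [upper _](_ : _ = false).
      by rewrite /Phi /= mul0r al1 be0 subr_gt0.
    rewrite /upper /Phi /= al1 c3 sub0r.
    have : 0 < (cayley tau (be (1%:R / N.+1%:R))).2.
      by rewrite cayley_disk //; apply: Dbe; exact: x01'.
    by move=> H; rewrite oppr_gt0 oppr_eq0 gt_eqF // ltNge ltW.
  move=> i iN; rewrite /upper /Phi /= al1 c3 sub0r.
  move: (iN); rewrite leq_eqVlt => /predU1P[[->]|iN'].
    rewrite xN be1 c4 oppr0 ltxx eqxx /=.
    by apply/negbTE; rewrite -leNgt; lra.
  have : 0 < (cayley tau (be (i.+1%:R / N.+1%:R))).2.
    by rewrite cayley_disk //; apply: Dbe; exact: x01'.
  by move=> H; rewrite oppr_gt0 oppr_eq0 gt_eqF // ltNge ltW.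
(* On this side the last edge changes half-plane too, as it ends at x3 - x4 < 0. Its starting point
   is within d of an end of size at least 2 d, so its first coordinate is negative and nothing is
   crossed; this is the use of [fine_grid]. *)
have -> // : path_parity (fun s => Phi (s, 1)) N.+1 = false.
rewrite /path_parity loop_parityS (@loop_parity_head _ true).
  rewrite /crossing [X in X (+) _](_ : _ = false); last first.
    rewrite /Phi /= mul0r al0 be1.
    by rewrite [0 < _](_ : _ = false) ?andbF //; apply/negbTE; rewrite -leNgt; lra.
  rewrite /= [0 < _](_ : _ = false) ?andbF //; apply/negbTE; rewrite -leNgt.
  have S1 : unit_square ((N.+1%:R / N.+1%:R, 1) : R * R).
    by split; rewrite /= ?xN; lra.
  have := l _ S1; rewrite xN /large /Phi /= al1 be1 c3 c4 subrr normr0.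
  rewrite [2 * d <= 0]leNgt mulr_gt0 //= orbF => H1.
  have S2 : unit_square ((N%:R / N.+1%:R, 1) : R * R).
    by split=> /=; [apply: x01|lra].
  have := c _ ((N.+1%:R / N.+1%:R, 1) : R * R) S2.
  rewrite /= subrr normr0 invr_ge0 ler0n distrC -mulrBl -[N.+1%:R in X in X -> _]natr1.
  rewrite [N%:R + 1]addrC addrK mul1r ger0_norm // lexx => /(_ erefl erefl).
  rewrite xN /close /Phi /= al1 be1 => /andP[+ _].
  move: H1; rewrite ler0_norm; last lra.
  by rewrite ltr_norml => H1 /andP[H2 H3]; lra.
move=> i iN; rewrite /upper /Phi /= be1 c4 subr0 cayley_disk //.
by apply: Dal; exact: x01'.
Qed.

End crossing_paths.

(** * Non-oscillation by preimages of segments *)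

Section no_alternation.
Context {R : realType}.
Implicit Types (p q : R * R).

Definition clamp (t : R) : R := Num.max 0 (Num.min 1 t).

Lemma clamp01 t : 0 <= clamp t <= 1.
Proof. by rewrite /clamp le_max lexx /= ge_max ler01 /= ge_min lexx. Qed.

Lemma clamp_le0 t : t <= 0 -> clamp t = 0.
Proof.
by move=> t0; rewrite /clamp (min_idPr _) ?(max_idPl _) // (le_trans t0).
Qed.

Lemma clamp_ge1 t : 1 <= t -> clamp t = 1.
Proof. by move=> t1; rewrite /clamp (min_idPl _) // (max_idPr _). Qed.

Lemma clamp_continuous : continuous clamp.
Proof.
move=> t; apply: continuous_max; first exact: cvg_cst.
by apply: continuous_min; [exact: cvg_cst|exact: cvg_id].
Qed.

Variable F : R * R -> R * R.
Hypothesis cF : forall p, disk2 p -> {for p, continuous F}.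
Hypothesis injF : forall p q, disk2 p -> disk2 q -> F p = F q -> p = q.
Hypothesis convexF : forall p q t, disk2 p -> disk2 q -> 0 <= t <= 1 ->
  exists2 r, disk2 r & F r = F p + t *: (F q - F p).

(** Continuity is that of the inverse of F. [clamp] extends the path constantly beyond [0, 1],
    because [paths_cross] asks for continuity on the whole line and [boundary_path]
    reparametrizes. *)
Lemma segment_lift p q : disk2 p -> disk2 q -> exists g : R -> R * R,
  [/\ continuous g, forall t, disk2 (g t), forall t, t <= 0 -> g t = p,
      forall t, 1 <= t -> g t = q &
      forall t, F (g t) = F p + clamp t *: (F q - F p)].
Proof.
move=> Dp Dq.
have [g hg] := choice (fun t => (exists2P _ _).1 (convexF Dp Dq (clamp01 t))).
exists g; split=> [||t t0|t t1|t].
- move=> t; have [Dg Fg] := hg t.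
  apply/cvgrPdist_lt => /= e e0.
  have [d d0 hd] := inverse_continuous cF injF Dg e0.
  have : {for t, continuous (fun t => F p + clamp t *: (F q - F p))}.
    apply: continuousD; first exact: cvg_cst.
    by apply: continuousZr_tmp; exact: clamp_continuous.
  move=> /cvgrPdist_lt/(_ _ d0); apply: filterS => s.
  have [Ds <-] := hg s; rewrite -Fg distrC => /(hd _ Ds).
  by rewrite distrC.
- by move=> t; have [] := hg t.
- have [Dg Fg] := hg t; apply: injF => //.
  by rewrite Fg clamp_le0 // scale0r addr0.
- have [Dg Fg] := hg t; apply: injF => //.
  by rewrite Fg clamp_ge1 // scale1r addrC subrK.
- by have [] := hg t.
Qed.

Definition radial (r s : R) : R * R := r *: circle s.

Lemma radial_disk r s : 0 <= r < 1 -> disk2 (radial r s).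
Proof.
move=> r1; rewrite /disk2 /radial /=.
have -> : (r *: cos s) ^+ 2 + (r *: sin s) ^+ 2 = r ^+ 2.
  by rewrite /GRing.scale /= !exprMn -mulrDr cos2Dsin2 mulr1.
by have /andP[r0 r1'] := r1; rewrite expr_lt1.
Qed.

Section level.
Variables (l : R * R -> R) (c : R).
Hypothesis linl : forall p q t, l (p + t *: (q - p)) = (1 - t) * l p + t * l q.

(** Three pieces, each over a third of the parameter: inwards along one radius, along the preimage
    of a segment, outwards along the other radius. On the middle piece l stays above c because it is
    affine along the segment. *)
Lemma boundary_path rho s s' : 0 <= rho < 1 ->
  (forall r, rho <= r < 1 -> c < l (F (radial r s))) ->
  (forall r, rho <= r < 1 -> c < l (F (radial r s'))) ->
  exists g : R -> R * R, [/\ continuous g, g 0 = circle s, g 1 = circle s' &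
    forall t, 0 < t < 1 -> disk2 (g t) /\ c < l (F (g t))].
Proof.
move=> rho1 hs hs'.
have [g [cg Dg g0 g1 Fg]] := segment_lift (radial_disk s rho1) (radial_disk s' rho1).
pose a t := (1 - rho) * Num.max 0 (1 - 3 * t).
pose b t := (1 - rho) * Num.max 0 (3 * t - 2).
(* Each summand is constant while another one moves, so continuity needs no case distinction. *)
exists (fun t => g (3 * t - 1) + a t *: circle s + b t *: circle s'); split.
- apply: continuous_for => t; apply: continuousD; first apply: continuousD.
  + apply: (@continuous_comp _ _ _ (fun t : R => 3 * t - 1) g); last exact: cg.
    apply: continuousB; last exact: cvg_cst.
    by apply: continuousM; [exact: cvg_cst|exact: cvg_id].
  + apply: continuousZr_tmp; apply: continuousM; first exact: cvg_cst.
    apply: continuous_max; first exact: cvg_cst.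
    apply: continuousB; first exact: cvg_cst.
    by apply: continuousM; [exact: cvg_cst|exact: cvg_id].
  + apply: continuousZr_tmp; apply: continuousM; first exact: cvg_cst.
    apply: continuous_max; first exact: cvg_cst.
    apply: continuousB; last exact: cvg_cst.
    by apply: continuousM; [exact: cvg_cst|exact: cvg_id].
- rewrite g0; last lra.
  rewrite /a /b (max_idPr _); last lra.
  rewrite (max_idPl _); last lra.
  by rewrite !mulr0 scale0r addr0 /radial -scalerDl (_ : _ + _ = 1) ?scale1r //; lra.
- rewrite g1; last lra.
  rewrite /a /b (max_idPl _); last lra.
  rewrite (max_idPr _); last lra.
  by rewrite mulr0 scale0r addr0 /radial -scalerDl (_ : _ + _ = 1) ?scale1r //; lra.
- move=> t t01; have [t3|t3] := leP (3 * t) 1.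
    rewrite g0; last lra.
    rewrite /a /b (max_idPr _); last lra.
    rewrite (max_idPl _); last lra.
    rewrite mulr0 scale0r addr0 /radial -scalerDl.
    have h : rho <= rho + (1 - rho) * (1 - 3 * t) < 1.
      by apply/andP; split; nra.
    by split; [apply: radial_disk; lra|exact: hs].
  have [t2|t2] := leP (3 * t) 2.
    rewrite /a /b (max_idPl _); last lra.
    rewrite (max_idPl _); last lra.
    rewrite mulr0 !scale0r !addr0; split; first exact: Dg.
    rewrite Fg linl; have := clamp01 (3 * t - 1).
    have k : rho <= rho < 1 by lra.
    have := hs _ k; have := hs' _ k.
    move: (clamp _) (l _) (l _) => x y z cz cy /andP[x0 x1].
    have [x1'|x1'] := ltP x 1; last by rewrite (_ : x = 1); lra.
    have p1 : 0 < (1 - x) * (y - c) by apply: mulr_gt0; lra.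
    have p2 : 0 <= x * (z - c) by apply: mulr_ge0; lra.
    lra.
  rewrite g1; last lra.
  rewrite /a /b (max_idPl _); last lra.
  rewrite (max_idPr _); last lra.
  rewrite mulr0 scale0r addr0 /radial -scalerDl.
  have h : rho <= rho + (1 - rho) * (3 * t - 2) < 1.
    by apply/andP; split; nra.
  by split; [apply: radial_disk; lra|exact: hs'].
Qed.

End level.

(** The two paths meet by [paths_cross], and not on the circle since their four ends are distinct;
    at the meeting point l would be both above and below c. The assumptions are on final pieces of
    radii, since radial limits are what Fatou's theorem supplies. *)
Lemma no_alternation (l : R * R -> R) c rho tau s1 s2 s3 s4 :
  (forall p q t, l (p + t *: (q - p)) = (1 - t) * l p + t * l q) ->
  tau < s1 -> s1 < s2 -> s2 < s3 -> s3 < s4 -> s4 < tau + 2 * pi ->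
  0 <= rho < 1 ->
  (forall r, rho <= r < 1 -> c < l (F (radial r s1))) ->
  (forall r, rho <= r < 1 -> l (F (radial r s2)) < c) ->
  (forall r, rho <= r < 1 -> c < l (F (radial r s3))) ->
  (forall r, rho <= r < 1 -> l (F (radial r s4)) < c) -> False.
Proof.
move=> linl h0 h1 h2 h3 h4 rho1 H1 H2 H3 H4.
have [al [cal al0 al1 hal]] := boundary_path linl rho1 H1 H3.
have [||||be [cbe be0 be1 hbe]] := @boundary_path (fun p => - l p) (- c) _ rho s2 s4.
- by move=> p q t; rewrite linl; ring.
- exact: rho1.
- by move=> r /H2; rewrite ltrN2.
- by move=> r /H4; rewrite ltrN2.
have [s [t [s01 t01 E]]] := paths_cross h0 h1 h2 h3 h4 cal cbe al0 al1 be0 be1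
  (fun t ht => (hal t ht).1) (fun t ht => (hbe t ht).1).
have circ (x : R) : ~ disk2 (circle x) by rewrite /disk2 /= cos2Dsin2 ltxx.
have cc (x y : R) : tau < x -> x < y -> y < tau + 2 * pi -> circle x <> circle y.
  move=> xt xy yt e; have := cayley_circle_lt xt xy yt.
  by rewrite e ltxx.
have hs : s = 0 \/ s = 1 \/ 0 < s < 1.
  move: s01 => /andP[]; rewrite le_eqVlt => /predU1P[<-|->]; first by left.
  by rewrite le_eqVlt => /predU1P[->|->]; right; [left|right].
have ht : t = 0 \/ t = 1 \/ 0 < t < 1.
  move: t01 => /andP[]; rewrite le_eqVlt => /predU1P[<-|->]; first by left.
  by rewrite le_eqVlt => /predU1P[->|->]; right; [left|right].
case: hs => [s0|[s0|s0]]; case: ht => [t0|[t0|t0]].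
- by move: E; rewrite s0 t0 al0 be0; apply: cc; lra.
- by move: E; rewrite s0 t0 al0 be1; apply: cc; lra.
- by apply: (circ s1); rewrite -al0 -s0 E; have [] := hbe t t0.
- by move: E; rewrite s0 t0 al1 be0 => /esym; apply: cc; lra.
- by move: E; rewrite s0 t0 al1 be1; apply: cc; lra.
- by apply: (circ s3); rewrite -al1 -s0 E; have [] := hbe t t0.
- by apply: (circ s2); rewrite -be0 -t0 -E; have [] := hal s s0.
- by apply: (circ s4); rewrite -be1 -t0 -E; have [] := hal s s0.
- have [_ a1] := hal s s0; have [_ a2] := hbe t t0.
  by move: a1 a2; rewrite E; lra.
Qed.

End no_alternation.

(** * The Poisson kernel near a boundary point *)

Section kernel.
Context {R : realType}.

Lemma MVT_le (f df : R -> R) (a b : R) : a <= b ->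
  (forall x, a <= x <= b -> is_derive x 1 f (df x)) ->
  exists2 c, a <= c <= b & f b - f a = df c * (b - a).
Proof.
move=> ab hf; have [||c cab E] := @MVT_segment R f df a b ab.
- by move=> x; rewrite in_itv /= => /andP[h1 h2]; apply: hf; rewrite !ltW.
- apply: derivable_within_continuous => x; rewrite in_itv /= => h.
  exact: (@ex_derive _ _ _ _ _ _ _ (hf x h)).
by exists c => //; move: cab; rewrite in_itv.
Qed.

Lemma sin_lipschitz (a b : R) : `|sin a - sin b| <= `|a - b|.
Proof.
wlog ab : a b / b <= a.
  by move=> H; have [/H//|/ltW/H] := leP b a; rewrite distrC [leRHS]distrC.
have [c _ ->] := @MVT_le sin cos b a ab (fun x _ => is_derive_sin x).
rewrite normrM ler_piMl // ler_norml; have := cos2Dsin2 c.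
by have := sqr_ge0 (sin c); move: (cos c) (sin c) => x y h1 h2; apply/andP; split; nra.
Qed.

(** In sin v = 2 sin (v / 2) cos (v / 2) the mean value theorem replaces sin (v / 2) by v / 2 times
    a cosine; both cosines are taken on [0, pi / 4], hence are at least 1 / sqrt 2. *)
Lemma sin_ge_half (v : R) : 0 <= v <= pi / 2 -> v / 2 <= sin v.
Proof.
move=> /andP[v0 v1].
have [c /andP[c0 c1]] := @MVT_le sin cos 0 (v / 2) ltac:(lra) (fun x _ => is_derive_sin x).
rewrite sin0 !subr0 => E.
have half (x : R) : 0 <= x <= pi / 4 -> 0 < cos x /\ 1 <= 2 * cos x ^+ 2.
  move=> hx; have hpi := pi_gt0 R; split; first by apply: cos_gt0_pihalf; lra.
  have : 0 <= cos (x *+ 2) by apply: cos_ge0_pihalf; rewrite (mulr2n x); lra.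
  by rewrite cos_mulr2n; lra.
have [a1 a2] := half c ltac:(lra); have [b1 b2] := half (v / 2) ltac:(lra).
rewrite {2}(_ : v = (v / 2) *+ 2); last by rewrite mulr2n; field.
rewrite sin_mulr2n E.
have h : 1 / 2 <= cos c * cos (v / 2).
  have h0 : 0 < cos c * cos (v / 2) by exact: mulr_gt0.
  have h1 : 1 <= 4 * (cos c * cos (v / 2)) ^+ 2.
    have := @ler_pM R 1 (2 * cos c ^+ 2) 1 (2 * cos (v / 2) ^+ 2) ler01 ler01 a2 b2.
    by rewrite mulr1 exprMn; lra.
  by move: h0 h1; set y := _ * _; nra.
move: h; set y := cos c; set z := cos _; have v2 : 0 <= v / 2 by lra.
by move=> h; have := @ler_wpM2l R (v / 2) v2 _ _ h; lra.
Qed.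

Lemma sin_sqr_ge (v : R) : - pi <= v <= pi -> v ^+ 2 / 16 <= sin (v / 2) ^+ 2.
Proof.
move=> hv; wlog v0 : v hv / 0 <= v.
  move=> H; have [/H//|v0] := leP 0 v; first exact.
  by have := H (- v); rewrite sqrrN mulNr sinN sqrrN; apply; lra.
have := @sin_ge_half (v / 2) ltac:(lra).
by move: (sin _) => y h; nra.
Qed.

(* The Poisson kernel at the point (1 - x) e^(i al), as a function of
   v = t - al. *)
Definition pk (x v : R) : R :=
  x * (2 - x) / (x ^+ 2 + (1 - x) * (4 * sin (v / 2) ^+ 2)).

Lemma pk_den_gt0 (x v : R) : 0 < x < 1 -> 0 < x ^+ 2 + (1 - x) * (4 * sin (v / 2) ^+ 2).
Proof.
move=> hx; rewrite ltr_wpDr ?exprn_gt0 //; last lra.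
by apply: mulr_ge0; [lra|rewrite mulr_ge0 ?sqr_ge0].
Qed.

Lemma pk_ge0 x v : 0 < x < 1 -> 0 <= pk x v.
Proof.
move=> hx; have D := ltW (pk_den_gt0 v hx).
by rewrite /pk; apply: divr_ge0 => //; apply: mulr_ge0; lra.
Qed.

Lemma pk_continuous (x al : R) : 0 < x < 1 -> continuous (fun t => pk x (t - al)).
Proof.
move=> hx; apply: continuous_for => t.
have cs : {for t, continuous (fun t : R => sin ((t - al) / 2))}.
  apply: (@continuous_comp _ _ _ (fun t : R => (t - al) / 2) sin); last exact: continuous_sin.
  apply: continuousM; last exact: cvg_cst.
  by apply: continuousB; [exact: cvg_id|exact: cvg_cst].
apply: continuousM; first exact: cvg_cst.
apply: continuousV; first by rewrite gt_eqF // pk_den_gt0.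
apply: continuousD; first exact: cvg_cst.
apply: continuousM; first exact: cvg_cst.
apply: continuousM; first exact: cvg_cst.
exact: continuous_sqr.
Qed.

Definition polarC (x al : R) : R[i]^o := ((1 - x) * cos al) +i* ((1 - x) * sin al).

Lemma normc_polarC x al : x <= 1 -> Normc.normc (polarC x al) = 1 - x.
Proof.
move=> x1; rewrite /= !exprMn -mulrDr cos2Dsin2 mulr1 sqrtr_sqr ger0_norm //; lra.
Qed.

Lemma poisson_kernelE x al t : 0 < x <= 1 ->
  poisson_kernel (polarC x al) t = pk x (t - al).
Proof.
move=> /andP[x0 x1]; rewrite /poisson_kernel normc_polarC //.
rewrite /pk; congr (_ / _); first ring.
rewrite /= sqr_sqrtr ?addr_ge0 ?sqr_ge0 //.
have c1 : cos t * cos al + sin t * sin al = 1 - 2 * sin ((t - al) / 2) ^+ 2.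
  rewrite -cosB {1}(_ : t - al = ((t - al) / 2) *+ 2); last by rewrite mulr2n; field.
  by rewrite cos_mulr2n; have := cos2Dsin2 ((t - al) / 2); lra.
have h1 := cos2Dsin2 t; have h2 := cos2Dsin2 al.
move: c1 h1 h2; set s := sin ((t - al) / 2).
set a := cos t; set b := sin t; set c := cos al; set d := sin al => c1 h1 h2.
transitivity ((a ^+ 2 + b ^+ 2) - 2 * (1 - x) * (a * c + b * d) +
  (1 - x) ^+ 2 * (c ^+ 2 + d ^+ 2)); first ring.
by rewrite c1 h1 h2; ring.
Qed.

(** The condition on al is nontangential approach to e^(i c). It moves the sine in the denominator
    by at most K x / 2, which the term x^2 absorbs at the price of the constant; the result is a
    kernel centred at c. *)
Lemma pk_upper K x al c t : 0 < x <= 1 / 2 -> 0 <= K -> `|al - c| <= K * x ->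
  `|t - c| <= pi ->
  pk x (t - al) <= (32 + 16 * K ^+ 2) * (x / (x ^+ 2 + (t - c) ^+ 2)).
Proof.
move=> /andP[x0 x1] K0 alc; rewrite ler_norml => tc.
have s1 := sin_sqr_ge tc.
have := sin_lipschitz ((t - c) / 2) ((t - al) / 2).
rewrite (_ : (t - c) / 2 - (t - al) / 2 = (al - c) / 2); last by field.
rewrite normrM (@ger0_norm _ 2^-1) //.
have D0 := @pk_den_gt0 x (t - al) ltac:(lra).
move: s1 D0; rewrite /pk.
set s := sin ((t - c) / 2); set s' := sin ((t - al) / 2) => s1 D0 hs.
have {}hs : s ^+ 2 <= 2 * s' ^+ 2 + K ^+ 2 * x ^+ 2 / 2.
  have : `|s - s'| <= K * x / 2 by apply: le_trans hs _; rewrite mulrC [leRHS]mulrC; lra.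
  rewrite ler_norml => /andP[h1 h2].
  have h3 : (s - s') ^+ 2 <= (K * x / 2) ^+ 2.
    rewrite -[X in X <= _]real_normK ?num_real // lerXn2r ?nnegrE //.
      by rewrite mulr_ge0 ?mulr_ge0 //; lra.
    by rewrite ler_norml h1 h2.
  have h4 := sqr_ge0 (s - 2 * s'); nra.
have y0 : 0 < x ^+ 2 + (t - c) ^+ 2 by rewrite ltr_wpDr ?sqr_ge0 // exprn_gt0.
rewrite mulrA ler_pdivrMr // mulrAC ler_pdivlMr //.
have q : x ^+ 2 + (t - c) ^+ 2 <= (16 + 8 * K ^+ 2) * (x ^+ 2 + (1 - x) * (4 * s' ^+ 2)).
  have k2 := sqr_ge0 K; have ss := sqr_ge0 s'; have xx := sqr_ge0 x.
  have p1 : 2 * s' ^+ 2 <= (1 - x) * (4 * s' ^+ 2) by nra.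
  have p2 : (16 + 8 * K ^+ 2) * (x ^+ 2 + 2 * s' ^+ 2) <=
    (16 + 8 * K ^+ 2) * (x ^+ 2 + (1 - x) * (4 * s' ^+ 2)).
    by rewrite ler_wpM2l ?lerD2l //; lra.
  apply: le_trans p2.
  have : 0 <= K ^+ 2 * s' ^+ 2 by exact: mulr_ge0.
  nra.
have x2 : x * (2 - x) <= 2 * x by have := sqr_ge0 x; lra.
have D1 := ltW D0.
apply: (@le_trans _ _ (2 * x * (x ^+ 2 + (t - c) ^+ 2))).
  by rewrite ler_wpM2r // ltW.
rewrite (_ : (32 + 16 * K ^+ 2) * x * _ = 2 * x * ((16 + 8 * K ^+ 2) *
  (x ^+ 2 + (1 - x) * (4 * s' ^+ 2)))); last by ring.
by rewrite ler_wpM2l //; lra.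
Qed.

(** The bound is relative to the kernel itself, so it can be integrated against any |h|. It plays
    the part of an estimate of the derivative in x of a Poisson integral. *)
Lemma pk_lipschitz x x' v : 0 < x <= 1 / 2 -> 0 < x' <= 1 / 2 -> x <= 2 * x' ->
  `|pk x v - pk x' v| <= 16 * (`|x - x'| / x) * pk x v.
Proof.
move=> hx hx' xx'.
have D0 := @pk_den_gt0 x v ltac:(lra); have D0' := @pk_den_gt0 x' v ltac:(lra).
rewrite /pk; move: D0 D0'; set S := 4 * sin (v / 2) ^+ 2 => D0 D0'.
have S0 : 0 <= S by rewrite /S mulr_ge0 ?sqr_ge0.
rewrite (_ : _ - _ = (x - x') * ((S * (2 - x - x' + x * x') - 2 * x * x') /
  ((x ^+ 2 + (1 - x) * S) * (x' ^+ 2 + (1 - x') * S)))); last first.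
  by field; rewrite !gt_eqF.
rewrite normrM (_ : 16 * _ * _ = `|x - x'| * (16 * (2 - x) / (x ^+ 2 + (1 - x) * S))); last first.
  by field; rewrite !gt_eqF //; lra.
apply: ler_wpM2l => //; rewrite normrM [X in _ * X <= _]ger0_norm; last first.
  by rewrite invr_ge0 ltW // mulr_gt0.
rewrite ler_pdivrMr ?mulr_gt0 //.
rewrite (_ : _ * (_ * _) = (x' ^+ 2 + (1 - x') * S) * (16 * (2 - x))); last first.
  by field; rewrite gt_eqF.
have b : `|S * (2 - x - x' + x * x') - 2 * x * x'| <= 2 * S + 2 * x * x'.
  have p := @mulr_ge0 R x x' ltac:(lra) ltac:(lra).
  have xx1 : x * x' <= 1 / 4 by nra.
  have l1 : 0 <= S * (2 - x - x' + x * x') by rewrite mulr_ge0 //; lra.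
  have l2 : S * (2 - x - x' + x * x') <= S * 2 by rewrite ler_wpM2l //; nra.
  by rewrite ler_norml; apply/andP; split; lra.
apply: le_trans b _.
have q1 : S / 2 <= (1 - x') * S by nra.
have q2 : x * x' <= 2 * x' ^+ 2 by nra.
have q3 := sqr_ge0 x'.
have q4 : 24 * (x' ^+ 2 + S / 2) <= (x' ^+ 2 + (1 - x') * S) * (16 * (2 - x)).
  rewrite [leRHS]mulrC; apply: ler_pM; lra.
lra.
Qed.

End kernel.

(** * Translation invariance and integrals over a period *)

Section shift.
Context {R : realType}.
Local Notation mu := (@lebesgue_measure R).

Lemma measurable_addr (tau : R) : measurable_fun setT (fun x : R => x + tau).
Proof. by apply: continuous_measurable_fun => x; apply: continuousD; [exact: cvg_id|exact: cvg_cst]. Qed.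

(** The translated measure has the same values on half-open intervals, so uniqueness of Lebesgue
    measure identifies the two. *)
Lemma lebesgue_measure_shift (tau : R) (A : set R) : measurable A ->
  mu A = pushforward mu (fun x => x + tau) A.
Proof.
pose phi : R -> R := fun x => x + tau.
have mphi : measurable_fun setT phi by exact: measurable_addr.
pose M : {measure set (measurableTypeR R) -> \bar R} :=
  measure_function_pushforward__canonical__measure_function_Measure
    (T1 := measurableTypeR R) (T2 := measurableTypeR R) (@lebesgue_measure R) mphi.
move=> mA; have H := @lebesgue_measure_unique R M _ A mA; apply: H.
move=> X [[a b]] /= _ <-; change (mu `]a, b]%classic = mu (phi @^-1` `]a, b]%classic)).
have -> : phi @^-1` `]a, b]%classic = `]a - tau, b - tau]%classic.
  by apply/seteqP; split => x /=; rewrite !in_itv /= ltrBlDr lerBrDr.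
rewrite !lebesgue_measure_itv /= !lte_fin ltrD2r; case: ifP => // _.
by rewrite -!EFinD; congr EFin; ring.
Qed.

Lemma preimage_addr_itv (tau a b : R) :
  (fun x : R => x + tau) @^-1` `[a + tau, b + tau]%classic = `[a, b]%classic.
Proof. by apply/seteqP; split => x /=; rewrite !in_itv /= !lerD2r. Qed.

Lemma integral_shift (f : R -> R) (tau a b : R) :
  mu.-integrable `[a, b] (EFin \o f) ->
  mu.-integrable `[a + tau, b + tau] (EFin \o (fun x => f (x - tau))) /\
  \int[mu]_(x in `[a + tau, b + tau]) f (x - tau) = \int[mu]_(x in `[a, b]) f x.
Proof.
move=> fi; pose g : R -> \bar R := (EFin \o f) \_ `[a, b].
pose phi : R -> R := fun x => x + tau.
have mphi : measurable_fun setT phi by exact: measurable_addr.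
have gi : mu.-integrable setT g by apply/integrable_restrict => //; rewrite setTI.
have mg : measurable_fun setT g by apply: measurable_int gi.
pose h y := g (y - tau).
have mh : measurable_fun setT h.
  by apply: measurableT_comp => //; exact: measurable_addr.
have mD : measurable (`[a + tau, b + tau]%classic : set R) by [].
have hphi : h \o phi = g by apply/funext => x; rewrite /h /phi /= addrK.
have ghi : mu.-integrable (phi @^-1` `[a + tau, b + tau]%classic) (h \o phi).
  by rewrite hphi preimage_addr_itv; apply: integrableS gi.
have E := @integral_pushforward _ _ (measurableTypeR R) (measurableTypeR R) R phi mphi mu _ h mh ghi mD.
have I := @integrable_pushforward _ _ (measurableTypeR R) (measurableTypeR R) R phi mphi mu _ h mh ghi mD.
have hf x : `[a + tau, b + tau]%classic x -> h x = (f (x - tau))%:E.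
  rewrite /h /g /= in_itv /= => hx; rewrite patchE mem_set //=.
  by rewrite in_itv /=; lra.
have gf x : `[a, b]%classic x -> g x = (f x)%:E.
  by move=> hx; rewrite /g patchE mem_set.
pose M : {measure set (measurableTypeR R) -> \bar R} :=
  measure_function_pushforward__canonical__measure_function_Measure
    (T1 := measurableTypeR R) (T2 := measurableTypeR R) (@lebesgue_measure R) mphi.
have meq D (k : R -> \bar R) : (\int[M]_(y in D) k y = \int[mu]_(y in D) k y)%E.
  have := @eq_measure_integral _ (measurableTypeR R) R D mu M k; apply.
  by move=> A mA _; rewrite [RHS](@lebesgue_measure_shift tau).
split.
  apply: (@eq_integrable _ _ _ mu _ mD h) => //.
    by move=> x; rewrite inE => /hf.
  apply/integrableP; split; first exact: measurable_funTS.
  have /integrableP[_] := I; apply: le_lt_trans; rewrite le_eqVlt; apply/orP; left; apply/eqP.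
  exact: (esym (meq _ _)).
rewrite /Rintegral; congr fine.
transitivity (\int[mu]_(y in `[(a + tau)%R, (b + tau)%R]) h y)%E.
  by apply: eq_integral => x; rewrite inE => /hf.
rewrite -meq; apply: (etrans E); rewrite hphi preimage_addr_itv.
by apply: eq_integral => x; rewrite inE => /gf.
Qed.

Section periodic.
Variables (f : R -> R) (T : R).
Hypotheses (T0 : 0 < T) (fT : forall x, f (x + T) = f x).

Lemma integrable_itvU (a b c : R) : a <= b -> b <= c ->
  mu.-integrable `[a, b] (EFin \o f) -> mu.-integrable `[b, c] (EFin \o f) ->
  mu.-integrable `[a, c] (EFin \o f) /\
  \int[mu]_(x in `[a, c]) f x = \int[mu]_(x in `[a, b]) f x + \int[mu]_(x in `[b, c]) f x.
Proof.
move=> ab bc i1 i2.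
have U : `[a, c]%classic = `[a, b] `|` `]b, c] :> set R.
  apply/seteqP; split=> x /=; rewrite !in_itv /=.
    by move=> h; have [xb|xb] := leP x b; [left|right]; lra.
  by case; lra.
have i2' : mu.-integrable `]b, c] (EFin \o f).
  by apply: integrableS i2 => //; apply: subset_itvr; rewrite bnd_simp.
have dj : [disjoint `[a, b]%classic & `]b, c]%classic].
  by rewrite disj_set2E; apply/eqP/seteqP; split=> x //= []; rewrite !in_itv /=; lra.
have mf : measurable_fun `[a, c] (EFin \o f).
  by rewrite U; apply/measurable_funU => //; split;
    [exact: measurable_int i1|exact: measurable_int i2'].
have i : mu.-integrable `[a, c] (EFin \o f).
  apply/integrableP; split => //; rewrite U ge0_integral_setU //.
    have /integrableP[_ h1] := i1; have /integrableP[_ h2] := i2'.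
    exact: lte_add_pinfty.
  by rewrite -U; apply: measurableT_comp.
split => //; rewrite U Rintegral_setU -?U //.
by congr (_ + _); apply: Rintegral_itv_obnd_cbnd.
Qed.

(** A shift by at most one period cuts the interval in two and carries one piece over by T. Both
    directions are needed, as b may lie on either side of a in [integral_period]. *)
Lemma integral_period_step (a h : R) : 0 <= h <= T ->
  mu.-integrable `[a, a + T] (EFin \o f) ->
  (mu.-integrable `[a + h, a + h + T] (EFin \o f) /\
  \int[mu]_(x in `[a + h, a + h + T]) f x = \int[mu]_(x in `[a, a + T]) f x) /\
  (mu.-integrable `[a - h, a - h + T] (EFin \o f) /\
  \int[mu]_(x in `[a - h, a - h + T]) f x = \int[mu]_(x in `[a, a + T]) f x).
Proof.
move=> hT fi.
have sub (b c : R) : a <= b -> c <= a + T -> mu.-integrable `[b, c] (EFin \o f).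
  move=> ab cT; apply: integrableS fi => //.
  by apply: subset_itv; rewrite bnd_simp.
have fT' x : f (x - T) = f x by rewrite -fT subrK.
split.
  have [i1 e1] := @integral_shift f T a (a + h) (sub a (a + h) ltac:(lra) ltac:(lra)).
  have ff : (fun x => f (x - T)) = f by apply/funext.
  rewrite ff in i1 e1; move: i1 e1; rewrite (_ : a + h + T = a + T + h); last by ring.
  move=> i1 e1.
  have [i2 ->] := @integrable_itvU (a + h) (a + T) (a + T + h) ltac:(lra) ltac:(lra)
    (sub (a + h) (a + T) ltac:(lra) ltac:(lra)) i1.
  split => //.
  have [_ ->] := @integrable_itvU a (a + h) (a + T) ltac:(lra) ltac:(lra)
    (sub a (a + h) ltac:(lra) ltac:(lra)) (sub (a + h) (a + T) ltac:(lra) ltac:(lra)).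
  by rewrite addrC; congr (_ + _); rewrite -e1; apply: eq_Rintegral.
have [i1 e1] := @integral_shift f (- T) (a + T - h) (a + T) (sub (a + T - h) (a + T) ltac:(lra) ltac:(lra)).
have ff : (fun x => f (x - - T)) = f by apply/funext => x; rewrite opprK.
rewrite ff in i1 e1; move: i1 e1.
rewrite (_ : a + T - h - T = a - h); last by ring.
rewrite (_ : a + T - T = a); last by ring.
rewrite (_ : a - h + T = a + T - h); last by ring.
move=> i1 e1.
have [i2 ->] := @integrable_itvU (a - h) a (a + T - h) ltac:(lra) ltac:(lra)
    i1 (sub a (a + T - h) ltac:(lra) ltac:(lra)).
split => //.
have [_ ->] := @integrable_itvU a (a + T - h) (a + T) ltac:(lra) ltac:(lra)
    (sub a (a + T - h) ltac:(lra) ltac:(lra)) (sub (a + T - h) (a + T) ltac:(lra) ltac:(lra)).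
by rewrite addrC; congr (_ + _).
Qed.

Lemma integral_period (a b : R) : mu.-integrable `[a, a + T] (EFin \o f) ->
  mu.-integrable `[b, b + T] (EFin \o f) /\
  \int[mu]_(x in `[b, b + T]) f x = \int[mu]_(x in `[a, a + T]) f x.
Proof.
move=> fi; pose n := (Num.truncn (`|b - a| / T)).+1.
pose h := `|b - a| / n%:R.
have n0 : (0 : R) < n%:R by rewrite ltr0n.
have hT : 0 <= h <= T.
  rewrite /h divr_ge0 //= ler_pdivrMr // mulrC -ler_pdivrMr //.
  by apply: ltW; rewrite /n; apply: truncnS_gt.
have P k : (mu.-integrable `[a + k%:R * h, a + k%:R * h + T] (EFin \o f) /\
  \int[mu]_(x in `[a + k%:R * h, a + k%:R * h + T]) f x = \int[mu]_(x in `[a, a + T]) f x) /\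
  (mu.-integrable `[a - k%:R * h, a - k%:R * h + T] (EFin \o f) /\
  \int[mu]_(x in `[a - k%:R * h, a - k%:R * h + T]) f x = \int[mu]_(x in `[a, a + T]) f x).
  elim: k => [|k [[IH1 IH2] [IH3 IH4]]]; first by rewrite mul0r subr0 addr0.
  rewrite -natr1 mulrDl mul1r opprD !addrA; split.
    have [[i e] _] := integral_period_step hT IH1.
    by split => //; rewrite e.
  have [_ [i e]] := integral_period_step hT IH3.
  by split => //; rewrite e.
have [P1 P2] := P n.
have nh : n%:R * h = `|b - a| by rewrite /h; field; lra.
have [ab|ab] := leP a b.
  move: P1; rewrite nh ger0_norm; last lra.
  by rewrite (_ : a + (b - a) = b) //; ring.
move: P2; rewrite nh ltr0_norm; last lra.
by rewrite (_ : a - - (b - a) = b) //; ring.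
Qed.

End periodic.
End shift.

(** * Nontangential smallness of Poisson integrals *)

Section fatou.
Context {R : realType}.
Local Notation mu := (@lebesgue_measure R).
Variables (h : R -> R) (c : R).
Local Notation I r := `[c - r, c + r]%classic.
Hypothesis hi : mu.-integrable (I pi) (EFin \o h).

Let q (x t : R) : R := x / (x ^+ 2 + (t - c) ^+ 2).

Let mh (A : set R) : measurable A -> A `<=` I pi -> measurable_fun A h.
Proof.
by move=> mA AD; apply: measurable_funS AD _ => //; apply/measurable_EFinP; exact: measurable_int hi.
Qed.

Let mnh (A : set R) : measurable A -> A `<=` I pi ->
  measurable_fun A (fun t => `|h t|%:E).
Proof.
by move=> mA AD; apply/measurable_EFinP/measurableT_comp => //; exact: mh.
Qed.

Let den_gt0 (x t : R) : 0 < x -> 0 < x ^+ 2 + (t - c) ^+ 2.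
Proof. by move=> x0; rewrite ltr_wpDr ?sqr_ge0 // exprn_gt0. Qed.

Let q_ge0 x t : 0 < x -> 0 <= q x t.
Proof. by move=> x0; rewrite divr_ge0 ?ltW // den_gt0. Qed.

Let mqh x (A : set R) : 0 < x -> measurable A -> A `<=` I pi ->
  measurable_fun A (fun t => (q x t * `|h t|)%:E).
Proof.
move=> x0 mA AD; apply/measurable_EFinP/measurable_funM; last first.
  by apply: measurableT_comp => //; exact: mh.
apply: measurable_funTS; apply: continuous_measurable_fun.
apply: continuous_for => t; apply: continuousM; first exact: cvg_cst.
apply: continuousV; first by rewrite gt_eqF // den_gt0.
apply: continuousD; first exact: cvg_cst.
by apply: continuousM; apply: continuousB; (exact: cvg_id || exact: cvg_cst).
Qed.

Let subI r r' : r <= r' -> I r `<=` I r'.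
Proof. by move=> rr' t /=; rewrite !in_itv /=; lra. Qed.

Let annulus_step x r r' : 0 < x -> 0 < r -> r <= r' -> r' <= pi ->
  (\int[mu]_(t in I r') (q x t * `|h t|)%:E <=
   \int[mu]_(t in I r) (q x t * `|h t|)%:E +
   (x / r ^+ 2)%:E * \int[mu]_(t in I r') `|h t|%:E)%E.
Proof.
move=> x0 r0 rr' r'pi.
have U : I r' = I r `|` (I r' `\` I r) by rewrite setDUK //; exact: subI.
have mD : measurable (I r' `\` I r) by apply: measurableD.
have sD : I r' `\` I r `<=` I pi by apply: subset_trans (subI r'pi) => t [].
have s' := subI r'pi.
have e0 : (0 <= x / r ^+ 2)%R by rewrite divr_ge0 ?sqr_ge0 // ltW.
rewrite {1}U ge0_integral_setU //; first last.
- by rewrite disj_set2E setDIK.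
- by move=> t _; rewrite lee_fin mulr_ge0 // q_ge0.
- by rewrite -U; apply: mqh.
apply: leeD => //.
rewrite -ge0_integralZl //; last exact: mnh.
apply: (@le_trans _ _ (\int[mu]_(t in I r' `\` I r) ((x / r ^+ 2)%:E * `|h t|%:E))%E).
  apply: ge0_le_integral => //.
  - by move=> t _; rewrite lee_fin mulr_ge0 // q_ge0.
  - exact: mqh.
  - by apply: measurable_funeM; apply: mnh.
  move=> t [_ /= tr]; rewrite -EFinM lee_fin ler_wpM2r //.
  rewrite /q ler_wpM2l ?(ltW x0) // lef_pV2 ?posrE ?den_gt0 ?exprn_gt0 //.
  have : r ^+ 2 <= (t - c) ^+ 2.
    have [tc|tc] := leP c t.
      rewrite lerXn2r ?nnegrE ?(ltW r0) //; first lra.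
      by move: tr; rewrite in_itv /= => /negP; rewrite negb_and -!ltNge => /orP[]; lra.
    rewrite -[(t - c) ^+ 2]sqrrN lerXn2r ?nnegrE ?(ltW r0) //; first lra.
    by move: tr; rewrite in_itv /= => /negP; rewrite negb_and -!ltNge => /orP[]; lra.
  by have := sqr_ge0 x; lra.
apply: ge0_subset_integral => //.
- by apply: measurable_funeM; apply: mnh.
- by move=> t _; rewrite -EFinM lee_fin mulr_ge0.
Qed.

(** The Lebesgue point condition at c with value 0. *)
Definition small_average :=
  forall e : R, 0 < e -> exists2 d : R, 0 < d & forall x : R, 0 < x <= d ->
  (\int[mu]_(t in I x) `|h t|%:E <= (e * x)%:E)%E.

(** A geometric series: on the annulus from 2^k x to 2^(k+1) x the kernel is at most x / (2^k x)^2,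
    so its contribution is at most 2 e / 2^k. The factor 5 - 4 / 2^k starts at 1 and grows by
    exactly 2 / 2^k. *)
Let dyadic e d x k : 0 < e -> d <= pi -> 0 < x ->
  (forall y : R, 0 < y <= d -> (\int[mu]_(t in I y) `|h t|%:E <= (e * y)%:E)%E) ->
  2 ^+ k * x <= d ->
  (\int[mu]_(t in I (2 ^+ k * x)) (q x t * `|h t|)%:E <= (e * (5 - 4 / 2 ^+ k))%:E)%E.
Proof.
move=> e0 dpi x0 hd; elim: k => [|k IH] kd.
  move: kd; rewrite expr0 mul1r => xd.
  apply: (@le_trans _ _ (\int[mu]_(t in I x) ((x^-1)%:E * `|h t|%:E))%E).
    have s := @subI x pi ltac:(lra).
    apply: ge0_le_integral => //.
    - by move=> t _; rewrite lee_fin mulr_ge0 // q_ge0.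
    - exact: mqh.
    - by apply: measurable_funeM; apply: mnh.
    move=> t _; rewrite -EFinM lee_fin ler_wpM2r // /q.
    rewrite ler_pdivrMr ?den_gt0 // -ler_pdivrMl ?invr_gt0 // invrK -expr2.
    by rewrite lerDl sqr_ge0.
  rewrite ge0_integralZl //; last 2 first.
  - by apply: mnh => //; apply: subI; lra.
  - by rewrite lee_fin invr_ge0 ltW.
  apply: (@le_trans _ _ ((x^-1)%:E * (e * x)%:E)%E).
    by apply: lee_wpmul2l; [rewrite lee_fin invr_ge0 ltW|apply: hd; rewrite x0].
  by rewrite -EFinM lee_fin le_eqVlt; apply/orP; left; apply/eqP; field; lra.
have k0 : 0 < 2 ^+ k :> R by rewrite exprn_gt0.
have kx : 0 < 2 ^+ k * x by rewrite mulr_gt0.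
have k1 : 2 ^+ k.+1 * x = 2 * (2 ^+ k * x) by rewrite exprS mulrA.
have s1 : 2 ^+ k * x <= 2 ^+ k.+1 * x by rewrite k1; lra.
have s2 : 2 ^+ k.+1 * x <= pi by lra.
apply: le_trans (annulus_step x0 kx s1 s2) _.
have {}IH := IH (le_trans s1 kd).
apply: (@le_trans _ _ ((e * (5 - 4 / 2 ^+ k))%:E +
  (x / (2 ^+ k * x) ^+ 2)%:E * (e * (2 ^+ k.+1 * x))%:E)%E).
  apply: leeD => //; apply: lee_wpmul2l; first by rewrite lee_fin divr_ge0 ?sqr_ge0 ?ltW.
  by apply: hd; rewrite kd k1 andbT; lra.
rewrite -EFinM -EFinD lee_fin le_eqVlt; apply/orP; left; apply/eqP.
rewrite k1 (exprS 2 k); move: k0; set p := 2 ^+ k => k0; field; lra.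
Qed.

Let q_integral_small : small_average -> forall e : R, 0 < e ->
  exists2 d : R, 0 < d & forall x : R, 0 < x < d ->
  (\int[mu]_(t in I pi) (q x t * `|h t|)%:E <= e%:E)%E.
Proof.
move=> sh e e0; have e6 : 0 < e / 6 by lra.
have [d1 d10 hd1] := sh _ e6.
have pi0 := pi_gt0 R.
pose d := Num.min d1 pi.
have d0 : 0 < d by rewrite lt_min d10.
have dpi : d <= pi by rewrite ge_min lexx orbT.
have hd y : 0 < y <= d -> (\int[mu]_(t in I y) `|h t|%:E <= (e / 6 * y)%:E)%E.
  by move=> /andP[y0 yd]; apply: hd1; rewrite y0 (le_trans yd) // ge_min lexx.
have /integrableP[_ hfin] := hi.
pose H := fine (\int[mu]_(t in I pi) `|h t|%:E)%E.
have HE : (\int[mu]_(t in I pi) `|h t|%:E = H%:E)%E.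
  rewrite fineK // ge0_fin_numE //; exact: integral_ge0.
have H0 : 0 <= H by rewrite -lee_fin -HE; exact: integral_ge0.
pose d' := Num.min d (d ^+ 2 * (e / 6) / (4 * (H + 1))).
have H1 : 0 < H + 1 by lra.
have dd0 : 0 < d ^+ 2 * (e / 6) / (4 * (H + 1)).
  by rewrite divr_gt0 ?mulr_gt0 ?exprn_gt0.
have d'0 : 0 < d' by rewrite lt_min d0.
exists d' => // x /andP[x0]; rewrite lt_min => /andP[xd xd'].
(* The predecessor of this n gives the radius r with r <= d < 2 r. The dyadic sum up to r costs at
   most 5 e / 6, and d' is chosen so that the rest costs at most e / 6. *)
have [n nP nmin] : exists2 n, d < 2 ^+ n * x & forall m, d < 2 ^+ m * x -> (n <= m)%N.
  have ex : exists n, d < 2 ^+ n * x.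
    exists (Num.truncn (d / x)).+1; rewrite -ltr_pdivrMr //.
    apply: lt_le_trans (truncnS_gt _) _.
    by rewrite -natrX ler_nat ltnW // ltn_expl.
  by exists (ex_minn ex); case: ex_minnP.
case: n nP nmin => [|n] nP nmin; first by exfalso; move: nP; rewrite expr0 mul1r; lra.
have nd : 2 ^+ n * x <= d.
  by rewrite leNgt; apply/negP => /nmin; rewrite ltnn.
have n0 : 0 < 2 ^+ n :> R by rewrite exprn_gt0.
have r0 : 0 < 2 ^+ n * x by rewrite mulr_gt0.
have npi : 2 ^+ n * x <= pi by lra.
apply: le_trans (annulus_step x0 r0 npi (lexx _)) _.
rewrite HE.
apply: (@le_trans _ _ ((e / 6 * (5 - 4 / 2 ^+ n))%:E + (x / (2 ^+ n * x) ^+ 2 * H)%:E)%E).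
  by apply: leeD; [exact: (dyadic e6 dpi x0 hd nd)|rewrite EFinM].
rewrite -EFinD lee_fin.
have a1 : 0 <= e / 6 * (4 / 2 ^+ n).
  by apply: mulr_ge0; [lra|apply: divr_ge0 => //; lra].
have a2 : x / (2 ^+ n * x) ^+ 2 * H <= e / 6.
  move: r0 nP; rewrite exprS -mulrA; set r := 2 ^+ n * x => r0 nP.
  rewrite mulrAC ler_pdivrMr ?exprn_gt0 //.
  move: xd'; rewrite ltr_pdivlMr ?mulr_gt0 // => xd'.
  have d2 : d ^+ 2 <= (2 * r) ^+ 2 by rewrite lerXn2r ?nnegrE //; lra.
  have e2 := @ler_wpM2r R (e / 6) ltac:(lra) _ _ d2.
  lra.
lra.
Qed.

Lemma poisson_small : small_average -> forall K e : R, 0 <= K -> 0 < e ->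
  exists2 d : R, 0 < d & forall x al : R, 0 < x < d -> `|al - c| <= K * x ->
  (\int[mu]_(t in I pi) (pk x (t - al) * `|h t|)%:E <= e%:E)%E.
Proof.
move=> sh K e K0 e0.
have C0 : 0 < 32 + 16 * K ^+ 2 by have := sqr_ge0 K; lra.
have e1 : 0 < e / (32 + 16 * K ^+ 2) by exact: divr_gt0.
have [d d0 hd] := q_integral_small sh e1.
exists (Num.min d (1 / 2)); first by rewrite lt_min d0; lra.
move=> x al /andP[x0]; rewrite lt_min => /andP[xd x2] alc.
have x1 : 0 < x < 1 by lra.
have mpk : measurable_fun (I pi) (fun t => (pk x (t - al) * `|h t|)%:E).
  apply/measurable_EFinP/measurable_funM; last first.
    by apply: measurableT_comp => //; exact: mh.
  apply: measurable_funTS; apply: continuous_measurable_fun.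
  exact: pk_continuous.
apply: (@le_trans _ _ (\int[mu]_(t in I pi) ((32 + 16 * K ^+ 2)%:E * (q x t * `|h t|)%:E))%E).
  apply: ge0_le_integral => //.
  - by move=> t _; rewrite lee_fin mulr_ge0 // pk_ge0.
  - by apply: measurable_funeM; apply: mqh.
  move=> t /=; rewrite in_itv /= => ht; rewrite -EFinM lee_fin mulrA ler_wpM2r //.
  by apply: pk_upper => //; [lra|rewrite ler_norml; lra].
rewrite ge0_integralZl //; last 3 first.
- exact: mqh.
- by move=> t _; rewrite lee_fin mulr_ge0 // q_ge0.
- by rewrite lee_fin ltW.
apply: (@le_trans _ _ ((32 + 16 * K ^+ 2)%:E * (e / (32 + 16 * K ^+ 2))%:E)%E).
  by apply: lee_wpmul2l; [rewrite lee_fin ltW|apply: hd; rewrite x0].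
by rewrite -EFinM lee_fin mulrC divfK // gt_eqF.
Qed.

End fatou.

(** * Poisson integral of a jump *)

Section step.
Context {R : realType}.
Local Notation mu := (@lebesgue_measure R).

(** Equal to (1 + rho) / (1 - rho) at the radius rho = 1 - x: the factor in the classical
    antiderivative of the Poisson kernel. *)
Definition kap (x : R) : R := (2 - x) / x.

Lemma pk_primitive x al t : 0 < x < 1 -> al - pi < t < al + pi ->
  is_derive t 1 (fun t => 2 * atan (kap x * tan ((t - al) / 2))) (pk x (t - al)).
Proof.
move=> hx ht; have hpi := pi_gt0 R.
have c0 : 0 < cos ((t - al) / 2) by apply: cos_gt0_pihalf; lra.
have d1 : is_derive t 1 (fun t : R => (t - al) / 2) (1 / 2).
  apply: is_derive_eq; rewrite !scaler0 /= /GRing.scale /=; ring.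
have d2 := @is_derive_tan R ((t - al) / 2) (lt0r_neq0 c0).
have d3 : is_derive t 1 (fun t => tan ((t - al) / 2)) _ :=
  @is_derive1_comp R tan (fun t : R => (t - al) / 2) t _ _ d2 d1.
have d4 : is_derive t 1 (fun t => kap x * tan ((t - al) / 2)) _ := is_deriveZ (kap x) d3.
have d5 := @is_derive1_atan R (kap x * tan ((t - al) / 2)).
have d6 : is_derive t 1 (fun t => atan (kap x * tan ((t - al) / 2))) _ :=
  @is_derive1_comp R atan (fun t : R => kap x * tan ((t - al) / 2)) t _ _ d5 d4.
have d7 : is_derive t 1 (fun t => 2 * atan (kap x * tan ((t - al) / 2))) _ := is_deriveZ 2 d6.
apply: (is_derive_eq d7).
have h := cos2Dsin2 ((t - al) / 2); rewrite /tan /pk /GRing.scale /= /kap.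
move: c0 h; set c := cos _; set s := sin _ => c0 h.
have D : 0 < x ^+ 2 + (1 - x) * (4 * s ^+ 2).
  by have := @pk_den_gt0 R x (t - al) hx.
have D' : 0 < (x * c) ^+ 2 + ((2 - x) * s) ^+ 2.
  rewrite ltr_pwDl ?sqr_ge0 // exprn_gt0 // mulr_gt0 //; lra.
have E : x ^+ 2 + (1 - x) * (4 * s ^+ 2) = (x * c) ^+ 2 + ((2 - x) * s) ^+ 2.
  transitivity (x ^+ 2 * (c ^+ 2 + s ^+ 2) + (1 - x) * (4 * s ^+ 2)); last by ring.
  by rewrite h mulr1.
rewrite E.
have cn : c != 0 by rewrite gt_eqF.
have xn : x != 0 by rewrite gt_eqF //; lra.
have e1 : 1 + ((2 - x) / x * (s / c)) ^+ 2 = ((x * c) ^+ 2 + ((2 - x) * s) ^+ 2) / (x * c) ^+ 2.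
  by field; rewrite cn xn.
by rewrite e1; field; rewrite xn cn gt_eqF.
Qed.

Lemma pk_integral x al a b : 0 < x < 1 -> a < b -> al - pi < a -> b < al + pi ->
  \int[mu]_(t in `[a, b]) pk x (t - al) =
  2 * atan (kap x * tan ((b - al) / 2)) - 2 * atan (kap x * tan ((a - al) / 2)).
Proof.
move=> hx ab ha hb; rewrite /Rintegral.
pose F t := 2 * atan (kap x * tan ((t - al) / 2)).
have dF t : a <= t <= b -> is_derive t 1 F (pk x (t - al)).
  by move=> tab; apply: pk_primitive => //; lra.
have cF t : a <= t <= b -> {for t, continuous F}.
  move=> tab; have := dF t tab => -[+ _] => /derivable1_diffP/differentiable_continuous.
  exact.
rewrite (@continuous_FTC2 _ _ F) //=.
- by apply: continuous_subspaceT; exact: pk_continuous.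
- split.
  + move=> t; rewrite in_itv /= => tab.
    exact: (@ex_derive _ _ _ _ _ _ _ (dF t ltac:(lra))).
  + by apply: cvg_at_right_filter; apply: cF; lra.
  + by apply: cvg_at_left_filter; apply: cF; lra.
- move=> t; rewrite in_itv /= => tab; rewrite derive1E.
  exact: (@derive_val _ _ _ _ _ _ _ (dF t ltac:(lra))).
Qed.

End step.

Section decomposition.
Context {R : realType}.
Local Notation mu := (@lebesgue_measure R).

Lemma pk_le (x v : R) : 0 < x < 1 -> pk x v <= 2 / x.
Proof.
move=> hx; have D := pk_den_gt0 v hx; rewrite /pk.
rewrite ler_pdivrMr // mulrAC ler_pdivlMr; last lra.
have : 0 <= (1 - x) * (4 * sin (v / 2) ^+ 2).
  by apply: mulr_ge0; [lra|rewrite mulr_ge0 ?sqr_ge0].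
have x2 : 0 < x * x by rewrite mulr_gt0; lra.
have x3 : 0 < x * x * x by rewrite mulr_gt0; lra.
lra.
Qed.

Lemma pk_integrable (x al : R) (A : set R) (h : R -> R) : 0 < x < 1 ->
  measurable A -> mu.-integrable A (EFin \o h) ->
  mu.-integrable A (EFin \o (fun t => pk x (t - al) * h t)).
Proof.
move=> hx mA hi.
have mh : measurable_fun A h by apply/measurable_EFinP; exact: measurable_int hi.
apply: (@le_integrable _ _ _ mu A mA _ (fun t => (2 / x)%:E * (EFin \o h) t)%E).
- apply/measurable_EFinP/measurable_funM => //.
  apply: measurable_funTS; apply: continuous_measurable_fun.
  exact: pk_continuous.
- move=> t At /=; rewrite lee_fin normrM [leRHS]normrM ler_wpM2r //.
  by rewrite ger0_norm ?pk_ge0 // (le_trans (pk_le _ hx)) // ler_norm.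
exact: integrableZl.
Qed.

Variables (g : R -> R).
Hypothesis g_periodic : forall t, g (t + 2 * pi) = g t.
Hypothesis gi0 : mu.-integrable `[0, 2 * pi] (EFin \o g).
Variables (c gp gm : R).

Lemma poisson_centered x al : 0 < x < 1 ->
  poisson_integral g (polarC x al) =
  (2 * pi)^-1 * \int[mu]_(t in `[c - pi, c + pi]) (pk x (t - al) * g t).
Proof.
move=> hx; have pi0 := pi_gt0 R.
rewrite /poisson_integral; congr (_ * _).
transitivity (\int[mu]_(t in `[0, 2 * pi]) (pk x (t - al) * g t)).
  by apply: eq_Rintegral => t _; rewrite poisson_kernelE //; lra.
have P t : pk x (t + 2 * pi - al) * g (t + 2 * pi) = pk x (t - al) * g t.
  rewrite g_periodic /pk (_ : (t + 2 * pi - al) / 2 = (t - al) / 2 + pi); last by field.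
  by rewrite sinDpi sqrrN.
have i0 : mu.-integrable `[0, 0 + 2 * pi] (EFin \o (fun t => pk x (t - al) * g t)).
  by rewrite add0r; apply: pk_integrable.
have [_] := @integral_period R (fun t => pk x (t - al) * g t) (2 * pi) ltac:(lra) P 0 (c - pi) i0.
by rewrite add0r (_ : c - pi + 2 * pi = c + pi) //; ring.
Qed.

Lemma gi : mu.-integrable `[c - pi, c + pi] (EFin \o g).
Proof.
have pi0 := pi_gt0 R.
have := @integral_period R g (2 * pi) ltac:(lra) g_periodic 0 (c - pi).
rewrite add0r (_ : c - pi + 2 * pi = c + pi); last by ring.
by case.
Qed.

(** A model of g near c when gp and gm are its one-sided limits. It stops at distance 1 so that, for
    |al - c| <= 1 / 2, its ends are within 3 / 2 < pi of al, where [pk_primitive] is valid. *)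
Definition step_fun (t : R) : R :=
  gp * \1_(`[c, c + 1]%classic) t + gm * \1_(`[c - 1, c[%classic) t.

Definition step_rest (t : R) : R := g t - step_fun t.

Definition step_poisson (x al : R) : R :=
  let A y := atan (kap x * tan ((c + y - al) / 2)) in
  (gp * (A 1 - A 0) + gm * (A 0 - A (-1))) / pi.

Lemma indic_integrable (k : R) (A B : set R) : measurable A -> measurable B ->
  (mu B < +oo)%E ->
  mu.-integrable B (EFin \o (fun t => k * \1_A t)).
Proof.
move=> mA mB fB; apply: measurable_bounded_integrable => //.
  by apply: measurable_funM => //; exact: measurable_indic.
exists `|k|; split => // y ky t _ /=; apply: le_trans (ltW ky).
by rewrite normrM ler_piMr // indicE; case: (_ \in _); rewrite /= ?normr0 ?normr1.
Qed.

Lemma itv_fin (a b : R) : (mu `[a, b]%classic < +oo)%E.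
Proof. by rewrite lebesgue_measure_itv /=; case: ifP => // _; rewrite -EFinD ltry. Qed.

Lemma step_integrable : mu.-integrable `[c - pi, c + pi] (EFin \o step_fun).
Proof.
have H := @integrableD _ _ _ mu `[c - pi, c + pi]%classic.
rewrite (_ : EFin \o _ = (EFin \o (fun t => gp * \1_(`[c, c + 1]%classic) t)) \+
   (EFin \o (fun t => gm * \1_(`[c - 1, c[%classic) t))) //.
apply: H => //; apply: indic_integrable => //; exact: itv_fin.
Qed.

Lemma rest_integrable : mu.-integrable `[c - pi, c + pi] (EFin \o step_rest).
Proof.
rewrite (_ : EFin \o _ = ((EFin \o g) \- (EFin \o step_fun))%E) //.
apply: integrableB => //; [exact: gi|exact: step_integrable].
Qed.

Lemma pk_indic (x al k : R) (A : set R) : 0 < x < 1 -> measurable A ->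
  A `<=` `[c - pi, c + pi] ->
  \int[mu]_(t in `[c - pi, c + pi]) (pk x (t - al) * (k * \1_A t)) =
  k * \int[mu]_(t in A) pk x (t - al).
Proof.
move=> hx mA sA.
have ipk (B : set R) : measurable B -> B `<=` `[c - pi, c + pi] ->
    mu.-integrable B (EFin \o (fun t => pk x (t - al))).
  move=> mB sB; apply: (@integrableS _ _ _ mu `[c - pi, c + pi]%classic) => //.
  apply: continuous_compact_integrable; first exact: segment_compact.
  by apply: continuous_subspaceT; exact: pk_continuous.
rewrite -RintegralZl //; last exact: ipk.
rewrite -[in RHS](setIidr sA) Rintegral_mkcondr.
apply: eq_Rintegral => t _; rewrite indicE patchE.
by case: ifP; rewrite /= ?mulr1 ?mulr0 // mulrC.
Qed.

Lemma pi_gt1 : 1 < pi :> R.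
Proof. have := @pi_ge2 R; lra. Qed.

Lemma step_poissonE x al : 0 < x < 1 -> `|al - c| <= 1 / 2 ->
  (2 * pi)^-1 * \int[mu]_(t in `[c - pi, c + pi]) (pk x (t - al) * step_fun t) =
  step_poisson x al.
Proof.
move=> hx; rewrite ler_norml => alc; have pi1 := @pi_ge2 R.
rewrite /step_fun; under eq_Rintegral => t _ do rewrite mulrDr.
rewrite RintegralD //; first last.
- by apply: pk_integrable => //; apply: indic_integrable => //; exact: itv_fin.
- by apply: pk_integrable => //; apply: indic_integrable => //; exact: itv_fin.
rewrite !pk_indic //; first last.
- by move=> t /=; rewrite !in_itv /=; lra.
- by move=> t /=; rewrite !in_itv /=; lra.
rewrite Rintegral_itv_bndo_bndc; last first.
  apply: (@integrableS _ _ _ mu `[c - 1, c]%classic) => //.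
    by apply: subset_itvl; rewrite bnd_simp.
  apply: continuous_compact_integrable; first exact: segment_compact.
  by apply: continuous_subspaceT; exact: pk_continuous.
rewrite !pk_integral //; try lra.
rewrite /step_poisson addr0; field.
by rewrite gt_eqF //; lra.
Qed.

Lemma poisson_decomposition x al : 0 < x < 1 -> `|al - c| <= 1 / 2 ->
  poisson_integral g (polarC x al) - step_poisson x al =
  (2 * pi)^-1 * \int[mu]_(t in `[c - pi, c + pi]) (pk x (t - al) * step_rest t).
Proof.
move=> hx alc; rewrite poisson_centered // -step_poissonE // -mulrBr.
congr (_ * _); rewrite -RintegralB //; last 2 first.
- by apply: pk_integrable => //; exact: gi.
- by apply: pk_integrable => //; exact: step_integrable.
by apply: eq_Rintegral => t _; rewrite /step_rest mulrBr.
Qed.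

(** The first estimate bounds the error, the second its radial derivative by e / x, in difference
    form. Both come from [poisson_small] applied to the remainder, the second through
    [pk_lipschitz]. *)
Lemma poisson_step_close : small_average step_rest c ->
  forall K e : R, 0 <= K -> 0 < e -> exists2 d : R, 0 < d <= 1 / 2 &
  forall x al : R, 0 < x < d -> `|al - c| <= K * x ->
  `|poisson_integral g (polarC x al) - step_poisson x al| <= e /\
  forall x' : R, 0 < x' < d -> `|al - c| <= K * x' -> x <= 2 * x' ->
  `|(poisson_integral g (polarC x al) - step_poisson x al) -
    (poisson_integral g (polarC x' al) - step_poisson x' al)| <= e * (`|x - x'| / x).
Proof.
move=> sm K e K0 e0; have pi0 := pi_gt0 R; have pi1 := pi_gt1.
have e16 : 0 < e / 16 by lra.
have [d d0 hd] := poisson_small rest_integrable sm K0 e16.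
have K1 : 0 < K + 1 by lra.
(* The bound 1 / (2 (K + 1)) on x forces |al - c| <= 1 / 2, the range of [step_poissonE]. *)
pose d' := Num.min d (Num.min (1 / 2) (2 * (K + 1))^-1).
have d'0 : 0 < d' by rewrite !lt_min d0 invr_gt0 mulr_gt0 //=; lra.
have d'2 : d' <= 1 / 2 by rewrite !ge_min lexx orbT.
exists d'; first by rewrite d'0.
have alc x (al : R) : 0 < x < d' -> `|al - c| <= K * x -> `|al - c| <= 1 / 2.
  move=> /andP[x0]; rewrite !lt_min => /and3P[_ _ xK] h; apply: le_trans h _.
  have xK' : x * (2 * (K + 1)) < 1.
    by move: xK; rewrite -[(2 * (K + 1))^-1]mul1r ltr_pdivlMr // mulr_gt0.
  lra.
have J x al : 0 < x < d' -> `|al - c| <= K * x ->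
    \int[mu]_(t in `[c - pi, c + pi]) (pk x (t - al) * `|step_rest t|) <= e / 16.
  move=> hx h; have hx1 : 0 < x < 1 by lra.
  have x0d : 0 < x < d by move: hx; rewrite !lt_min => /andP[-> /andP[-> _]].
  rewrite -lee_fin /Rintegral fineK; first exact: hd.
  apply: integrable_fin_num => //; apply: pk_integrable => //.
  by have := integrable_abse rest_integrable; apply: eq_integrable.
move=> x al hx h; have hx1 : 0 < x < 1 by lra.
have ir : mu.-integrable `[c - pi, c + pi] (EFin \o (fun t => `|step_rest t|)).
  by have := integrable_abse rest_integrable; apply: eq_integrable.
have p1 : (2 * pi)^-1 <= 1 :> R by rewrite invf_le1; lra.
have p2 : 0 <= (2 * pi)^-1 :> R by rewrite invr_ge0; lra.
have IR y : 0 < y < 1 -> mu.-integrable `[c - pi, c + pi] (EFin \o (fun t => pk y (t - al) * step_rest t)).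
  by move=> hy; apply: pk_integrable => //; exact: rest_integrable.
split.
  rewrite poisson_decomposition //; last exact: (alc x).
  rewrite normrM ger0_norm //.
  apply: (@le_trans _ _ (1 * (e / 16))); last lra.
  apply: ler_pM => //; apply: le_trans _ (J x al hx h).
  apply: le_trans (le_normr_Rintegral _ (IR x hx1)) _ => //.
  rewrite le_eqVlt; apply/orP; left; apply/eqP; apply: eq_Rintegral => t _.
  by rewrite normrM ger0_norm // pk_ge0.
move=> x' hx' h' xx'; have hx1' : 0 < x' < 1 by lra.
rewrite !poisson_decomposition //; try exact: (alc x).
rewrite -mulrBr -RintegralB //; try exact: IR.
rewrite normrM ger0_norm //.
have q0 : 0 <= `|x - x'| / x by rewrite divr_ge0 //; lra.
apply: (@le_trans _ _ (1 * (16 * (`|x - x'| / x) * (e / 16)))); last by lra.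
apply: ler_pM => //.
apply: (@le_trans _ _ (16 * (`|x - x'| / x) * \int[mu]_(t in `[c - pi, c + pi]) (pk x (t - al) * `|step_rest t|))); last first.
  by apply: ler_wpM2l; [rewrite mulr_ge0|exact: J].
have IB : mu.-integrable `[c - pi, c + pi]
   (EFin \o (fun t => pk x (t - al) * step_rest t - pk x' (t - al) * step_rest t)).
  have := integrableB _ (IR x hx1) (IR x' hx1').
  by apply.
apply: le_trans (le_normr_Rintegral _ IB) _ => //.
rewrite -RintegralZl //; last exact: pk_integrable.
apply: le_Rintegral => //.
- by have := integrable_abse IB; apply: eq_integrable.
- have := @integrableZl _ _ _ mu _ _ (16 * (`|x - x'| / x)) _ (@pk_integrable x al _ _ hx1 _ ir).
  by apply.
move=> t _; rewrite -mulrBl normrM mulrA ler_wpM2r //.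
by apply: pk_lipschitz; lra.
Qed.

End decomposition.

(** * Fatou's theorem on radial limits *)

Section boundary_limits.
Context {R : realType}.
Local Notation mu := (@lebesgue_measure R).

Lemma ae_imp (P Q : R -> Prop) : (forall x, P x -> Q x) ->
  {ae mu, forall x, P x} -> {ae mu, forall x, Q x}.
Proof. by move=> PQ; apply: negligibleS => x /= nQ /PQ. Qed.

Lemma ae_and (P Q : R -> Prop) : {ae mu, forall x, P x} ->
  {ae mu, forall x, Q x} -> {ae mu, forall x, P x /\ Q x}.
Proof.
move=> hP hQ; have := negligibleU hP hQ; apply: negligibleS => x /= nPQ.
by have [p|p] := pselect (P x); [right => q; exact: nPQ|left].
Qed.

Lemma atan_kap_cvg (T e : R) : 0 < T -> 0 < e ->
  exists2 d : R, 0 < d <= 1 / 2 & forall x, 0 < x < d -> `|atan (kap x * T) - pi / 2| < e.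
Proof.
move=> T0 e0; have /cvgrPdist_lt /(_ _ e0) := @cvgy_atan R.
move=> [M [_ hM]].
have M0 : 0 < `|M| + 1 by rewrite ltr_wpDl.
have d0 : 0 < T / (`|M| + 1) by exact: divr_gt0.
exists (Num.min (1 / 2) (T / (`|M| + 1))); first by rewrite lt_min d0 ge_min lexx /= andbT; lra.
move=> x /andP[x0]; rewrite lt_min => /andP[x1]; rewrite ltr_pdivlMr // => xM.
rewrite distrC; apply: hM.
have Mn := ler_norm M.
rewrite /kap mulrAC ltr_pdivlMr //.
have h : M * x <= `|M| * x by rewrite ler_pM2r.
have : T * x <= T * 1 by rewrite ler_pM2l //; lra.
lra.
Qed.

Variables (g : R -> R).
Hypothesis g_periodic : forall t, g (t + 2 * pi) = g t.
Hypothesis gi0 : mu.-integrable `[0, 2 * pi] (EFin \o g).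

Lemma small_average_ess (c gp gm : R) :
  (forall e : R, 0 < e -> exists2 d : R, 0 < d &
     {ae mu, forall s, c - d < s < c -> `|g s - gm| < e}) ->
  (forall e : R, 0 < e -> exists2 d : R, 0 < d &
     {ae mu, forall s, c < s < c + d -> `|g s - gp| < e}) ->
  small_average (step_rest g c gp gm) c.
Proof.
move=> hl hr e e0; have e2 : 0 < e / 2 by lra.
have [d1 d10 h1] := hl _ e2; have [d2 d20 h2] := hr _ e2.
exists (Num.min (Num.min d1 d2) (1 / 2)); first by rewrite !lt_min d10 d20; lra.
move=> x /andP[x0]; rewrite !le_min => /andP[/andP[xd1 xd2] x1].
have pi2 := @pi_ge2 R.
have mr : measurable_fun `[c - x, c + x] (step_rest g c gp gm).
  have : measurable_fun `[c - pi, c + pi] (step_rest g c gp gm).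
    by apply/measurable_EFinP; apply: measurable_int (rest_integrable g_periodic gi0 _ _ _).
  by apply: measurable_funS => //; apply: subset_itv; rewrite bnd_simp; lra.
(* The hypotheses say nothing at c and may stop short of the ends of the closed interval; these
   three points are discarded as a null set. *)
have nc : {ae mu, forall s : R, s <> c /\ s <> c - x /\ s <> c + x}.
  have n1 (y : R) : {ae mu, forall s : R, s <> y}.
    exists [set y]; split => //; first by rewrite lebesgue_measure_set1.
    by move=> s /= /contrapT.
  exact: (ae_and (n1 c) (ae_and (n1 (c - x)) (n1 (c + x)))).
apply: (@le_trans _ _ (\int[mu]_(t in `[(c - x)%R, (c + x)%R]) (e / 2)%:E)%E); last first.
  rewrite integral_cst //= lebesgue_measure_itv /= lte_fin ifT; last lra.
  by rewrite -EFinD -EFinM lee_fin; lra.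
apply: ae_ge0_le_integral => //.
- by apply/measurable_EFinP; apply: measurableT_comp.
- by move=> t _; rewrite lee_fin ltW.
apply: (ae_imp _ (ae_and h1 (ae_and h2 nc))) => s [H1 [H2 [n1 [n2 n3]]]].
rewrite /= in_itv /= => sx; rewrite lee_fin ltW // /step_rest /step_fun !indicE.
have [sc|sc] := ltP s c.
  have := H1 ltac:(move: sx n2 => /andP[a1 a2] /eqP; rewrite neq_lt; lra).
  rewrite memNset /=; last by rewrite in_itv /=; lra.
  by rewrite mem_set /= ?mulr0 ?mulr1 ?add0r // in_itv /=; lra.
have := H2 ltac:(move: sx n1 n3 => /andP[a1 a2] /eqP + /eqP; rewrite !neq_lt; lra).
rewrite mem_set /=; last by rewrite in_itv /=; lra.
by rewrite memNset /= ?mulr0 ?mulr1 ?addr0 // in_itv /=; lra.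
Qed.

Definition radial_limit (s : R) : Prop :=
  forall e : R, 0 < e -> exists2 d : R, 0 < d <= 1 / 2 &
  forall x, 0 < x < d -> `|poisson_integral g (polarC x s) - g s| < e.

(** With equal values on both sides the step model has no jump at s, and its Poisson integral along
    the radius is explicit, with limit g s. *)
Lemma small_average_radial (s : R) : small_average (step_rest g s (g s) (g s)) s ->
  radial_limit s.
Proof.
move=> sm e e0; have e2 : 0 < e / 2 by lra.
have [d1 d10 h1] := poisson_step_close g_periodic gi0 sm (lexx 0) e2.
have T0 : 0 < tan (1 / 2) :> R.
  have := @pi_ge2 R; move=> pi2.
  by rewrite /tan divr_gt0 ?sin_gt0_pi ?cos_gt0_pihalf //; lra.
have G0 : 0 < 1 + `|g s| by rewrite ltr_wpDr.
have e3 : 0 < e / 2 / (1 + `|g s|) by exact: divr_gt0.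
have [d2 d20 h2] := atan_kap_cvg T0 e3.
exists (Num.min d1 d2); first by rewrite lt_min ge_min; lra.
move=> x /andP[x0]; rewrite lt_min => /andP[xd1 xd2].
have [||a1 _] := h1 x s.
- by rewrite x0.
- by rewrite subrr normr0 mul0r.
have a2 := h2 x ltac:(lra).
rewrite (_ : _ - g s = (poisson_integral g (polarC x s) - step_poisson s (g s) (g s) x s) +
  (step_poisson s (g s) (g s) x s - g s)); last by ring.
apply: le_lt_trans (ler_normD _ _) _.
suff : `|step_poisson s (g s) (g s) x s - g s| < e / 2 by lra.
rewrite /step_poisson (_ : s + 1 - s = 1); last by ring.
rewrite (_ : s + -1 - s = - 1); last by ring.
rewrite mulNr tanN mulrN atanN.
have pi2 := @pi_ge2 R.
rewrite (_ : _ - g s = g s * (atan (kap x * tan (1 / 2)) - pi / 2) * (2 / pi)); last first.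
  by field; rewrite gt_eqF //; lra.
rewrite normrM (@ger0_norm _ (2 / pi)); last by rewrite divr_ge0 //; lra.
rewrite normrM.
have b1 : 2 / pi <= 1 :> R by rewrite ler_pdivrMr; lra.
move: a2; rewrite ltr_pdivlMr // => a2.
apply: (@le_lt_trans _ _ (`|g s| * `|atan (kap x * tan (1 / 2)) - pi / 2|)).
  by rewrite ler_piMr ?mulr_ge0.
move: a2; set z := `|atan _ - _|; have z0 : 0 <= z by exact: normr_ge0.
by rewrite mulrDr mulr1 [`|g s| * z]mulrC => u; lra.
Qed.

Lemma fatou_ae (c : R) : {ae mu, forall s, c - 1 < s < c + 1 -> radial_limit s}.
Proof.
have pi2 := @pi_ge2 R.
(* The restriction is integrable on the whole line and agrees with g within distance 1 of every s
   considered. *)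
pose f : R -> R := g \_ `[c - 2, c + 2]%classic.
have fl : locally_integrable setT f.
  apply: integrable_locally => //; apply: integrableS (gi g_periodic gi0 c) => //.
  by apply: subset_itv; rewrite bnd_simp; lra.
apply: (ae_imp _ (lebesgue_differentiation fl)) => s Ls sc.
apply: small_average_radial => e e0.
have e4 : 0 < e / 4 by lra.
have : \forall r \near 0^'+, (davg f s r < (e / 4)%:E)%E.
  by apply: (Ls [set y | (y < (e / 4)%:E)%E]); apply: open_ereal_lt'; rewrite lte_fin.
move=> [d /= d0 hd].
exists (Num.min (d / 4) (1 / 4)); first by rewrite lt_min; lra.
move=> x /andP[x0]; rewrite le_min => /andP[xd x1].
(* The radius 2 x makes the open ball contain the closed interval [s - x, s + x]; its length 4 x
   accounts for e / 4. *)
have D : (davg f s (2 * x) < (e / 4)%:E)%E.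
  apply: hd => /=; last by lra.
  by rewrite sub0r normrN ger0_norm; lra.
have mf : measurable_fun setT f by case: fl.
have B : (\int[mu]_(y in ball s (2 * x)) `|(f y - f s)%:E| <= (e * x)%:E)%E.
  move: D; rewrite /davg /iavg lebesgue_measure_ball; last lra.
  rewrite inver ifF; last by apply/negbTE; rewrite mulrn_eq0 /= mulf_neq0 //; lra.
  move=> /ltW; rewrite lee_pdivrMl; last by rewrite mulrn_wgt0 //; lra.
  move=> h; apply: le_trans h _.
  by rewrite -EFinM lee_fin -mulr_natl; lra.
apply: le_trans B.
apply: (@le_trans _ _ (\int[mu]_(y in `[(s - x)%R, (s + x)%R]) `|(f y - f s)%:E|)%E).
  rewrite le_eqVlt; apply/orP; left; apply/eqP; apply: eq_integral => t.
  rewrite inE /= in_itv /= => tx; congr (_%:E); congr (`| _ |).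
  rewrite /f !patchE !mem_set /= ?in_itv /=; try lra.
  rewrite /step_rest /step_fun !indicE; congr (_ - _).
  have [ts|ts] := ltP t s.
    rewrite memNset /=; last by rewrite in_itv /=; lra.
    by rewrite mem_set /= ?mulr0 ?mulr1 ?add0r // in_itv /=; lra.
  rewrite mem_set /=; last by rewrite in_itv /=; lra.
  by rewrite memNset /= ?mulr0 ?mulr1 ?addr0 // in_itv /=; lra.
apply: ge0_subset_integral => //.
- exact: measurable_ball.
- apply/measurable_EFinP; apply: measurableT_comp => //.
  by apply: measurable_funB => //; apply: measurable_funTS.
- by move=> t /=; rewrite in_itv /= /ball /= => tx; rewrite ltr_norml; lra.
Qed.

End boundary_limits.

(** * One-sided essential limits of the boundary function *)

Section ess_limit.
Context {R : realType}.
Local Notation mu := (@lebesgue_measure R).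
Variables (g : R -> R) (c sg M : R) (good : R -> Prop).
Hypothesis sg1 : sg = 1 \/ sg = -1.
Hypothesis good_ae : {ae mu, forall s, c - 1 < s < c + 1 -> good s}.
Hypothesis good_bounded : forall s, good s -> `|g s| <= M.
Hypothesis no_alt : forall k p1 p2 p3 p4, good p1 -> good p2 -> good p3 -> good p4 ->
  0 < sg * (p1 - c) -> sg * (p1 - c) < sg * (p2 - c) ->
  sg * (p2 - c) < sg * (p3 - c) -> sg * (p3 - c) < sg * (p4 - c) ->
  sg * (p4 - c) < 1 -> k < g p1 -> g p2 < k -> k < g p3 -> g p4 < k -> False.

Let near_c (d s : R) := 0 < sg * (s - c) < d.

Let good_near (d : R) (P : R -> Prop) : 0 < d <= 1 ->
  ~ {ae mu, forall s, near_c d s -> ~ P s} -> exists s, [/\ good s, near_c d s & P s].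
Proof.
move=> hd; apply: contra_notP => nex.
apply: (ae_imp _ good_ae) => s gs ns Ps; apply: nex; exists s; split => //.
by apply: gs; move: ns; rewrite /near_c; case: sg1 => ->; lra.
Qed.

Let near_not_null (d : R) : 0 < d -> ~ {ae mu, forall s, ~ near_c d s}.
Proof.
move=> d0 [N [mN N0 sN]].
have H (a b : R) : a < b -> (forall s, a < s < b -> near_c d s) -> False.
  move=> ab hab.
  have : (mu `]a, b[ <= mu N)%E.
    apply: le_measure => /=; rewrite ?inE //.
    by move=> s /=; rewrite in_itv /= => sab; apply: sN => /=; apply; exact: hab.
  by rewrite N0 lebesgue_measure_itv /= lte_fin ab -EFinD lee_fin; lra.
case: sg1 => e; [apply: (H c (c + d))|apply: (H (c - d) c)]; rewrite /near_c ?e; try lra.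
  by move=> s; lra.
by move=> s; lra.
Qed.

(** The supremum of the k with [hi k] is the essential upper limit of g at c from the side sg; the
    infimum of those with [lo k] is the essential lower limit. *)
Let hi k := forall d, 0 < d -> ~ {ae mu, forall s, near_c d s -> ~ (k < g s)}.
Let lo k := forall d, 0 < d -> ~ {ae mu, forall s, near_c d s -> ~ (g s < k)}.

(** The four points are chosen from the outside inwards, each closer to c than the previous one: a
    condition that holds on a non-null set near c holds at some good point. *)
Let not_hi_lo k : hi k -> lo k -> False.
Proof.
move=> hk lk.
have [p4 [g4 /andP[n4 m4] k4]] := @good_near 1 _ ltac:(lra) (lk 1 ltr01).
have [p3 [g3 /andP[n3 m3] k3]] := @good_near (sg * (p4 - c)) _ ltac:(lra) (hk _ n4).
have [p2 [g2 /andP[n2 m2] k2]] := @good_near (sg * (p3 - c)) _ ltac:(lra) (lk _ n3).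
have [p1 [g1 /andP[n1 m1] k1]] := @good_near (sg * (p2 - c)) _ ltac:(lra) (hk _ n2).
exact: (no_alt g1 g2 g3 g4 n1 m1 m2 m3 m4 k1 k2 k3 k4).
Qed.

Lemma ess_one_sided_limit : exists l : R, forall e : R, 0 < e ->
  exists2 d : R, 0 < d & {ae mu, forall s, 0 < sg * (s - c) < d -> `|g s - l| < e}.
Proof.
pose S := [set k | hi k].
have S0 : S !=set0.
  (* Good values are at least - M, so they all exceed this k. *)
  exists (- M - 1) => d d0 H.
  have hm : 0 < Num.min d 1 by rewrite lt_min d0 ltr01.
  apply: (near_not_null hm); apply: (ae_imp _ (ae_and H good_ae)) => s [h1 h2].
  rewrite /near_c lt_min => /and3P[s0 sd s1].
  have gs : good s by apply: h2; move: s0 s1; case: sg1 => ->; lra.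
  apply: h1; first by rewrite /near_c s0 sd.
  by have := good_bounded gs; rewrite ler_norml; lra.
have Sb : has_ubound S.
  exists M => k hk.
  have [s [gs _ ks]] := @good_near 1 _ ltac:(lra) (hk 1 ltr01).
  by have := good_bounded gs; rewrite ler_norml; lra.
exists (sup S) => e e0; have e2 : 0 < e / 2 by lra.
have nh : ~ hi (sup S + e / 2).
  by move=> h; have := ub_le_sup Sb h; lra.
have [k hk kl] := @sup_adherent _ S (e / 2) e2 (conj S0 Sb).
have nl : ~ lo k by move=> h; exact: (not_hi_lo hk h).
have [d1 /not_implyP[d10 /contrapT h1]] := (existsNP _).2 nh.
have [d2 /not_implyP[d20 /contrapT h2]] := (existsNP _).2 nl.
exists (Num.min d1 d2); first by rewrite lt_min d10 d20.
apply: (ae_imp _ (ae_and h1 h2)) => s [a1 a2].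
rewrite lt_min => /and3P[s0 sd1 sd2].
have b1 : g s <= sup S + e / 2.
  by rewrite leNgt; apply/negP; apply: a1; rewrite /near_c s0 sd1.
have b2 : k <= g s.
  by rewrite leNgt; apply/negP; apply: a2; rewrite /near_c s0 sd2.
by rewrite ltr_norml; lra.
Qed.

End ess_limit.

(** * Functions of class C^1 in two real variables *)

Section calculus.
Context {R : realType}.
Implicit Types (p q : R * R) (u ux uy : R * R -> R).

Definition square_ball p (d : R) q := `|q.1 - p.1| < d /\ `|q.2 - p.2| < d.

Lemma continuous_square u p : {for p, continuous u} <->
  forall e : R, 0 < e -> exists2 d : R, 0 < d &
  forall q, square_ball p d q -> `|u q - u p| < e.
Proof.
split=> [cu e e0|H].
  have /cvgrPdist_lt /(_ _ e0) := cu => /nbhs_ballP[d /= d0 hd].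
  exists d => // q [q1 q2]; rewrite distrC; apply: hd.
  by split; rewrite /ball /= distrC.
apply/cvgrPdist_lt => e e0; have [d d0 hd] := H e e0.
apply: filterS (nbhsx_ballx p d d0) => q [q1 q2]; rewrite distrC; apply: hd.
by split; rewrite distrC.
Qed.

Lemma disk2_open p : disk2 p -> exists2 d : R, 0 < d &
  forall q, square_ball p d q -> disk2 q.
Proof.
rewrite /disk2 /= => hp.
have c : {for p, continuous (fun q => q.1 ^+ 2 + q.2 ^+ 2)}.
  apply: continuousD; apply: continuous_sqr.
    exact: continuous_fst2.
  exact: continuous_snd2.
have [d d0 hd] := (continuous_square _ _).1 c (1 - (p.1 ^+ 2 + p.2 ^+ 2)) ltac:(lra).
by exists d => // q /hd /=; rewrite ltr_norml; lra.
Qed.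

Definition C1_2 u ux uy := forall p, disk2 p ->
  [/\ is_derive p.1 1 (fun s => u (s, p.2)) (ux p),
      is_derive p.2 1 (fun s => u (p.1, s)) (uy p),
      {for p, continuous ux} & {for p, continuous uy}].

Lemma MVT_any (f df : R -> R) (a b : R) :
  (forall x, Num.min a b <= x <= Num.max a b -> is_derive x 1 f (df x)) ->
  exists2 c, Num.min a b <= c <= Num.max a b & f b - f a = df c * (b - a).
Proof.
have [ab|/ltW ab] := leP a b => h.
  exact: MVT_le.
have [c hc E] := MVT_le ab h; exists c => //.
by rewrite -opprB E -mulrN opprB.
Qed.

Lemma minmax_ball (a b c d : R) : `|b - a| < d -> Num.min a b <= c <= Num.max a b ->
  `|c - a| < d.
Proof. by rewrite !ltr_norml; have [ab|ab] := leP a b; lra. Qed.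

Section C1.
Variables (u ux uy : R * R -> R).
Hypothesis hu : C1_2 u ux uy.

(* A Caratheodory-type form of differentiability at p. *)
Lemma C1_increment p : disk2 p -> exists phi psi : R * R -> R,
  [/\ phi p = ux p, psi p = uy p, {for p, continuous phi}, {for p, continuous psi} &
  exists2 d : R, 0 < d & forall q, square_ball p d q ->
   disk2 q /\ u q - u p = phi q * (q.1 - p.1) + psi q * (q.2 - p.2)].
Proof.
move=> Dp; have [d d0 hd] := disk2_open Dp.
pose phi q := if q.1 == p.1 then ux p else (u q - u (p.1, q.2)) / (q.1 - p.1).
pose psi q := if q.2 == p.2 then uy p else (u (p.1, q.2) - u p) / (q.2 - p.2).
have phiE q : square_ball p d q -> q.1 != p.1 -> exists2 c,
    Num.min p.1 q.1 <= c <= Num.max p.1 q.1 & phi q = ux (c, q.2).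
  move=> [q1 q2] ne; have [|c hc E] := @MVT_any (fun s => u (s, q.2)) (fun s => ux (s, q.2)) p.1 q.1.
    move=> x hx; have [|//] := hu (_ : disk2 (x, q.2)).
    by apply: hd; split => //=; exact: minmax_ball hx.
  exists c => //; rewrite /phi (negbTE ne); apply/eqP.
  rewrite eqr_div ?oner_eq0 ?subr_eq0 // || rewrite -(inj_eq (mulIf (_ : q.1 - p.1 != 0))) ?subr_eq0 //.
  by rewrite divfK ?subr_eq0 // -E -surjective_pairing.
have psiE q : square_ball p d q -> q.2 != p.2 -> exists2 c,
    Num.min p.2 q.2 <= c <= Num.max p.2 q.2 & psi q = uy (p.1, c).
  move=> [q1 q2] ne; have [|c hc E] := @MVT_any (fun s => u (p.1, s)) (fun s => uy (p.1, s)) p.2 q.2.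
    move=> x hx; have [|//] := hu (_ : disk2 (p.1, x)).
    by apply: hd; split => //=; [rewrite subrr normr0|exact: minmax_ball hx].
  exists c => //; rewrite /psi (negbTE ne); apply/eqP.
  rewrite -(inj_eq (mulIf (_ : q.2 - p.2 != 0))) ?subr_eq0 //.
  by rewrite divfK ?subr_eq0 // -E -surjective_pairing.
exists phi, psi; have [_ _ cx cy] := hu Dp; split.
- by rewrite /phi eqxx.
- by rewrite /psi eqxx.
- apply/continuous_square => e e0; have [d1 d10 h1] := (continuous_square _ _).1 cx e e0.
  exists (Num.min d d1); first by rewrite lt_min d0.
  move=> q [q1 q2]; move: (q1) (q2); rewrite !lt_min => /andP[q1d q1d1] /andP[q2d q2d1].
  rewrite {2}/phi eqxx; have [e1|ne] := eqVneq q.1 p.1.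
    by rewrite /phi e1 eqxx subrr normr0.
  have [c hc ->] := phiE q (conj q1d q2d) ne.
  by apply: h1; split => //=; exact: minmax_ball hc.
- apply/continuous_square => e e0; have [d1 d10 h1] := (continuous_square _ _).1 cy e e0.
  exists (Num.min d d1); first by rewrite lt_min d0.
  move=> q [q1 q2]; move: (q1) (q2); rewrite !lt_min => /andP[q1d q1d1] /andP[q2d q2d1].
  rewrite {2}/psi eqxx; have [e1|ne] := eqVneq q.2 p.2.
    by rewrite /psi e1 eqxx subrr normr0.
  have [c hc ->] := psiE q (conj q1d q2d) ne.
  by apply: h1; split => //=; [rewrite subrr normr0|exact: minmax_ball hc].
- exists d => // q hq; split; first exact: hd.
  rewrite /phi /psi; case: eqP => [e1|/eqP n1]; case: eqP => [e2|/eqP n2];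
   rewrite ?divfK ?subr_eq0 //.
  + by rewrite e1 e2 !subrr !mulr0 addr0 [q]surjective_pairing e1 e2 -surjective_pairing subrr.
  + by rewrite e1 subrr mulr0 add0r [in LHS](surjective_pairing q) e1.
  + by rewrite e2 subrr mulr0 addr0 -surjective_pairing.
  + by rewrite addrA subrK.
Qed.

Lemma C1_continuous p : disk2 p -> {for p, continuous u}.
Proof.
move=> Dp; have [phi [psi [_ _ cphi cpsi [d d0 hd]]]] := C1_increment Dp.
have c : {for p, continuous (fun q => u p + (phi q * (q.1 - p.1) + psi q * (q.2 - p.2)))}.
  apply: continuousD; first exact: cvg_cst.
  apply: continuousD; apply: continuousM => //; apply: continuousB; try exact: cvg_cst.
    exact: continuous_fst2.
  exact: continuous_snd2.
apply/continuous_square => e e0; have [d1 d10 h1] := (continuous_square _ _).1 c e e0.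
exists (Num.min d d1); first by rewrite lt_min d0.
move=> q [q1 q2]; move: (q1) (q2); rewrite !lt_min => /andP[q1d q1d1] /andP[q2d q2d1].
have := h1 q (conj q1d1 q2d1); rewrite !subrr !mulr0 !addr0.
have [_ <-] := hd q (conj q1d q2d).
by rewrite [u p + _]addrC subrK.
Qed.

Lemma C1_chain (X Y : R -> R) (t X' Y' : R) : disk2 (X t, Y t) ->
  is_derive t 1 X X' -> is_derive t 1 Y Y' ->
  is_derive t 1 (fun s => u (X s, Y s)) (ux (X t, Y t) * X' + uy (X t, Y t) * Y').
Proof.
move=> Dp dX dY.
have [phi [psi [e1 e2 cphi cpsi [d d0 hd]]]] := C1_increment Dp.
have cX : {for t, continuous X}.
  by have [/derivable1_diffP/differentiable_continuous + _] := dX; apply.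
have cY : {for t, continuous Y}.
  by have [/derivable1_diffP/differentiable_continuous + _] := dY; apply.
have cXY := continuous_pair cX cY.
have qX : h^-1 *: (X (h *: 1 + t) - X t) @[h --> (0 : R)^'] --> X'.
  by have [h1 h2] := dX; rewrite -h2; exact: h1.
have qY : h^-1 *: (Y (h *: 1 + t) - Y t) @[h --> (0 : R)^'] --> Y'.
  by have [h1 h2] := dY; rewrite -h2; exact: h1.
have sh : h *: 1 + t @[h --> (0 : R)^'] --> t.
  have : {for (0 : R), continuous (fun h : R => h *: (1 : R) + t)}.
    apply: continuousD; last exact: cvg_cst.
    by apply: continuousM; [exact: cvg_id|exact: cvg_cst].
  move=> /continuous_withinNx; rewrite scale0r add0r; exact.
have cph : phi (X (h *: 1 + t), Y (h *: 1 + t)) @[h --> (0 : R)^'] --> ux (X t, Y t).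
  rewrite -e1; apply: (@cvg_comp _ _ _ (fun h : R => h *: 1 + t) (fun s => phi (X s, Y s)) _ _ _ sh).
  exact: (@continuous_comp _ _ _ (fun s => (X s, Y s)) phi).
have cps : psi (X (h *: 1 + t), Y (h *: 1 + t)) @[h --> (0 : R)^'] --> uy (X t, Y t).
  rewrite -e2; apply: (@cvg_comp _ _ _ (fun h : R => h *: 1 + t) (fun s => psi (X s, Y s)) _ _ _ sh).
  exact: (@continuous_comp _ _ _ (fun s => (X s, Y s)) psi).
have L : phi (X (h *: 1 + t), Y (h *: 1 + t)) * (h^-1 *: (X (h *: 1 + t) - X t)) +
    psi (X (h *: 1 + t), Y (h *: 1 + t)) * (h^-1 *: (Y (h *: 1 + t) - Y t))
    @[h --> (0 : R)^'] --> ux (X t, Y t) * X' + uy (X t, Y t) * Y'.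
  by apply: cvgD; apply: cvgM.
have near : \forall h \near (0 : R)^', square_ball (X t, Y t) d (X (h *: 1 + t), Y (h *: 1 + t)).
  have nX : \forall h \near (0 : R)^', `|X t - X (h *: 1 + t)| < d.
    by have /cvgrPdist_lt := @cvg_comp _ _ _ (fun h : R => h *: 1 + t) X _ _ _ sh cX; exact.
  have nY : \forall h \near (0 : R)^', `|Y t - Y (h *: 1 + t)| < d.
    by have /cvgrPdist_lt := @cvg_comp _ _ _ (fun h : R => h *: 1 + t) Y _ _ _ sh cY; exact.
  by apply: filterS2 nX nY => h h1 h2; split; rewrite /= distrC.
have C : h^-1 *: (u (X (h *: 1 + t), Y (h *: 1 + t)) - u (X t, Y t)) @[h --> (0 : R)^']
   --> ux (X t, Y t) * X' + uy (X t, Y t) * Y'.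
  apply: (cvg_trans (near_eq_cvg _) L); apply: filterS near => h hh.
  have [_ E] := hd _ hh; rewrite /= E /=.
  by rewrite /GRing.scale /=; ring.
by split; [apply: cvgP C|exact: cvg_lim C].
Qed.

End C1.

(** The second difference of u over a small square, divided by its area, is a value of uxy and also
    a value of uyx by the mean value theorem; continuity at p excludes a gap between the two. The
    lemma serves to show that dV is closed in the coordinates (m, t). *)
Lemma schwarz u ux uy uxx uxy uyx uyy : C1_2 u ux uy -> C1_2 ux uxx uxy ->
  C1_2 uy uyx uyy -> forall p, disk2 p -> uxy p = uyx p.
Proof.
move=> hu hux huy p Dp; apply/eqP; rewrite -subr_eq0; apply/eqP.
apply: contrapT => /eqP ne.
have e0 : 0 < `|uxy p - uyx p| / 2 by rewrite divr_gt0 // normr_gt0.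
have [_ _ _ cxy] := hux p Dp; have [_ _ cyx _] := huy p Dp.
have [d1 d10 h1] := (continuous_square _ _).1 cxy _ e0.
have [d2 d20 h2] := (continuous_square _ _).1 cyx _ e0.
have [d3 d30 h3] := disk2_open Dp.
pose d := Num.min d1 (Num.min d2 d3) / 2.
have m0 : 0 < Num.min d1 (Num.min d2 d3) by rewrite !lt_min d10 d20.
have dd : 0 < d by rewrite divr_gt0.
have sq x y (e : R) : Num.min d1 (Num.min d2 d3) <= e -> p.1 <= x <= p.1 + d ->
    p.2 <= y <= p.2 + d -> square_ball p e (x, y).
  by move=> me hx hy; split; rewrite /= ltr_norml; move: hx hy; rewrite /d; lra.
have D x y : p.1 <= x <= p.1 + d -> p.2 <= y <= p.2 + d -> disk2 (x, y).
  by move=> hx hy; apply: h3; apply: sq => //; rewrite !ge_min lexx !orbT.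
have [x hx Ex] := @MVT_le R (fun s => u (s, p.2 + d) - u (s, p.2))
   (fun s => ux (s, p.2 + d) - ux (s, p.2)) p.1 (p.1 + d) ltac:(lra) (fun s hs =>
   is_deriveB (let: And4 a _ _ _ := hu _ (D s (p.2 + d) hs ltac:(lra)) in a)
              (let: And4 a _ _ _ := hu _ (D s p.2 hs ltac:(lra)) in a)).
have [y hy Ey] := @MVT_le R (fun s => ux (x, s)) (fun s => uxy (x, s)) p.2 (p.2 + d) ltac:(lra)
   (fun s hs => (let: And4 _ a _ _ := hux _ (D x s hx hs) in a)).
have [y' hy' Ey'] := @MVT_le R (fun s => u (p.1 + d, s) - u (p.1, s))
   (fun s => uy (p.1 + d, s) - uy (p.1, s)) p.2 (p.2 + d) ltac:(lra) (fun s hs =>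
   is_deriveB (let: And4 _ a _ _ := hu _ (D (p.1 + d) s ltac:(lra) hs) in a)
              (let: And4 _ a _ _ := hu _ (D p.1 s ltac:(lra) hs) in a)).
have [x' hx' Ex'] := @MVT_le R (fun s => uy (s, y')) (fun s => uyx (s, y')) p.1 (p.1 + d) ltac:(lra)
   (fun s hs => (let: And4 a _ _ _ := huy _ (D s y' hs hy') in a)).
have E : uxy (x, y) = uyx (x', y').
  apply: (@mulIf _ (d * d)); first by rewrite mulf_neq0 // gt_eqF.
  have a1 : p.1 + d - p.1 = d by ring.
  have a2 : p.2 + d - p.2 = d by ring.
  move: Ex Ex' Ey Ey' => /=; rewrite a1 a2 => Ex Ex' Ey Ey'.
  rewrite [LHS]mulrA [RHS]mulrA -Ey -Ex' -Ex -Ey'; ring.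
have b1 := h1 _ (sq x y d1 ltac:(by rewrite ge_min lexx) hx hy).
have b2 := h2 _ (sq x' y' d2 ltac:(by rewrite !ge_min lexx !orbT) hx' hy').
have := ler_normB (uyx (x', y') - uyx p) (uxy (x, y) - uxy p).
rewrite (_ : _ - _ = uxy p - uyx p); last by rewrite E; ring.
lra.
Qed.

End calculus.

Section one_sided.
Context {R : realType}.
Local Notation mu := (@lebesgue_measure R).
Variables (F : R * R -> R * R) (l : R * R -> R) (g : R -> R) (M : R).
Hypothesis cF : forall p, disk2 p -> {for p, continuous F}.
Hypothesis injF : forall p q, disk2 p -> disk2 q -> F p = F q -> p = q.
Hypothesis convexF : forall p q t, disk2 p -> disk2 q -> 0 <= t <= 1 ->
  exists2 r, disk2 r & F r = F p + t *: (F q - F p).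
Hypothesis linl : forall p q t, l (p + t *: (q - p)) = (1 - t) * l p + t * l q.
Hypothesis g_periodic : forall t, g (t + 2 * pi) = g t.
Hypothesis gi0 : mu.-integrable `[0, 2 * pi] (EFin \o g).
Hypothesis F_poisson : forall x s, 0 < x < 1 ->
  l (F (radial (1 - x) s)) = poisson_integral g (polarC x s).
Hypothesis F_bounded : forall p, disk2 p -> `|l (F p)| <= M.

Let radial_gt s k : radial_limit g s -> k < g s -> exists2 d : R, 0 < d < 1 &
  forall r, 1 - d < r < 1 -> k < l (F (radial r s)).
Proof.
move=> gs kg; have e0 : 0 < g s - k by lra.
have [d d0 hd] := gs _ e0; exists d; first lra.
move=> r hr; rewrite (_ : r = 1 - (1 - r)); last by ring.
rewrite F_poisson; last lra.
by have := hd (1 - r) ltac:(lra); rewrite ltr_norml; lra.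
Qed.

Let radial_lt s k : radial_limit g s -> g s < k -> exists2 d : R, 0 < d < 1 &
  forall r, 1 - d < r < 1 -> l (F (radial r s)) < k.
Proof.
move=> gs kg; have e0 : 0 < k - g s by lra.
have [d d0 hd] := gs _ e0; exists d; first lra.
move=> r hr; rewrite (_ : r = 1 - (1 - r)); last by ring.
rewrite F_poisson; last lra.
by have := hd (1 - r) ltac:(lra); rewrite ltr_norml; lra.
Qed.

Let radial_bounded s : radial_limit g s -> `|g s| <= M.
Proof.
move=> gs; apply/ler_addgt0Pr => e e0.
have [d d0 hd] := gs _ e0.
have := hd (d / 2) ltac:(lra); rewrite -F_poisson; last lra.
have := F_bounded (@radial_disk R (1 - d / 2) s ltac:(lra)).
by rewrite ler_norml ltr_norml ler_norml; lra.
Qed.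

Lemma boundary_one_sided (c sg : R) : sg = 1 \/ sg = -1 ->
  exists L : R, forall e : R, 0 < e -> exists2 d : R, 0 < d &
  {ae mu, forall s, 0 < sg * (s - c) < d -> `|g s - L| < e}.
Proof.
move=> sg1; have pi2 := @pi_ge2 R.
apply: (@ess_one_sided_limit R g c sg M (radial_limit g)) => //.
  exact: fatou_ae.
move=> k p1 p2 p3 p4 g1 g2 g3 g4 o1 o2 o3 o4 o5 k1 k2 k3 k4.
have [d1 d10 h1] := radial_gt g1 k1; have [d2 d20 h2] := radial_lt g2 k2.
have [d3 d30 h3] := radial_gt g3 k3; have [d4 d40 h4] := radial_lt g4 k4.
pose d := Num.min (Num.min d1 d2) (Num.min d3 d4).
have d0 : 0 < d by rewrite !lt_min; lra.
have [e1 e2 e3 e4] : [/\ d <= d1, d <= d2, d <= d3 & d <= d4].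
  by rewrite !ge_min !lexx !orbT.
have rho1 : 0 <= 1 - d / 2 < 1 by lra.
have sub (P : R -> Prop) e : d <= e -> (forall r, 1 - e < r < 1 -> P r) ->
  forall r, 1 - d / 2 <= r < 1 -> P r by move=> de hP r hr; apply: hP; lra.
have {}h1 := sub _ _ e1 h1; have {}h2 := sub _ _ e2 h2.
have {}h3 := sub _ _ e3 h3; have {}h4 := sub _ _ e4 h4.
case: sg1 => e; rewrite e in o1 o2 o3 o4 o5.
  by apply: (@no_alternation R F cF injF convexF l k (1 - d / 2) c p1 p2 p3 p4); rewrite //; lra.
(* To the left of c the points come in reverse order, so the pattern starts with a low value;
   negating l and k restores it. *)
apply: (@no_alternation R F cF injF convexF (fun p => - l p) (- k) (1 - d / 2) (c - 1) p4 p3 p2 p1) => //; try lra.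
- by move=> p q t; rewrite linl; ring.
- by move=> r /h4; rewrite ltrN2.
- by move=> r /h3; rewrite ltrN2.
- by move=> r /h2; rewrite ltrN2.
- by move=> r /h1; rewrite ltrN2.
Qed.

End one_sided.

(** * Passage between the complex plane and pairs of reals *)

Section complex_plane.
Context {R : realType}.
Implicit Types (p q : R * R) (z w : R[i]^o).

Definition toC p : R[i]^o := p.1 +i* p.2.

Lemma lt_normc z (e : R) : (`|z| < e%:C) = (Normc.normc z < e).
Proof. by rewrite -ltcR. Qed.

Lemma le_normc z (e : R) : (`|z| <= e%:C) = (Normc.normc z <= e).
Proof. by rewrite -lecR. Qed.

Lemma toC_disk p : unit_disk (toC p) <-> disk2 p.
Proof.
rewrite /unit_disk /disk2 /= (lt_normc (toC p) 1) /=.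
have h : 0 <= p.1 ^+ 2 + p.2 ^+ 2 by rewrite addr_ge0 // sqr_ge0.
split => [|h1].
  by rewrite -[X in _ < X]sqrtr1 ltr_sqrt.
by rewrite -[X in _ < X]sqrtr1 ltr_sqrt.
Qed.

Lemma normc_Re_Im z : Normc.normc z <= `|complex.Re z| + `|complex.Im z|.
Proof.
case: z => x y /=; rewrite -[leRHS]ger0_norm ?addr_ge0 // -sqrtr_sqr ler_sqrt ?sqr_ge0 //.
rewrite -[x ^+ 2]real_normK ?num_real // -[y ^+ 2]real_normK ?num_real //.
by have := mulr_ge0 (normr_ge0 x) (normr_ge0 y); lra.
Qed.

Lemma toC_continuous : continuous toC.
Proof.
move=> p A /nbhs_ballP [r /= r0 hr].
(* Radii of balls of [R[i]] are themselves complex numbers; a positive one is real. *)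
have r0' : 0 < complex.Re r /\ r = (complex.Re r)%:C.
  by move: r0; case: (r) => a b; rewrite ltcE /= => /andP[/eqP -> ->].
have [re0 rE] := r0'.
apply: filterS (nbhsx_ballx p (complex.Re r / 2) _) => [q [/= q1 q2]|]; last by lra.
apply: hr; rewrite /ball /= rE; rewrite /= (lt_normc (toC p - toC q)).
apply: le_lt_trans (normc_Re_Im _) _ => /=; move: q1 q2; rewrite /ball /=; lra.
Qed.

Lemma C1_on_C1_2 (u : R[i]^o -> R) : C1_on unit_disk u ->
  C1_2 (u \o toC) (partial_x u \o toC) (partial_y u \o toC).
Proof.
move=> hu p /toC_disk Dp; have [dx dy cx cy] := hu _ Dp; split.
- by apply: (DeriveDef dx); rewrite /= /partial_x derive1E.
- by apply: (DeriveDef dy); rewrite /= /partial_y derive1E.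
- by apply: continuous_comp; [exact: toC_continuous|exact: cx].
- by apply: continuous_comp; [exact: toC_continuous|exact: cy].
Qed.

Lemma expi_periodic (t : R) : expi (t + 2 * pi) = expi t.
Proof. by rewrite /expi mulr_natl cosD2pi sinD2pi. Qed.

Lemma toC_radial (x s : R) : toC (radial (1 - x) s) = polarC x s.
Proof. by []. Qed.

End complex_plane.

(** * Behaviour near a jump *)

Section trig_bounds.
Context {R : realType}.

Lemma derive_lipschitz_bound (f : R -> R) (x df B d : R) : 0 < d ->
  is_derive x 1 f df -> (forall y, `|y - x| < d -> `|f y - f x| <= B * `|y - x|) ->
  `|df| <= B.
Proof.
move=> d0 [H1 H2] hB; rewrite leNgt; apply/negP => Bdf.
have e0 : 0 < `|df| - B by lra.
have C : h^-1 *: (f (h *: 1 + x) - f x) @[h --> (0 : R)^'] --> df.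
  by rewrite -H2; exact: H1.
have /cvgrPdist_lt /(_ _ e0) := C => -[r /= r0 hr].
pose h := Num.min r d / 2.
have m0 : 0 < Num.min r d by rewrite lt_min r0.
have [mr md] : Num.min r d <= r /\ Num.min r d <= d by rewrite !ge_min !lexx orbT.
have h0 : 0 < h by rewrite /h; lra.
have := hr h; rewrite /ball_ /= sub0r normrN ger0_norm ?(ltW h0) //.
move=> /(_ ltac:(rewrite /h; lra) ltac:(by rewrite gt_eqF)).
rewrite /GRing.scale /= mulr1 => K.
have := hB (h + x); rewrite addrK ger0_norm ?(ltW h0) // => /(_ ltac:(rewrite /h; lra)) K2.
have : `|h^-1 * (f (h + x) - f x)| <= B.
  by rewrite normrM ger0_norm ?invr_ge0 ?(ltW h0) // ler_pdivrMl // mulrC.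
have := ler_normD (df - h^-1 * (f (h + x) - f x)) (h^-1 * (f (h + x) - f x)).
by rewrite subrK; lra.
Qed.

Lemma tan_bounds (v : R) : 0 <= v <= 1 / 2 -> v <= tan v /\ tan v <= 2 * v /\
  tan v <= v * (1 + 2 * v ^+ 2).
Proof.
move=> /andP[v0 v1]; have pi2 := @pi_ge2 R.
have cp x : 0 <= x <= v -> 0 < cos x by move=> hx; apply: cos_gt0_pihalf; lra.
have [x hx] := @MVT_le R tan (fun x => (cos x) ^- 2) 0 v v0
  (fun x hx => is_derive_tan (lt0r_neq0 (cp x hx))).
rewrite tan0 !subr0 => ->.
have cx := cp x hx; have cv := cp v ltac:(lra).
have c1 := cos2Dsin2 x.
have s1 := sqr_ge0 (sin x).
have cx2 : 0 < cos x ^+ 2 by rewrite exprn_gt0.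
have c2 : 1 <= 2 * cos x ^+ 2.
  have : 0 <= cos (x *+ 2) by apply: cos_ge0_pihalf; rewrite (mulr2n x); lra.
  by rewrite cos_mulr2n; lra.
have i1 : 1 <= cos x ^- 2 by rewrite invf_ge1 //; lra.
have i2 : cos x ^- 2 <= 2 by rewrite -[2]invrK lef_pV2 ?posrE //; lra.
have s2 : sin x ^+ 2 <= v ^+ 2.
  have := sin_lipschitz x 0; rewrite sin0 !subr0 (@ger0_norm _ x); last lra.
  rewrite ler_norml => /andP[a1 a2]; nra.
have i3 : cos x ^- 2 <= 1 + 2 * v ^+ 2.
  rewrite -[cos x ^- 2]mul1r ler_pdivrMr // -[leLHS]c1.
  have := @ler_wpM2r R (v ^+ 2) (sqr_ge0 _) _ _ c2; lra.
rewrite mulrC; split; [|split].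
- by rewrite ler_peMr.
- by rewrite [leRHS]mulrC ler_wpM2l.
- by rewrite ler_wpM2l.
Qed.

Lemma tan_quarter (v : R) : 1 / 4 <= v <= 3 / 4 -> 1 / 4 <= tan v.
Proof.
move=> hv; have pi2 := @pi_ge2 R; have [h1 _] := @tan_bounds (1 / 4) ltac:(lra).
apply: le_trans h1 _.
have [e|ne] := eqVneq v (1 / 4); first by rewrite e.
have lt : 1 / 4 < v by rewrite lt_neqAle eq_sym ne; lra.
by rewrite ltW // ltr_tan // in_itv /=; lra.
Qed.

Lemma atan_lipschitz (x y : R) : `|atan x - atan y| <= `|x - y|.
Proof.
wlog xy : x y / y <= x.
  move=> W; case: (leP y x) => [|/ltW] h; first exact: W.
  by rewrite distrC [leRHS]distrC; exact: W.
have [z _ ->] := @MVT_le R atan (fun x => (1 + x ^+ 2)^-1) y x xy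
  (fun z _ => @is_derive1_atan R z).
have z1 : 1 <= 1 + z ^+ 2 by rewrite lerDl sqr_ge0.
by rewrite normrM ler_piMl // ger0_norm ?invr_ge0 ?invf_le1; lra.
Qed.

(** With x = m th, [kap x] is about 2 / (m th) and tan (th / 2) about th / 2. So at the jump the
    argument of atan tends to 1 / m: this is how the limit along a curve comes to depend on m. *)
Lemma kap_tan (m th : R) : 0 < m <= 1 -> 0 < th <= 1 / 2 ->
  `|kap (m * th) * tan (th / 2) - m^-1| <= th / m.
Proof.
move=> hm ht; have m0 : 0 < m by lra.
have [b1 [_ b2]] := @tan_bounds (th / 2) ltac:(lra).
have mth0 : 0 < m * th by rewrite mulr_gt0 //; lra.
have mth1 : m * th <= th by rewrite ler_piMl //; lra.
have i1 : 1 <= m^-1 by rewrite invf_ge1; lra.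
have kE : kap (m * th) * (th / 2) = m^-1 - th / 2.
  by rewrite /kap; field; rewrite !gt_eqF //; lra.
have k0 : 0 <= kap (m * th) by rewrite divr_ge0 //; lra.
have r1 := ler_wpM2l k0 b1; have r2 := ler_wpM2l k0 b2.
rewrite kE in r1; rewrite (mulrA (kap (m * th)) (th / 2)) kE in r2.
have me2 : 0 <= th / m by rewrite divr_ge0 //; lra.
have me3 : th <= th / m by rewrite -{1}[th]mulr1 ler_wpM2l //; lra.
have r3 : (m^-1 - th / 2) * (1 + 2 * (th / 2) ^+ 2) <= m^-1 * (1 + 2 * (th / 2) ^+ 2).
  have th2 := sqr_ge0 (th / 2); rewrite ler_wpM2r; lra.
have r4 : m^-1 * (1 + 2 * (th / 2) ^+ 2) = m^-1 + th / m * (th / 2) by field; lra.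
have r5 : th / m * (th / 2) <= th / m by rewrite ler_piMr //; lra.
by rewrite ler_norml; lra.
Qed.

Lemma dist_jumps (gp gm x0 x1 x2 y0 y1 y2 e : R) :
  `|x0 - y0| <= e -> `|x1 - y1| <= e -> `|x2 - y2| <= e ->
  `|gp * (x1 - x0) + gm * (x0 - x2) - (gp * (y1 - y0) + gm * (y0 - y2))| <=
  2 * ((`|gp| + `|gm|) * e).
Proof.
move=> h0 h1 h2.
have -> : gp * (x1 - x0) + gm * (x0 - x2) - (gp * (y1 - y0) + gm * (y0 - y2)) =
  gp * ((x1 - y1) - (x0 - y0)) + gm * ((x0 - y0) - (x2 - y2)) by ring.
have -> : 2 * ((`|gp| + `|gm|) * e) = `|gp| * (2 * e) + `|gm| * (2 * e) by ring.
apply: le_trans (ler_normD _ _) _; rewrite (normrM gp) (normrM gm).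
by apply: lerD; rewrite ler_wpM2l //; apply: le_trans (ler_normB _ _) _; lra.
Qed.
End trig_bounds.

Section jump.
Context {R : realType}.
Local Notation mu := (@lebesgue_measure R).
Variables (V Vx Vy : R * R -> R) (g : R -> R) (c sg gp gm : R).
Hypothesis hV : C1_2 V Vx Vy.
Hypothesis sg1 : sg = 1 \/ sg = -1.
Hypothesis g_periodic : forall t, g (t + 2 * pi) = g t.
Hypothesis gi0 : mu.-integrable `[0, 2 * pi] (EFin \o g).
Hypothesis V_poisson : forall x s, 0 < x < 1 ->
  V (radial (1 - x) s) = poisson_integral g (polarC x s).
Hypothesis sm : small_average (step_rest g c gp gm) c.

Definition sector (m t : R) : R * R := radial (1 - m * (sg * (t - c))) t.

Definition sector_m (ux uy : R * R -> R) (m t : R) : R :=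
  ux (sector m t) * (- (sg * (t - c)) * cos t) +
  uy (sector m t) * (- (sg * (t - c)) * sin t).

Lemma sector_disk m t : 0 < m * (sg * (t - c)) <= 1 -> disk2 (sector m t).
Proof. by move=> h; apply: radial_disk; lra. Qed.

Lemma is_derive_affine (a b x : R) (f : R -> R) : (forall y, f y = a * y + b) ->
  is_derive x 1 f a.
Proof.
move=> fE; rewrite (_ : f = (fun y => a * y + b)); last exact/funext.
have d1 : is_derive x 1 (fun y : R => a * y) (a *: 1) := is_deriveZ a (is_derive_id x 1).
have d2 : is_derive x 1 (fun y : R => a * y + b) (a *: 1 + 0) := is_deriveD d1 (is_derive_cst b x 1).
by apply: (is_derive_eq d2); rewrite addr0 /GRing.scale /= mulr1.
Qed.

Lemma sector_derive_m (u ux uy : R * R -> R) m t : C1_2 u ux uy ->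
  0 < m * (sg * (t - c)) <= 1 ->
  is_derive m 1 (fun m => u (sector m t)) (sector_m ux uy m t).
Proof.
move=> hu hm.
apply: (@C1_chain _ u ux uy hu (fun m => (1 - m * (sg * (t - c))) * cos t)
  (fun m => (1 - m * (sg * (t - c))) * sin t) m _ _ (sector_disk hm)).
  by apply: (@is_derive_affine _ (cos t)) => y; ring.
by apply: (@is_derive_affine _ (sin t)) => y; ring.
Qed.

(** The derivative in m of [kap (m * th)], which equals 2 / (m th) - 1. *)
Let kD (m th : R) := - 2 / (m ^+ 2 * th).

Let kap_derive (m th T : R) : 0 < m -> 0 < th ->
  is_derive m 1 (fun m => atan (kap (m * th) * T))
    (kD m th * T / (1 + (kap (m * th) * T) ^+ 2)).
Proof.
move=> m0 th0.
have mn : m != 0 by rewrite gt_eqF.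
have d1 : is_derive m 1 (fun y : R => y^-1) _ := is_deriveV mn (is_derive_id m 1).
have d2 : is_derive m 1 (fun y : R => (2 * T / th) * y^-1) _ := is_deriveZ (2 * T / th) d1.
have d3 : is_derive m 1 (fun y : R => (2 * T / th) * y^-1 - T) _ :=
  is_deriveB d2 (is_derive_cst T m 1).
have E (y : R) : 0 < y -> kap (y * th) * T = (2 * T / th) * y^-1 - T.
  by move=> y0; rewrite /kap; field; rewrite !gt_eqF.
have d4 := @is_derive1_atan R ((2 * T / th) * m^-1 - T).
have d5 : is_derive m 1 (fun y : R => atan ((2 * T / th) * y^-1 - T)) _ :=
  @is_derive1_comp R atan (fun y : R => (2 * T / th) * y^-1 - T) m _ _ d4 d3.
have n : \forall y \near m, atan ((2 * T / th) * y^-1 - T) = atan (kap (y * th) * T).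
  have : \forall y \near m, 0 < y by exact: lt_nbhsr.
  by apply: filterS => y y0; rewrite E.
apply: (near_eq_is_derive n).
apply: (is_derive_eq d5); rewrite E // /kD /GRing.scale /=.
have den : 0 < 1 + ((2 * T / th) * m^-1 - T) ^+ 2 by rewrite ltr_pwDl ?sqr_ge0.
have thn : th != 0 by rewrite gt_eqF.
move: den; set K := (2 * T / th) * m^-1 - T => den.
have dn : 1 + K ^+ 2 != 0 by rewrite gt_eqF.
by field; rewrite mn thn dn.
Qed.

(** Meant for the outer ends of the step: T stays away from 0, so the argument of atan is at least
    of order 1 / th, where atan is already flat. *)
Let kD_small (m th T : R) : 0 < m <= 1 -> 0 < th <= 1 / 2 -> 1 / 4 <= `|T| ->
  `|kD m th * T / (1 + (kap (m * th) * T) ^+ 2)| <= 8 * th.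
Proof.
move=> /andP[m0 m1] /andP[th0 th1] hT.
have den : 0 < 1 + (kap (m * th) * T) ^+ 2 by rewrite ltr_pwDl ?sqr_ge0.
have mth : 0 < m ^+ 2 * th by rewrite mulr_gt0 // exprn_gt0.
rewrite normrM [X in _ * X]ger0_norm ?invr_ge0 ?(ltW den) // ler_pdivrMr //.
rewrite normrM /kD mulNr normrN (@ger0_norm _ (2 / _)); last by rewrite divr_ge0 // ltW.
have k1 : (m * th)^-1 <= kap (m * th).
  have p : 0 < m * th by exact: mulr_gt0.
  rewrite /kap -[leLHS]mul1r ler_pM2r ?invr_gt0 //.
  have : m * th <= 1 * (1 / 2) by apply: ler_pM; lra.
  lra.
have k2 : (m * th)^-1 ^+ 2 * `|T| ^+ 2 <= (kap (m * th) * T) ^+ 2.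
  rewrite exprMn -[T ^+ 2]real_normK ?num_real // ler_wpM2r ?sqr_ge0 //.
  have p : 0 <= (m * th)^-1 by rewrite invr_ge0 mulr_ge0 ?ltW.
  by rewrite lerXn2r ?nnegrE // (le_trans p).
have k3 : 8 * th * ((m * th)^-1 ^+ 2 * `|T| ^+ 2) <= 8 * th * (1 + (kap (m * th) * T) ^+ 2).
  by rewrite ler_wpM2l //; lra.
apply: le_trans k3.
have -> : 8 * th * ((m * th)^-1 ^+ 2 * `|T| ^+ 2) = 2 / (m ^+ 2 * th) * (4 * `|T| * `|T|).
  by field; rewrite !gt_eqF.
rewrite ler_wpM2l ?divr_ge0 ?(ltW mth) // ler_peMl //; lra.
Qed.

(** Meant for the jump: tau is of the order of th, so the argument of atan stays below 2 / m and the
    derivative does not decay as th tends to 0. *)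
Let main_term (m th tau : R) : 0 < m <= 1 -> 0 < th <= 1 / 2 -> th / 2 <= tau <= th ->
  (m ^+ 2 + 4)^-1 <= - kD m th * tau / (1 + (kap (m * th) * tau) ^+ 2).
Proof.
move=> /andP[m0 m1] /andP[th0 th1] /andP[t1 t2].
have den : 0 < 1 + (kap (m * th) * tau) ^+ 2 by rewrite ltr_pwDl ?sqr_ge0.
have m2 : 0 < m ^+ 2 by rewrite exprn_gt0.
have k0 : 0 <= kap (m * th) * tau.
  apply: mulr_ge0; last lra.
  have p : m * th <= 1 * (1 / 2) by apply: ler_pM; lra.
  by rewrite divr_ge0 ?mulr_ge0 ?(ltW m0) ?(ltW th0) //; lra.
have k1 : kap (m * th) * tau <= 2 / m.
  rewrite /kap mulrAC ler_pdivrMr ?mulr_gt0 //.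
  have -> : 2 / m * (m * th) = 2 * th by field; rewrite gt_eqF.
  have p : 0 <= m * th * tau by rewrite !mulr_ge0 ?(ltW m0) ?(ltW th0) //; lra.
  lra.
have k2 : (kap (m * th) * tau) ^+ 2 <= (2 / m) ^+ 2.
  by rewrite lerXn2r ?nnegrE // (le_trans k0).
rewrite ler_pdivlMr //.
apply: (@le_trans _ _ ((m ^+ 2 + 4)^-1 * (1 + (2 / m) ^+ 2))).
  by rewrite ler_wpM2l ?invr_ge0 ?lerD2l //; lra.
have -> : (m ^+ 2 + 4)^-1 * (1 + (2 / m) ^+ 2) = (m ^+ 2)^-1.
  by field; rewrite !gt_eqF //; lra.
have -> : - kD m th = 2 / (m ^+ 2 * th) by rewrite /kD mulNr opprK.
rewrite -[leLHS]mul1r mulrAC -(@ler_pM2r _ (m ^+ 2 * th)) ?mulr_gt0 // divfK ?mulf_neq0 ?gt_eqF //.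
rewrite mul1r mulKf ?gt_eqF //; lra.
Qed.

Local Notation j := (gp - gm).

Let tan_sg (th : R) : tan (- (sg * th) / 2) = - sg * tan (th / 2).
Proof. by case: sg1 => ->; rewrite ?mul1r ?mulN1r ?opprK ?mulNr ?tanN ?mul1r. Qed.

Let tan_large (th y : R) : 0 < th <= 1 / 2 -> y = 1 \/ y = - 1 ->
  1 / 4 <= `|tan ((y - sg * th) / 2)|.
Proof.
move=> hth hy.
have [v hv E] : exists2 v, 1 / 4 <= v <= 3 / 4 & `|tan ((y - sg * th) / 2)| = `|tan v|.
  case: hy => ->.
    by exists ((1 - sg * th) / 2) => //; case: sg1 => ->; lra.
  exists ((1 + sg * th) / 2); first by case: sg1 => ->; lra.
  by rewrite -normrN -tanN; congr (`|tan _|); field.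
by rewrite E; apply: le_trans (tan_quarter hv) (ler_norm _).
Qed.

Lemma step_derive (m t : R) : 0 < m <= 1 -> 0 < sg * (t - c) <= 1 / 2 ->
  exists dS : R, is_derive m 1 (fun m => step_poisson c gp gm (m * (sg * (t - c))) t) dS /\
   (j ^+ 2 / (m ^+ 2 + 4) - 8 * (sg * (t - c)) * `|j| * (`|gp| + `|gm|)) / pi <= - (sg * j * dS).
Proof.
move=> hm hth; set th := sg * (t - c) in hth *.
have sg2 : sg * sg = 1 by case: sg1 => ->; ring.
have tE : t - c = sg * th by rewrite /th mulrA sg2 mul1r.
(* The contribution of the jump is D (T 0) = sg z; the sign of sg (gp - gm) in front then turns it
   into a multiple of the square of the jump. *)
have alg (P x y z : R) : P != 0 ->
   - (sg * j * ((gp * (x - sg * z) + gm * (sg * z - y)) / P)) * P =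
   (sg * sg) * j ^+ 2 * z - sg * j * (gp * x - gm * y).
  by move=> Pn; field.
pose D T := kD m th * T / (1 + (kap (m * th) * T) ^+ 2).
pose T y := tan ((c + y - t) / 2).
have dA y : is_derive m 1 (fun m => atan (kap (m * th) * T y)) (D (T y)).
  by apply: kap_derive; lra.
pose dS := (gp * (D (T 1) - D (T 0)) + gm * (D (T 0) - D (T (-1)))) / pi.
exists dS; split.
  have d1 := is_deriveZ gp (is_deriveB (dA 1) (dA 0)).
  have d2 := is_deriveZ gm (is_deriveB (dA 0) (dA (-1))).
  have d3 := is_deriveZ (pi^-1) (is_deriveD d1 d2).
  rewrite (_ : (fun m => _) = pi^-1 \*: ((gp \*: ((fun m => atan (kap (m * th) * T 1)) - (fun m => atan (kap (m * th) * T 0)))) +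
    (gm \*: ((fun m => atan (kap (m * th) * T 0)) - (fun m => atan (kap (m * th) * T (-1))))))); last first.
    by apply/funext => y; rewrite /step_poisson /GRing.scale /= mulrC.
  by apply: (is_derive_eq d3); rewrite /dS /GRing.scale /= mulrC.
have T0 : T 0 = - sg * tan (th / 2).
  by rewrite /T -tan_sg; congr tan; rewrite addr0 -tE; field.
have Ty y : T y = tan ((y - sg * th) / 2) by rewrite /T -tE; congr tan; field.
have B y : y = 1 \/ y = - 1 -> `|D (T y)| <= 8 * th.
  by move=> hy; apply: kD_small => //; rewrite Ty; exact: tan_large.
have [b1 [b2 _]] := @tan_bounds R (th / 2) ltac:(lra).
have Q := @main_term m th (tan (th / 2)) hm hth ltac:(lra).
have D0 : D (T 0) = sg * (- kD m th * tan (th / 2) / (1 + (kap (m * th) * tan (th / 2)) ^+ 2)).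
  rewrite T0 /D (_ : (kap (m * th) * (- sg * tan (th / 2))) ^+ 2 =
    (kap (m * th) * tan (th / 2)) ^+ 2 * (sg * sg)); last by ring.
  by rewrite sg2 mulr1; ring.
move: Q D0; set q := - kD m th * _ / _ => Q D0.
have pi0 := pi_gt0 R.
rewrite ler_pdivrMr // /dS D0.
rewrite alg ?gt_eqF // sg2 mul1r.
have q1 : j ^+ 2 / (m ^+ 2 + 4) <= j ^+ 2 * q by rewrite ler_wpM2l ?sqr_ge0.
have q2 : sg * j * (gp * D (T 1) - gm * D (T (-1))) <= 8 * th * `|j| * (`|gp| + `|gm|).
  apply: le_trans (ler_norm _) _; rewrite (normrM (sg * j)) (normrM sg).
  have -> : `|sg| = 1 by case: sg1 => ->; rewrite ?normrN normr1.
  rewrite mul1r [8 * th * _]mulrC -mulrA ler_wpM2l //.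
  apply: le_trans (ler_normB _ _) _; rewrite (normrM gp) (normrM gm) mulrDr.
  by apply: lerD; rewrite mulrC ler_wpM2r //; apply: B; [left|right].
lra.
Qed.

(** The step contributes at least 3 A / (4 pi) and the remainder at most A / (4 pi). The derivative
    of the remainder is bounded by a Lipschitz constant, without differentiating its integral. *)
Lemma sector_derive_bound (m1 m2 : R) : 0 < m1 -> m1 <= m2 -> m2 <= 1 -> gp != gm ->
  exists c0 th1 : R, [/\ 0 < c0, 0 < th1 <= 1 / 2 & forall m t, m1 <= m <= m2 ->
    0 < sg * (t - c) < th1 -> c0 <= - (sg * j * sector_m Vx Vy m t)].
Proof.
move=> m10 m12 m21 jn.
have j0 : j != 0 by rewrite subr_eq0.
have ja : 0 < `|j| by rewrite normr_gt0.
have j2 : 0 < j ^+ 2 by rewrite exprn_even_gt0.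
have pi0 := pi_gt0 R; have pi2 := @pi_ge2 R.
have md : 0 < m2 ^+ 2 + 4 by rewrite ltr_wpDl ?sqr_ge0.
pose A := j ^+ 2 / (m2 ^+ 2 + 4).
have A0 : 0 < A by exact: divr_gt0.
pose G := `|j| * (`|gp| + `|gm|).
have G0 : 0 <= G by rewrite mulr_ge0 ?addr_ge0.
have t8 (th : R) : 0 < th -> th < A / (32 * (G + 1)) -> 8 * th * G <= A / 4.
  move=> th0; rewrite ltr_pdivlMr => [thA|]; last by lra.
  by have := mulr_ge0 (ltW th0) G0; lra.
have Am (m : R) : m1 <= m <= m2 -> A <= j ^+ 2 / (m ^+ 2 + 4).
  move=> hm; have m4 : 0 < m ^+ 2 + 4 by rewrite ltr_wpDl ?sqr_ge0.
  have mm : m ^+ 2 <= m2 ^+ 2 by rewrite lerXn2r ?nnegrE; lra.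
  by rewrite /A ler_pM2l // lef_pV2 ?posrE // lerD2r.
have e0 : 0 < A / (4 * pi) * m1 / `|j| by apply: divr_gt0 => //; apply: mulr_gt0 => //; apply: divr_gt0 => //; apply: mulr_gt0 => //; lra.
(* Difference quotients at m use y with |y - m| < m1 / 2, hence y > m1 / 2; then th is at most (m1 /
   2)^-1 times the distance y th to the circle. *)
have K0 : 0 <= (m1 / 2)^-1 by rewrite invr_ge0; lra.
have [d d0 hd] := poisson_step_close g_periodic gi0 sm K0 e0.
have p4 : 0 < 4 * (pi : R) by lra.
exists (A / (4 * pi)), (Num.min (d / 2) (A / (32 * (G + 1)))).
have G1 : 0 < G + 1 by lra.
split; first by apply: divr_gt0.
  by rewrite lt_min ge_min (divr_gt0 A0) ?mulr_gt0 //=; lra.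
move=> m t hm; rewrite lt_min => /and3P[th0 thd thA].
have sg2 : sg * sg = 1 by case: sg1 => ->; ring.
have sgn : `|sg| = 1 by case: sg1 => ->; rewrite ?normrN normr1.
have [dS [dS1 dS2]] := @step_derive m t ltac:(lra) ltac:(lra).
move: th0 thd thA dS1 dS2; set th := sg * (t - c) => th0 thd thA dS1 dS2.
have tcE : `|t - c| = th.
  by rewrite -[t - c]mul1r -sg2 -mulrA normrM sgn mul1r ger0_norm // ltW.
have mth (y : R) : 0 < y <= 2 -> 0 < y * th < d.
  move=> /andP[y0 y2]; rewrite mulr_gt0 //=.
  have := @ler_wpM2r R th (ltW th0) _ _ y2; lra.
have dV := @sector_derive_m V Vx Vy m t hV ltac:(rewrite -/th; have := mth m ltac:(lra); lra).
have dE := is_deriveB dV dS1.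
have mm : 0 < m1 / 2 by lra.
have VE y : 0 < y <= 2 -> V (sector y t) = poisson_integral g (polarC (y * th) t).
  by move=> /mth y1; rewrite -V_poisson //; lra.
have L : `|sector_m Vx Vy m t - dS| <= A / (4 * pi) * m1 / `|j| / m.
  apply: (@derive_lipschitz_bound _ _ m _ _ (m1 / 2) mm dE) => y hy.
  move: hy; rewrite ltr_norml => hy.
  have hyy : 0 < y <= 2 by lra.
  rewrite /= distrC.
  have [||_ H] := hd (m * th) t.
  - by apply: mth; lra.
  - by rewrite tcE ler_pdivlMl // ler_wpM2r ?(ltW th0) //; lra.
  have := H (y * th) (mth y hyy) _ _.
  (* The factor th cancels here, which makes the bound uniform as th tends to 0. *)
  have -> : `|m * th - y * th| / (m * th) = `|y - m| / m.
    rewrite -mulrBl normrM (ger0_norm (ltW th0)) distrC; field.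
    by rewrite !gt_eqF //; lra.
  rewrite -!VE //; last by lra.
  move=> Hy; have := Hy _ _; rewrite -/th.
  have k1 : `|t - c| <= (m1 / 2)^-1 * (y * th).
    by rewrite tcE mulrA -[leLHS]mul1r ler_wpM2r ?(ltW th0) // ler_pdivlMl //; lra.
  have k2 : m * th <= 2 * (y * th).
    by rewrite mulrA ler_wpM2r ?(ltW th0) //; lra.
  move=> /(_ k1 k2) {}Hy.
  by apply: le_trans Hy _; rewrite mulrA [leLHS]mulrAC.
have {}L : `|j| * `|sector_m Vx Vy m t - dS| <= A / (4 * pi).
  rewrite mulrC -ler_pdivlMr //; apply: le_trans L _.
  have -> : A / (4 * pi) * m1 / `|j| / m = A / (4 * pi) / `|j| * (m1 / m) by rewrite !mulrA; congr (_ / m); rewrite mulrAC.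
  rewrite ler_piMr ?ler_pdivrMr //; [|lra|lra].
  by rewrite divr_ge0 // ltW // divr_gt0.
have {}t8 := t8 th th0 thA; have {}Am := Am m hm.
have q : 3 * (A / (4 * pi)) <= - (sg * j * dS).
  apply: le_trans dS2; rewrite -mulrA -/G ler_pdivlMr //.
  have -> : 3 * (A / (4 * pi)) * pi = 3 * A / 4 by move: (lt0r_neq0 pi0); move: pi => P Pn; field.
  lra.
have r : sg * j * (sector_m Vx Vy m t - dS) <= A / (4 * pi).
  apply: le_trans (ler_norm _) _.
  by rewrite (normrM (sg * j)) (normrM sg) sgn mul1r.
have -> : - (sg * j * sector_m Vx Vy m t) =
  - (sg * j * dS) - sg * j * (sector_m Vx Vy m t - dS) by ring.
have a0 : 0 < A / (4 * pi) by exact: divr_gt0.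
move: q r a0; set a := A / (4 * pi); lra.
Qed.

(** Along the curve the arctangents of the step tend to - sg atan (1 / m) at the jump, and to pi / 2
    and - pi / 2 at its outer ends. *)
Lemma sector_limit (m : R) : 0 < m <= 1 -> exists eta : R, forall e, 0 < e ->
  exists2 d, 0 < d & forall t, 0 < sg * (t - c) < d -> `|V (sector m t) - eta| < e.
Proof.
move=> hm; have m0 : 0 < m by lra.
have pi0 := pi_gt0 R; have pi1 := @pi_gt1 R.
pose a0 := - sg * atan m^-1.
exists ((gp * (pi / 2 - a0) + gm * (a0 - - (pi / 2))) / pi) => e e0.
pose G := `|gp| + `|gm|.
have G0 : 0 <= G by rewrite addr_ge0.
have G1 : 0 < G + 1 by lra.
have K0 : 0 <= m^-1 by rewrite invr_ge0; lra.
have e4 : 0 < e / 4 by lra.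
have [d1 d10 hd] := poisson_step_close g_periodic gi0 sm K0 e4.
pose e' := e / (4 * (G + 1)).
have e'0 : 0 < e' by apply: divr_gt0 => //; lra.
have e'G : G * e' <= e / 4.
  have -> : e / 4 = (G + 1) * e' by rewrite /e'; field; lra.
  by rewrite ler_wpM2r //; lra.
have q0 : 0 < 1 / 4 :> R by lra.
have [d2 d20 hA] := atan_kap_cvg q0 e'0.
exists (Num.min (d1 / 2) (Num.min (d2 / 2) (m * e'))).
  by rewrite !lt_min (mulr_gt0 m0 e'0) andbT; lra.
move=> t; rewrite !lt_min => /andP[th0 /and3P[thd1 thd2 thm]].
have sg2 : sg * sg = 1 by case: sg1 => ->; ring.
have sgn : `|sg| = 1 by case: sg1 => ->; rewrite ?normrN normr1.
rewrite /sector; move: th0 thd1 thd2 thm; set th := sg * (t - c) => th0 thd1 thd2 thm.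
have tE : t - c = sg * th by rewrite /th mulrA sg2 mul1r.
have tcE : `|t - c| = th by rewrite tE normrM sgn mul1r ger0_norm // ltW.
have mth1 : m * th <= th by rewrite ler_piMl //; lra.
have mth0 : 0 < m * th by exact: mulr_gt0.
have {}hA x : 1 / 4 <= x -> `|atan (kap (m * th) * x) - pi / 2| <= e'.
  move=> hx; have := hA (m * th) ltac:(lra).
  have k0 : 0 < kap (m * th) by rewrite divr_gt0 //; lra.
  have : kap (m * th) * (1 / 4) <= kap (m * th) * x by rewrite ler_pM2l.
  move=> /le_atan; have := @atan_ltpi2 R (kap (m * th) * x).
  rewrite !ltr0_norm ?subr_lt0 ?atan_ltpi2 //; lra.
have A0 : `|atan (kap (m * th) * tan ((c + 0 - t) / 2)) - a0| <= e'.
  have -> : (c + 0 - t) / 2 = - (sg * th) / 2 by rewrite -tE; field.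
  rewrite tan_sg mulrCA.
  have -> : atan (- sg * (kap (m * th) * tan (th / 2))) = - sg * atan (kap (m * th) * tan (th / 2)).
    by case: sg1 => ->; rewrite ?opprK ?mulN1r ?mul1r // atanN.
  rewrite -mulrBr normrM normrN sgn mul1r; apply: le_trans (atan_lipschitz _ _) _.
  have [hm1 ht1] : 0 < m <= 1 /\ 0 < th <= 1 / 2 by split; lra.
  apply: le_trans (kap_tan hm1 ht1) _.
  by rewrite ltW // ltr_pdivrMr // mulrC.
have A1 : `|atan (kap (m * th) * tan ((c + 1 - t) / 2)) - pi / 2| <= e'.
  apply: hA; apply: tan_quarter.
  have -> : c + 1 - t = 1 - sg * th by rewrite -tE; ring.
  by case: sg1 => ->; lra.
have A2 : `|atan (kap (m * th) * tan ((c + - 1 - t) / 2)) - - (pi / 2)| <= e'.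
  have -> : (c + - 1 - t) / 2 = - ((1 + sg * th) / 2) by rewrite -tE; field.
  rewrite tanN mulrN atanN -opprD normrN; apply: hA; apply: tan_quarter.
  by case: sg1 => ->; lra.
have [||S1 _] := hd (m * th) t; [lra| |].
  by rewrite tcE mulrA mulVf ?mul1r ?gt_eqF.
rewrite V_poisson; last lra.
have S2 : `|step_poisson c gp gm (m * th) t -
   (gp * (pi / 2 - a0) + gm * (a0 - - (pi / 2))) / pi| <= e / 2.
  rewrite /step_poisson -mulrBl normrM (@gtr0_norm _ pi^-1) ?invr_gt0 //.
  rewrite ler_pdivrMr //.
  apply: le_trans (dist_jumps gp gm A0 A1 A2) _.
  have h1 : e / 2 <= e / 2 * pi by rewrite ler_peMr // ltW // divr_gt0.
  by apply: le_trans h1; rewrite -/G; move: e'G; lra.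
move: S1 S2; set P := poisson_integral _ _; set S := step_poisson _ _ _ _ _ => S1 S2.
apply: le_lt_trans (ler_distD S _ _) _; lra.
Qed.
End jump.

(** * Green's formula on curvilinear strips *)

Section parametric_integrals.
Context {R : realType}.
Local Notation mu := (@lebesgue_measure R).

Lemma continuous_slices (h : R * R -> R) (p : R * R) : {for p, continuous h} ->
  {for p.1, continuous (fun x => h (x, p.2))} /\ {for p.2, continuous (fun y => h (p.1, y))}.
Proof.
case: p => x y /= ch; split.
  by apply: (@continuous_comp _ _ _ (fun x : R => (x, y)) h) => //;
     apply: continuous_pair; [exact: cvg_id|exact: cvg_cst].
by apply: (@continuous_comp _ _ _ (fun y : R => (x, y)) h) => //;
   apply: continuous_pair; [exact: cvg_cst|exact: cvg_id].
Qed.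

Lemma continuous_segment_integrable (f : R -> R) (a b : R) :
  (forall x, a <= x <= b -> {for x, continuous f}) ->
  mu.-integrable `[a, b] (EFin \o f).
Proof.
move=> cf; apply: continuous_compact_integrable; first exact: segment_compact.
apply: continuous_in_subspaceT => x; rewrite inE /= in_itv /= => hx; exact: cf.
Qed.

Lemma FTC_segment (f F : R -> R) (a b : R) : a < b ->
  (forall x, a <= x <= b -> is_derive x 1 F (f x)) ->
  (forall x, a <= x <= b -> {for x, continuous f}) ->
  \int[mu]_(x in `[a, b]) f x = F b - F a.
Proof.
move=> ab dF cf.
have cF x : a <= x <= b -> {for x, continuous F}.
  by move=> hx; have [d _] := dF x hx; exact/differentiable_continuous/derivable1_diffP.
rewrite /Rintegral (@continuous_FTC2 R f F) //.
- apply: continuous_in_subspaceT => x; rewrite inE /= in_itv /= => hx; exact: cf.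
- split.
  + move=> x; rewrite in_itv /= => hx; have [|d _] := dF x _; first lra; exact: d.
  + by apply: cvg_at_right_filter; apply: cF; lra.
  + by apply: cvg_at_left_filter; apply: cF; lra.
- move=> x; rewrite in_itv /= => hx; have [|_ d] := dF x _; first lra.
  by rewrite derive1E.
Qed.

Lemma is_derive_ge (f df : R -> R) (a b B : R) : a <= b ->
  (forall x, a <= x <= b -> is_derive x 1 f (df x) /\ B <= df x) -> B * (b - a) <= f b - f a.
Proof.
move=> ab H; have [x hx ->] := @MVT_le R f df a b ab (fun x hx => (H x hx).1).
by rewrite ler_wpM2r ?subr_ge0 //; exact: (H x hx).2.
Qed.

Lemma rectangle_bound (h : R * R -> R) (u v a b : R) :
  (forall p, u <= p.1 <= v -> a <= p.2 <= b -> {for p, continuous h}) ->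
  exists G, 0 <= G /\ forall x y, u <= x <= v -> a <= y <= b -> `|h (x, y)| <= G.
Proof.
move=> ch; pose K := [set p : R * R | u <= p.1 <= v /\ a <= p.2 <= b].
have cK : compact K.
  rewrite (_ : K = `[u, v] `*` `[a, b]); first by apply: compact_setX; exact: segment_compact.
  by apply/seteqP; split => p /=; rewrite !in_itv.
have [K0|nK] := pselect (K !=set0); last first.
  by exists 0; split => // x y hx hy; case: nK; exists (x, y).
have [|c _ hc] := @compact_EVT_max _ R (fun p => `|h p|) K K0 cK.
  apply: continuous_in_subspaceT => p; rewrite inE => -[hp1 hp2].
  by apply: (@continuous_comp _ _ _ h (fun x : R => `|x|)); [exact: ch|exact: norm_continuous].
by exists `|h c|; split => // x y hx hy; apply: (hc (x, y)); rewrite inE.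
Qed.

Lemma continuous_parametric (h : R * R -> R) (u v a b m : R) : u < m < v ->
  (forall p, u <= p.1 <= v -> a <= p.2 <= b -> {for p, continuous h}) ->
  {for m, continuous (fun x => \int[mu]_(y in `[a, b]) h (x, y))}.
Proof.
move=> hm ch; have [G [G0 hG]] := rectangle_bound ch.
have mI : [set` `]u, v[] m by rewrite /= in_itv.
apply: (@continuity_under_integral R _ _ mu (fun x y => h (x, y)) `[a, b] _ u v _ _ (fun=> G)) => //.
- move=> x; rewrite /= in_itv /= => hx; apply: continuous_segment_integrable => y hy.
  by have [|//|_] := continuous_slices (ch (x, y) _ _) => /=; [lra|].
- apply/aeW => y; rewrite /= in_itv /= => hy x; rewrite inE /= in_itv /= => hx.
  by have [|//|+ _] := continuous_slices (ch (x, y) _ _) => /=; [lra|].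
- by apply: continuous_segment_integrable => y _; exact: cvg_cst.
- move=> x; rewrite /= in_itv /= => hx; apply/aeW => y; rewrite /= in_itv /= => hy.
  by apply: hG => //; lra.
- by rewrite inE.
Qed.

Lemma is_derive_parametric (h hm : R * R -> R) (u v a b m : R) : u < m < v ->
  (forall p, u <= p.1 <= v -> a <= p.2 <= b ->
    [/\ {for p, continuous h}, {for p, continuous hm} &
        is_derive p.1 1 (fun x => h (x, p.2)) (hm p)]) ->
  is_derive m 1 (fun x => \int[mu]_(y in `[a, b]) h (x, y)) (\int[mu]_(y in `[a, b]) hm (m, y)).
Proof.
move=> mI H; have [G [G0 hG]] : exists G, 0 <= G /\ forall x y, u <= x <= v -> a <= y <= b -> `|hm (x, y)| <= G.
  by apply: rectangle_bound => p h1 h2; have [] := H p h1 h2.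
have hI : [set` `]u, v[] m by rewrite /= in_itv.
pose f (x y : R) := h (x, y).
have intf x : [set` `]u, v[] x -> mu.-integrable `[a, b] (EFin \o f x).
  rewrite /= in_itv /= => hx; apply: continuous_segment_integrable => y hy.
  have [||c _ _] := H (x, y) => //=; first lra.
  by have [_] := continuous_slices c.
have D x y : [set` `]u, v[] x -> [set` `[a, b]] y -> is_derive x 1 (f ^~ y) (hm (x, y)).
  by rewrite /= !in_itv /= => hx hy; have [||_ _] := H (x, y) => //=; lra.
have derf x y : [set` `]u, v[] x -> [set` `[a, b]] y -> derivable (f ^~ y) x 1.
  by move=> hx hy; have [d _] := D x y hx hy.
have E x y : [set` `]u, v[] x -> [set` `[a, b]] y -> partial1of2 f x y = hm (x, y).
  by move=> hx hy; rewrite partial1of2E; have [_ d] := D x y hx hy.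
have intG : mu.-integrable `[a, b] (EFin \o (fun _ : R => G)).
  by apply: continuous_segment_integrable => y _; exact: cvg_cst.
have mab : measurable (`[a, b] : set R) by [].
have ub x y : [set` `]u, v[] x -> [set` `[a, b]] y -> `|partial1of2 f x y| <= G.
  move=> hx hy; rewrite E //; move: hx hy; rewrite /= !in_itv /= => hx hy.
  by apply: hG => //; lra.
have d1 := @derivable_under_integral R _ _ mu f `[a, b] mab m u v hI intf derf (fun=> G) (fun=> G0) intG ub.
have d2 := @differentiation_under_integral R _ _ mu f `[a, b] mab m u v hI intf derf (fun=> G) (fun=> G0) intG ub.
apply: DeriveDef; first exact: d1.
rewrite -derive1E d2; apply: eq_Rintegral => y; rewrite inE => hy; exact: E.
Qed.

Definition pos_part (x : R) : R := Num.max 0 x.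

Lemma is_derive_sqr_pos_part (x : R) : is_derive x 1 (fun y => pos_part y ^+ 2) (2 * pos_part x).
Proof.
have [x0|x0|->] := ltgtP x 0.
- have n : \forall y \near x, 0 = pos_part y ^+ 2.
    have : \forall y \near x, y < 0 by exact: lt_nbhsl.
    by apply: filterS => y y0; rewrite /pos_part max_l ?expr0n // ltW.
  apply: (near_eq_is_derive n); rewrite /pos_part max_l ?ltW // mulr0.
  exact: is_derive_cst.
- have n : \forall y \near x, y ^+ 2 = pos_part y ^+ 2.
    have : \forall y \near x, 0 < y by exact: lt_nbhsr.
    by apply: filterS => y y0; rewrite /pos_part max_r // ltW.
  apply: (near_eq_is_derive n); rewrite /pos_part max_r ?ltW //.
  have d : is_derive x 1 (fun y : R => y ^+ 2) _ := is_deriveX 2 (is_derive_id x 1).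
  by apply: (is_derive_eq d); rewrite /GRing.scale /= expr1 mulr1.
- rewrite {2}/pos_part maxxx mulr0.
  have C : h^-1 *: (pos_part (h *: 1 + 0) ^+ 2 - pos_part 0 ^+ 2) @[h --> (0 : R)^'] --> (0 : R).
    apply/cvgrPdist_le => e e0.
    have : \forall h \near (0 : R)^', `|h| < e.
      by apply: cvg_within; have := nbhsx_ballx (0 : R) e e0; apply: filterS => h; rewrite /ball /= sub0r normrN.
    apply: filterS => h he; rewrite /GRing.scale /= mulr1 addr0.
    rewrite {2}/pos_part maxxx expr0n subr0 sub0r normrN normrM /pos_part.
    case: (ltgtP h 0) => h0.
    + by rewrite expr0n normr0 mulr0 ltW.
    + rewrite -normrM; rewrite expr2 mulKf ?gt_eqF //; exact: ltW.
    + by rewrite h0 expr0n normr0 mulr0 ltW.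
  apply: DeriveDef; first by apply/cvg_ex; exists 0.
  exact: (cvg_lim _ C).
Qed.

End parametric_integrals.

Section pointwise_rules.
Context {R : realType}.

Section continuity.
Context {T : topologicalType} (x : T).
Implicit Types A B : T -> R.

Lemma continuous_add A B : {for x, continuous A} -> {for x, continuous B} ->
  {for x, continuous (fun q => A q + B q)}.
Proof. exact: continuousD. Qed.

Lemma continuous_opp A : {for x, continuous A} -> {for x, continuous (fun q => - A q)}.
Proof. exact: continuousN. Qed.

Lemma continuous_mul A B : {for x, continuous A} -> {for x, continuous B} ->
  {for x, continuous (fun q => A q * B q)}.
Proof. exact: continuousM. Qed.

Lemma continuous_post A (h : R -> R) : {for x, continuous A} -> {for A x, continuous h} ->
  {for x, continuous (fun q => h (A q))}.
Proof. exact: (@continuous_comp _ _ _ A h). Qed.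
End continuity.

Implicit Types (A B : R -> R) (x a b : R).

Lemma is_derive_add A B x a b : is_derive x 1 A a -> is_derive x 1 B b ->
  is_derive x 1 (fun y => A y + B y) (a + b).
Proof. exact: is_deriveD. Qed.

Lemma is_derive_opp A x a : is_derive x 1 A a -> is_derive x 1 (fun y => - A y) (- a).
Proof. exact: is_deriveN. Qed.

Lemma is_derive_mul A B x a b : is_derive x 1 A a -> is_derive x 1 B b ->
  is_derive x 1 (fun y => A y * B y) (A x * b + B x * a).
Proof. exact: is_deriveM. Qed.

Lemma is_derive_post A (h : R -> R) x a b : is_derive x 1 A a -> is_derive (A x) 1 h b ->
  is_derive x 1 (fun y => h (A y)) (b * a).
Proof. by move=> dA dh; exact: (@is_derive1_comp R h A x _ _ dh dA). Qed.

End pointwise_rules.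

Ltac solve_continuous := repeat lazymatch goal with
  | |- {for ?x, continuous ?f} => lazymatch f with
    | (fun _ => ?k) => exact: cvg_cst
    | (fun q => q.1) => exact: continuous_fst2
    | (fun q => q.2) => exact: continuous_snd2
    | (fun q => q) => exact: cvg_id
    | (fun q => @?A q + @?B q) => refine (@continuous_add _ _ x A B _ _); cbv beta
    | (fun q => - @?A q) => refine (@continuous_opp _ _ x A _); cbv beta
    | (fun q => @?A q * @?B q) => refine (@continuous_mul _ _ x A B _ _); cbv beta
    | (fun q => @?A q ^+ 2) => refine (@continuous_mul _ _ x A A _ _); cbv beta
    | (fun q => cos (@?A q)) =>
        refine (@continuous_post _ _ x A cos _ (@continuous_cos _ _)); cbv beta
    | (fun q => sin (@?A q)) =>
        refine (@continuous_post _ _ x A sin _ (@continuous_sin _ _)); cbv beta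
    | _ => eassumption
    end
  end.

Ltac solve_derive := eapply is_derive_eq; [ repeat first
  [ eassumption | eapply is_derive_id | eapply is_derive_cst
  | eapply is_derive_add | eapply is_derive_opp | eapply is_derive_mul
  | eapply (@is_derive_post _ _ cos); [ | exact: is_derive_cos ]
  | eapply (@is_derive_post _ _ sin); [ | exact: is_derive_sin ] ] | ].

Section green.
Context {R : realType}.
Local Notation mu := (@lebesgue_measure R).
Variables (U Ux Uy V Vx Vy Vxx Vxy Vyx Vyy : R * R -> R) (c sg : R).
Hypothesis hU : C1_2 U Ux Uy.
Hypothesis hV : C1_2 V Vx Vy.
Hypothesis hVx : C1_2 Vx Vxx Vxy.
Hypothesis hVy : C1_2 Vy Vyx Vyy.

Local Notation phi p := (c + sg * p.2).
Let xm (p : R * R) : R := - (p.2 * cos (phi p)).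
Let ym (p : R * R) : R := - (p.2 * sin (phi p)).
Let xt (p : R * R) : R := - (p.1 * cos (phi p)) - sg * (1 - p.1 * p.2) * sin (phi p).
Let yt (p : R * R) : R := - (p.1 * sin (phi p)) + sg * (1 - p.1 * p.2) * cos (phi p).
Let xmt (p : R * R) : R := - cos (phi p) + sg * p.2 * sin (phi p).
Let ymt (p : R * R) : R := - sin (phi p) - sg * p.2 * cos (phi p).

(* The point of Gamma_{zeta,m} at the angle c + t (sg = 1) or c - t (sg = -1), for
   zeta = e^(i c) and p = (m, t). *)
Definition angular (p : R * R) : R * R :=
  ((1 - p.1 * p.2) * cos (phi p), (1 - p.1 * p.2) * sin (phi p)).
Local Notation st := angular.
Definition inside (p : R * R) := 0 < p.1 * p.2 < 1.

Lemma angular_disk p : inside p -> disk2 (st p).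
Proof.
move=> ip; rewrite (_ : st p = radial (1 - p.1 * p.2) (phi p)) //.
by apply: radial_disk; move: ip; rewrite /inside; lra.
Qed.

Definition along_m (ux uy : R * R -> R) (p : R * R) : R := ux (st p) * xm p + uy (st p) * ym p.
Definition along_t (ux uy : R * R -> R) (p : R * R) : R := ux (st p) * xt p + uy (st p) * yt p.

Lemma derive_along_m u ux uy p : C1_2 u ux uy -> inside p ->
  is_derive p.1 1 (fun m => u (st (m, p.2))) (along_m ux uy p).
Proof.
case: p => m t hu /angular_disk; rewrite /st /= => D.
apply: (@C1_chain _ u ux uy hu (fun m => (1 - m * t) * cos (c + sg * t))
  (fun m => (1 - m * t) * sin (c + sg * t)) m (xm (m, t)) (ym (m, t)) D);
  by solve_derive; rewrite /xm /ym /=; ring.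
Qed.

Lemma derive_along_t u ux uy p : C1_2 u ux uy -> inside p ->
  is_derive p.2 1 (fun t => u (st (p.1, t))) (along_t ux uy p).
Proof.
case: p => m t hu /angular_disk; rewrite /st /= => D.
apply: (@C1_chain _ u ux uy hu (fun t => (1 - m * t) * cos (c + sg * t))
  (fun t => (1 - m * t) * sin (c + sg * t)) t (xt (m, t)) (yt (m, t)) D);
  by solve_derive; rewrite /xt /yt /=; ring.
Qed.

Lemma continuous_angular (p : R * R) (u : R * R -> R) : inside p -> {for st p, continuous u} ->
  {for p, continuous (fun q => u (st q))}.
Proof.
move=> ip cu; apply: (@continuous_comp _ _ _ st u) => //.
apply: (@continuous_pair _ _ (fun q : R * R => (1 - q.1 * q.2) * cos (phi q))
  (fun q : R * R => (1 - q.1 * q.2) * sin (phi q))); solve_continuous.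
Qed.

Lemma continuous_angular_C1 (p : R * R) (u ux uy : R * R -> R) : C1_2 u ux uy -> inside p ->
  [/\ {for p, continuous (fun q => u (st q))},
      {for p, continuous (fun q => ux (st q))} & {for p, continuous (fun q => uy (st q))}].
Proof.
move=> hu ip; have D := angular_disk ip; have [_ _ c1 c2] := hu _ D.
by split; apply: continuous_angular => //; exact: (C1_continuous hu D).
Qed.

Lemma continuous_along (u ux uy : R * R -> R) (p : R * R) : C1_2 u ux uy -> inside p ->
  {for p, continuous (along_m ux uy : R * R -> R)} /\ {for p, continuous (along_t ux uy : R * R -> R)}.
Proof.
move=> hu ip; have [c0 c1 c2] := continuous_angular_C1 hu ip.
by split; rewrite /along_m /along_t /xm /ym /xt /yt; solve_continuous.
Qed.

Local Notation Vm := (along_m Vx Vy).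
Local Notation Vt := (along_t Vx Vy).
Local Notation Um := (along_m Ux Uy).
Local Notation Ut := (along_t Ux Uy).

(** The mixed second derivative of V in the coordinates (m, t). [derive_Vm] and [derive_Vt] both
    arrive at it, the second by [schwarz], so dV is closed in these coordinates. *)
Let W (p : R * R) : R := along_t Vxx Vxy p * xm p + Vx (st p) * xmt p +
  (along_t Vyx Vyy p * ym p + Vy (st p) * ymt p).

Let derive_Vm p : inside p -> is_derive p.2 1 (fun t => Vm (p.1, t)) (W p).
Proof.
case: p => m t ip; have d1 := derive_along_t hVx ip; have d2 := derive_along_t hVy ip.
rewrite /along_m /xm /ym /= in d1 d2 *.
by solve_derive; rewrite /W /xm /ym /xmt /ymt /=; ring.
Qed.

Let derive_Vt p : inside p -> is_derive p.1 1 (fun m => Vt (m, p.2)) (W p).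
Proof.
case: p => m t ip; have d1 := derive_along_m hVx ip; have d2 := derive_along_m hVy ip.
have S := schwarz hV hVx hVy (angular_disk ip).
rewrite /along_t /xt /yt /= in d1 d2 *.
solve_derive; rewrite /W /along_m /along_t /xm /ym /xmt /ymt /xt /yt /= S; ring.
Qed.

Let continuous_W p : inside p -> {for p, continuous W}.
Proof.
move=> ip; have [c1 c2 c3] := continuous_angular_C1 hVx ip.
have [c4 c5 c6] := continuous_angular_C1 hVy ip.
by rewrite /W /along_t /xm /ym /xmt /ymt /xt /yt; solve_continuous.
Qed.

Definition jacobian (p : R * R) : R := Ux p * Vy p - Uy p * Vx p.

(** The factor sg (1 - m t) t is the determinant of the change of variables from (t, m) to the
    plane. *)
Lemma angular_jacobian p : Ut p * Vm p - Um p * Vt p =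
  sg * ((1 - p.1 * p.2) * p.2 * jacobian (st p)).
Proof.
have e : cos (phi p) ^+ 2 + sin (phi p) ^+ 2 = 1 := cos2Dsin2 _.
transitivity (sg * ((1 - p.1 * p.2) * p.2 * jacobian (st p)) *
  (cos (phi p) ^+ 2 + sin (phi p) ^+ 2)); last by rewrite e mulr1.
rewrite /along_t /along_m /jacobian /xt /yt /xm /ym; ring.
Qed.

Variables chi chi' : R -> R.
Hypothesis dchi : forall y : R, is_derive y 1 chi (chi' y).
Hypothesis cchi' : forall y : R, {for y, continuous chi'}.

Let cchi (y : R) : {for y, continuous chi}.
Proof. by have [d _] := dchi y; exact/differentiable_continuous/derivable1_diffP. Qed.

(* The components of the form U chi(V) dV in the coordinates (m, t); by
   flux_curl its exterior derivative is sg * density. *)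
Definition flux_m (p : R * R) : R := U (st p) * chi (V (st p)) * Vm p.
Definition flux_t (p : R * R) : R := U (st p) * chi (V (st p)) * Vt p.
Definition density (p : R * R) : R :=
  chi (V (st p)) * ((1 - p.1 * p.2) * p.2 * jacobian (st p)).

Let flux_m_t (p : R * R) : R := Ut p * chi (V (st p)) * Vm p +
  U (st p) * chi' (V (st p)) * Vt p * Vm p + U (st p) * chi (V (st p)) * W p.
Let flux_t_m (p : R * R) : R := Um p * chi (V (st p)) * Vt p +
  U (st p) * chi' (V (st p)) * Vm p * Vt p + U (st p) * chi (V (st p)) * W p.

(** The terms with chi' are symmetric in m and t and those with [W] coincide, so only the wedge
    product of dU and dV, times chi (V), survives. *)
Let flux_curl (p : R * R) : flux_t_m p = flux_m_t p - sg * density p.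
Proof.
have := angular_jacobian p; rewrite /flux_t_m /flux_m_t /density => h.
rewrite [sg * _]mulrCA -h; ring.
Qed.

Let continuous_chiV (p : R * R) : inside p ->
  {for p, continuous (fun q => chi (V (st q)))} /\
  {for p, continuous (fun q => chi' (V (st q)))}.
Proof.
move=> ip; have [c0 _ _] := continuous_angular_C1 hV ip.
by split; apply: continuous_post => //; exact: cchi.
Qed.

Let derive_flux_m (p : R * R) : inside p -> is_derive p.2 1 (fun t => flux_m (p.1, t)) (flux_m_t p).
Proof.
case: p => m t ip; have dU := derive_along_t hU ip; have dV := derive_along_t hV ip.
have dc := is_derive_post dV (dchi _).
have dVm := derive_Vm ip; rewrite /flux_m /= in dU dV dc dVm *.
by solve_derive; rewrite /flux_m_t /=; ring.
Qed.

Let derive_flux_t (p : R * R) : inside p -> is_derive p.1 1 (fun m => flux_t (m, p.2)) (flux_t_m p).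
Proof.
case: p => m t ip; have dU := derive_along_m hU ip; have dV := derive_along_m hV ip.
have dc := is_derive_post dV (dchi _).
have dVt := derive_Vt ip; rewrite /flux_t /= in dU dV dc dVt *.
by solve_derive; rewrite /flux_t_m /=; ring.
Qed.

Lemma continuous_fluxes (p : R * R) : inside p ->
  [/\ {for p, continuous (flux_m : R * R -> R)}, {for p, continuous (flux_t : R * R -> R)},
      {for p, continuous (density : R * R -> R)}, {for p, continuous (flux_m_t : R * R -> R)} &
      {for p, continuous (flux_t_m : R * R -> R)}].
Proof.
move=> ip; have [a1 a2 a3] := continuous_angular_C1 hU ip.
have [b1 b2 b3] := continuous_angular_C1 hV ip.
have [cUm cUt] := continuous_along hU ip; have [cVm cVt] := continuous_along hV ip.
have [cc cc'] := continuous_chiV ip; have cW := continuous_W ip.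
by split; rewrite /flux_m /flux_t /density /flux_m_t /flux_t_m /jacobian; solve_continuous.
Qed.

(** Green's formula differentiated in m: the flux along a piece of curve changes by the flux through
    its two ends and by the density on it. *)
Lemma derive_integral_flux (m al be : R) : 0 < m -> 0 < al -> al < be -> m * be < 1 ->
  is_derive m 1 (fun x => \int[mu]_(t in `[al, be]) flux_t (x, t))
    (flux_m (m, be) - flux_m (m, al) - sg * \int[mu]_(t in `[al, be]) density (m, t)).
Proof.
move=> m0 al0 ab mb; have be0 : 0 < be by lra.
(* Halfway from m to 1 / be: a neighbourhood of m on which the whole rectangle still parametrizes
   points of the disk. *)
pose v := (m + be^-1) / 2.
have mbe : m < be^-1 by rewrite -[be^-1]mul1r ltr_pdivlMr.
have vbe : v * be < 1 by rewrite -ltr_pdivlMr // mul1r /v; lra.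
have ins (p : R * R) : m / 2 <= p.1 <= v -> al <= p.2 <= be -> inside p.
  move=> h1 h2; rewrite /inside mulr_gt0 /=; [|lra|lra].
  by apply: le_lt_trans vbe; apply: ler_pM; lra.
have mI : m / 2 < m < v by rewrite /v; lra.
have H (p : R * R) : m / 2 <= p.1 <= v -> al <= p.2 <= be ->
    [/\ {for p, continuous (flux_t : R * R -> R)}, {for p, continuous (flux_t_m : R * R -> R)} &
        is_derive p.1 1 (fun x => flux_t (x, p.2)) (flux_t_m p)].
  move=> h1 h2; have ip := ins p h1 h2; have [_ c1 _ _ c2] := continuous_fluxes ip.
  by split => //; exact: derive_flux_t.
apply: (is_derive_eq (is_derive_parametric mI H)).
have insm t : al <= t <= be -> inside (m, t) by move=> ht; apply: ins => //=; lra.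
have c1 t : al <= t <= be -> {for t, continuous (fun t => flux_m_t (m, t))}.
  by move=> ht; have [_ _ _ c1 _] := continuous_fluxes (insm t ht); have [] := continuous_slices c1.
have c2 t : al <= t <= be -> {for t, continuous (fun t => density (m, t))}.
  by move=> ht; have [_ _ c2 _ _] := continuous_fluxes (insm t ht); have [] := continuous_slices c2.
have c3 t : al <= t <= be -> {for t, continuous (fun t => sg * density (m, t))}.
  by move=> ht; apply: continuous_mul; [exact: cvg_cst|exact: c2].
have mab : measurable (`[al, be] : set R) by [].
rewrite -(@FTC_segment R (fun t => flux_m_t (m, t)) (fun t => flux_m (m, t)) _ _ ab (fun t ht => derive_flux_m (insm t ht)) c1).
rewrite -RintegralZl //; last exact: continuous_segment_integrable.
rewrite -RintegralB //; [|exact: continuous_segment_integrable|exact: continuous_segment_integrable].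
by apply: eq_Rintegral => t _; exact: flux_curl.
Qed.

End green.

(** * A cutoff in the values of V *)

Section cutoff.
Context {R : realType}.
Local Notation mu := (@lebesgue_measure R).
Implicit Types p q y : R.

Lemma pos_part_ge0 y : 0 <= pos_part y.
Proof. by rewrite /pos_part le_max lexx. Qed.

Lemma pos_part_le y : pos_part y <= `|y|.
Proof. by rewrite /pos_part ge_max normr_ge0 ler_norm. Qed.

Lemma le_pos_part y : y <= pos_part y.
Proof. by rewrite /pos_part le_max lexx orbT. Qed.

Lemma pos_part_continuous y : {for y, continuous (@pos_part R)}.
Proof.
by rewrite (_ : @pos_part R = (fun x => Num.max ((fun=> 0) x) x)) //;
   apply: continuous_max; [exact: cvg_cst|exact: cvg_id].
Qed.

(** The squares of positive parts are of class C^1, the smoothness that [derive_integral_flux] asks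
    of chi. *)
Definition cutoff p q y : R := pos_part (y - p) ^+ 2 * pos_part (q - y) ^+ 2.
Definition cutoff' p q y : R := pos_part (y - p) ^+ 2 * (2 * pos_part (q - y) * -1) +
  pos_part (q - y) ^+ 2 * (2 * pos_part (y - p) * 1).

Lemma is_derive_cutoff p q y : is_derive y 1 (cutoff p q) (cutoff' p q y).
Proof.
apply: is_derive_mul; apply: (is_derive_post (h := fun y => pos_part y ^+ 2)) (is_derive_sqr_pos_part _).
  by solve_derive; rewrite addr0.
by solve_derive; rewrite add0r.
Qed.

Lemma cutoff'_continuous p q y : {for y, continuous (cutoff' p q)}.
Proof.
have c1 : {for y, continuous (fun y => pos_part (y - p))}.
  by apply: (continuous_post (h := pos_part)); [solve_continuous; exact: cvg_id|exact: pos_part_continuous].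
have c2 : {for y, continuous (fun y => pos_part (q - y))}.
  by apply: (continuous_post (h := pos_part)); [solve_continuous; exact: cvg_id|exact: pos_part_continuous].
by rewrite /cutoff'; solve_continuous.
Qed.

Lemma cutoff_ge0 p q y : 0 <= cutoff p q y.
Proof. by rewrite mulr_ge0 // sqr_ge0. Qed.

Lemma cutoff_le p q y : cutoff p q y <= (`|y| + `|p|) ^+ 2 * (`|q| + `|y|) ^+ 2.
Proof.
apply: ler_pM; rewrite ?sqr_ge0 //; rewrite lerXn2r ?nnegrE ?pos_part_ge0 ?addr_ge0 //;
  by apply: le_trans (pos_part_le _) (ler_normB _ _).
Qed.

Lemma cutoff_eq0 p q y : y <= p \/ q <= y -> cutoff p q y = 0.
Proof.
rewrite /cutoff /pos_part; case=> h.
  by rewrite max_l ?subr_le0 // expr0n mul0r.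
by rewrite [Num.max 0 (q - y)]max_l ?subr_le0 // expr0n mulr0.
Qed.

Lemma cutoff_ge p q y r : 0 <= r -> r <= y - p -> r <= q - y -> r ^+ 4 <= cutoff p q y.
Proof.
move=> r0 h1 h2; rewrite (_ : r ^+ 4 = r ^+ 2 * r ^+ 2); last by rewrite -exprD.
apply: ler_pM; rewrite ?sqr_ge0 //; rewrite lerXn2r ?nnegrE ?pos_part_ge0 //;
  exact: le_trans (le_pos_part _).
Qed.

End cutoff.

(** * The integral over a strip *)

Section strip_estimate.
Context {R : realType}.
Local Notation mu := (@lebesgue_measure R).
Variables (U Ux Uy V Vx Vy Vxx Vxy Vyx Vyy w : R * R -> R) (c sg M : R).
Hypothesis hU : C1_2 U Ux Uy.
Hypothesis hV : C1_2 V Vx Vy.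
Hypothesis hVx : C1_2 Vx Vxx Vxy.
Hypothesis hVy : C1_2 Vy Vyx Vyy.
Hypothesis sg1 : sg = 1 \/ sg = -1.
Hypothesis bU : forall p, disk2 p -> `|U p| <= M.
Hypothesis bV : forall p, disk2 p -> `|V p| <= M.
Hypothesis cw : forall p : R * R, disk2 p -> {for p, continuous w}.
Hypothesis w0 : forall p, disk2 p -> 0 <= w p.
Hypothesis wJ : forall p, disk2 p ->
  w p * (Vx p ^+ 2 + Vy p ^+ 2) <= 4 * jacobian Ux Uy Vx Vy p.
Local Notation st := (angular c sg).
Local Notation Vm := (along_m c sg Vx Vy).
Variables (m1 m1' m2' m2 th1 c0 : R).
Hypothesis hm : [/\ 0 < m1, m1 < m1', m1' <= m2', m2' < m2 & m2 <= 1].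
Hypothesis c00 : 0 < c0.
Hypothesis th1_range : 0 < th1 <= 1 / 2.
Hypothesis hVm : forall p : R * R, m1 <= p.1 <= m2 -> 0 < p.2 < th1 -> c0 <= Vm p.
Hypothesis V_limit : forall m : R, m1 <= m <= m2 -> exists eta : R, forall e : R, 0 < e ->
  exists2 d : R, 0 < d & forall t : R, 0 < t < d -> `|V (st (m, t)) - eta| < e.

Let ins (m t : R) : m1 <= m <= m2 -> 0 < t < th1 -> inside (m, t).
Proof.
move=> h1 /andP[t0 t1]; have [h2 _ _ _ h3] := hm; have := th1_range => h4.
rewrite /inside /= mulr_gt0 //=; [|lra].
have : m * t <= 1 * (1 / 2) by apply: ler_pM; lra.
lra.
Qed.

Let V_increase (m m' t : R) : m1 <= m -> m <= m' -> m' <= m2 -> 0 < t < th1 ->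
  V (st (m, t)) + c0 * (m' - m) <= V (st (m', t)).
Proof.
move=> h1 h2 h3 ht.
have subx (x : R) : m <= x <= m' -> m1 <= x <= m2 by lra.
have [x hx] := @MVT_le R (fun m => V (st (m, t))) (fun m => Vm (m, t)) m m' h2
  (fun x hx => derive_along_m c sg hV (@ins x t (subx x hx) ht)).
move=> /= E; have := @ler_wpM2r R (m' - m) ltac:(lra) _ _ (hVm (p := (x, t)) ltac:(rewrite /=; lra) ht).
lra.
Qed.

(** V_m is - t times the radial derivative of V, so |grad V| >= c0 / t. The 8 is the 4 of the
    hypothesis on [w] times a 2 from 1 - m t >= 1 / 2. *)
Let jacobian_ge (p : R * R) : m1 <= p.1 <= m2 -> 0 < p.2 < th1 ->
  c0 ^+ 2 / 8 * (w (st p) / p.2) <= (1 - p.1 * p.2) * p.2 * jacobian Ux Uy Vx Vy (st p).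
Proof.
case: p => m t /= h1 ht; have D := angular_disk c sg (ins h1 ht).
have hv := hVm (p := (m, t)) h1 ht; have hJ := wJ D; have hw := w0 D.
have t0 : 0 < t by lra.
have := th1_range => h4; have [h2 _ _ _ h3] := hm.
have mt : m * t <= 1 * (1 / 2) by apply: ler_pM; lra.
set p := st (m, t) in D hJ hw *.
set gx := Vx p in hJ *; set gy := Vy p in hJ *.
pose cs := cos (c + sg * t); pose sn := sin (c + sg * t).
have vE : Vm (m, t) = - t * (gx * cs + gy * sn).
  by rewrite /along_m -/p -/gx -/gy /= -/cs -/sn; ring.
have e : cs ^+ 2 + sn ^+ 2 = 1 := cos2Dsin2 _.
(* Cauchy-Schwarz *)
have cs1 : (gx * cs + gy * sn) ^+ 2 <= gx ^+ 2 + gy ^+ 2.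
  rewrite -[leRHS]mulr1 -e -subr_ge0.
  have -> : (gx ^+ 2 + gy ^+ 2) * (cs ^+ 2 + sn ^+ 2) - (gx * cs + gy * sn) ^+ 2 =
    (gx * sn - gy * cs) ^+ 2 by ring.
  exact: sqr_ge0.
have c2 : c0 ^+ 2 <= t ^+ 2 * (gx ^+ 2 + gy ^+ 2).
  apply: (@le_trans _ _ (Vm (m, t) ^+ 2)).
    by have c0p := c00; rewrite lerXn2r ?nnegrE //; lra.
  by rewrite vE exprMn sqrrN ler_wpM2l ?sqr_ge0.
have J0 : t * (w p * (gx ^+ 2 + gy ^+ 2)) <= t * (4 * jacobian Ux Uy Vx Vy p).
  by rewrite ler_pM2l.
have k : c0 ^+ 2 * (w p / t) <= t * (w p * (gx ^+ 2 + gy ^+ 2)).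
  rewrite mulrA ler_pdivrMr //.
  have -> : t * (w p * (gx ^+ 2 + gy ^+ 2)) * t = t ^+ 2 * (gx ^+ 2 + gy ^+ 2) * w p by ring.
  by rewrite ler_wpM2r.
have wg : 0 <= t * (w p * (gx ^+ 2 + gy ^+ 2)).
  by rewrite !mulr_ge0 ?addr_ge0 ?sqr_ge0 // ltW.
have J1 : 0 <= t * jacobian Ux Uy Vx Vy p by lra.
have : 1 / 2 * (t * jacobian Ux Uy Vx Vy p) <= (1 - m * t) * (t * jacobian Ux Uy Vx Vy p).
  by rewrite ler_wpM2r //; lra.
move: J0 k wg J1; move: (jacobian _ _ _ _ _) (w p * _) (w p / t) => J S wt J0 k wg J1 h; lra.
Qed.

(* Q is the integral of the form U chi(V) dV along the curve, made monotone by
   adding a multiple of V at its two ends; it stands for the double integral over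
   the strip, which is never formed. *)
Lemma strip_estimate : exists C th0 : R, 0 < th0 < th1 /\
  forall eps : R, 0 < eps < th0 -> exists Q dQ : R -> R, Q m2' - Q m1' <= C /\
    forall m : R, m1' <= m <= m2' -> is_derive m 1 Q (dQ m) /\
      \int[mu]_(t in `[eps, th0]) (w (st (m, t)) / t) <= dQ m.
Proof.
have four (x y z u : R) : - M <= x <= M -> - M <= y <= M -> - M <= z <= M -> - M <= u <= M ->
  z + u - (x + y) <= 4 * M by lra.
have [m10 m11 m12 m22 m21] := hm.
have in1 : m1 <= m1 <= m2 by lra.
have in2 : m1 <= m2 <= m2 by lra.
have [m11' m12' m22'] : [/\ m1 <= m1', m1' <= m2 & m2' <= m2] by split; lra.
have m12'' : m1 <= m2' by lra.
have th1r := th1_range; have c0p := c00.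
have [eta1 L1] := V_limit in1.
have [eta2 L2] := V_limit in2.
(* On the extreme curves V will be within r of its limits eta1 and eta2, and it increases by at
   least 4 r before m1' and after m2'. With p = eta1 + r and q = eta2 - r the cutoff vanishes on the
   extreme curves, and on the inner strip V keeps a margin of 2 r from p and q. *)
have [r r0 [r1 r2]] : exists2 r : R, 0 < r & 4 * r <= c0 * (m1' - m1) /\ 4 * r <= c0 * (m2 - m2').
  exists (c0 / 4 * Num.min (m1' - m1) (m2 - m2')).
    by rewrite mulr_gt0 // ?lt_min; lra.
  have e : 4 * (c0 / 4 * Num.min (m1' - m1) (m2 - m2')) = c0 * Num.min (m1' - m1) (m2 - m2') by field.
  by split; rewrite e ler_pM2l // ge_min lexx ?orbT.
have [d1 d10 hd1] := L1 r r0; have [d2 d20 hd2] := L2 r r0.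
pose p := eta1 + r; pose q := eta2 - r.
pose X := (M + `|p|) ^+ 2 * (`|q| + M) ^+ 2.
have D00 : disk2 (0 : R * R) by rewrite /disk2 /= !expr0n /= addr0.
have M0 : 0 <= M by apply: le_trans (bU D00).
have X0 : 0 <= X by rewrite mulr_ge0 ?sqr_ge0.
have chiX y : `|y| <= M -> cutoff p q y <= X.
  move=> hy; apply: le_trans (cutoff_le p q y) _.
  by apply: ler_pM; rewrite ?sqr_ge0 //; rewrite lerXn2r ?nnegrE ?addr_ge0 //; lra.
pose k := r ^+ 4 * (c0 ^+ 2 / 8).
have k0 : 0 < k by rewrite mulr_gt0 ?exprn_gt0 // divr_gt0 ?exprn_gt0.
pose th0 := Num.min (th1 / 2) (Num.min (d1 / 2) (d2 / 2)).
have th00 : 0 < th0 by rewrite !lt_min; lra.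
have [th0d1 [th0d2 th0d3]] : th0 < th1 /\ th0 < d1 /\ th0 < d2.
  have : th0 <= th1 / 2 by rewrite ge_min lexx.
  have : th0 <= d1 / 2 by rewrite !ge_min lexx orbT.
  have : th0 <= d2 / 2 by rewrite !ge_min lexx !orbT.
  lra.
have zero (m t : R) : m = m1 \/ m = m2 -> 0 < t <= th0 -> cutoff p q (V (st (m, t))) = 0.
  move=> hm' /andP[t0 ht]; apply: cutoff_eq0; case: hm' => ->; [left|right].
    by have := hd1 t; rewrite /p ltr_norml t0 (le_lt_trans ht) // => /(_ isT)/andP[_]; lra.
  by have := hd2 t; rewrite /q ltr_norml t0 (le_lt_trans ht) // => /(_ isT)/andP[]; lra.
have lo (m t : R) : m1' <= m <= m2' -> 0 < t <= th0 -> r ^+ 4 <= cutoff p q (V (st (m, t))).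
  move=> /andP[hma hmb] /andP[t0 ht].
  have tr : 0 < t < th1 by rewrite t0 (le_lt_trans ht).
  apply: cutoff_ge; first exact: ltW.
    have i1 := V_increase (lexx _) (ltW (lt_le_trans m11 hma)) (le_trans hmb m22') tr.
    have := hd1 t; rewrite ltr_norml t0 (le_lt_trans ht) // => /(_ isT)/andP[x1 x2].
    have : c0 * (m1' - m1) <= c0 * (m - m1) by rewrite ler_pM2l // lerB.
    by rewrite /p; move: r1 i1 x2; lra.
  have i1 := V_increase (le_trans m11' hma) (le_trans hmb m22') (lexx _) tr.
  have := hd2 t; rewrite ltr_norml t0 (le_lt_trans ht) // => /(_ isT)/andP[x1 x2].
  have : c0 * (m2 - m2') <= c0 * (m2 - m) by rewrite ler_pM2l // lerB.
  by rewrite /q; move: r2 i1 x1; lra.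
exists (k^-1 * (4 * M ^+ 2 * X)), th0; split; first by rewrite th00.
move=> eps /andP[eps0 epst].
have er : eps <= th0 <= th0 by rewrite lexx andbT ltW.
have el : eps <= eps <= th0 by rewrite lexx ltW.
have tin (t : R) : eps <= t <= th0 -> 0 < t < th1.
  by move=> /andP[t1 t2]; rewrite (lt_le_trans eps0 t1) (le_lt_trans t2).
pose fm := flux_m U V Vx Vy c sg (cutoff p q).
pose ft := flux_t U V Vx Vy c sg (cutoff p q).
pose dn := density Ux Uy V Vx Vy c sg (cutoff p q).
pose Phi (m : R) := \int[mu]_(t in `[eps, th0]) ft (m, t).
pose K (m : R) := \int[mu]_(t in `[eps, th0]) dn (m, t).
(* The flux through t = th0 and t = eps is at most M X V_m in absolute value, as |U| <= M and chi <=
   X; the derivative of the added term compensates for it. The factor - sg gives the density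
   integral [K] the sign +. *)
pose Q0 (m : R) := - sg * Phi m + M * X * (V (st (m, th0)) + V (st (m, eps))).
pose dQ0 (m : R) := - sg * (fm (m, th0) - fm (m, eps) - sg * K m) +
  M * X * (Vm (m, th0) + Vm (m, eps)).
have sg2 : sg * sg = 1 by case: sg1 => ->; ring.
have sgn : `|sg| = 1 by case: sg1 => ->; rewrite ?normrN normr1.
have insm (m t : R) : m1 <= m <= m2 -> eps <= t <= th0 -> inside (m, t).
  by move=> h1 /tin; exact: ins.
have dQ (m : R) : m1 <= m <= m2 -> is_derive m 1 Q0 (dQ0 m).
  move=> hm'.
  have mb : m * th0 < 1 by have /andP[] := insm m th0 hm' er.
  have m0 : 0 < m by case/andP: hm' => h _; exact: lt_le_trans h.
  have dPhi : is_derive m 1 Phi (fm (m, th0) - fm (m, eps) - sg * K m) :=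
    derive_integral_flux c sg hU hV hVx hVy (is_derive_cutoff p q)
    (@cutoff'_continuous R p q) m0 eps0 epst mb.
  have dV1 : is_derive m 1 (fun m => V (st (m, th0))) (Vm (m, th0)) :=
    derive_along_m c sg hV (insm m th0 hm' er).
  have dV2 : is_derive m 1 (fun m => V (st (m, eps))) (Vm (m, eps)) :=
    derive_along_m c sg hV (insm m eps hm' el).
  by rewrite /Q0 /dQ0; solve_derive; rewrite /= !mulr0 !addr0.
have dn0 (m t : R) : m1 <= m <= m2 -> eps <= t <= th0 -> 0 <= dn (m, t).
  move=> h1 h2; rewrite /dn /density mulr_ge0 ?cutoff_ge0 //.
  have tr := tin t h2; have /andP[t0 _] := tr.
  apply: le_trans (jacobian_ge (p := (m, t)) h1 tr).
  rewrite mulr_ge0 ?divr_ge0 ?sqr_ge0 ?(ltW t0) //.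
  by apply: w0; apply: angular_disk; apply: insm.
have fmX (m t : R) : m1 <= m <= m2 -> eps <= t <= th0 -> `|fm (m, t)| <= M * X * Vm (m, t).
  move=> h1 h2; have D := angular_disk c sg (insm m t h1 h2).
  have v0 : 0 <= Vm (m, t) by apply: le_trans (ltW c0p) _; exact: (hVm (p := (m, t)) h1 (tin t h2)).
  rewrite /fm /flux_m (normrM (U _ * _)) (normrM (U _)) (@ger0_norm _ (Vm _)) //.
  rewrite ler_wpM2r //.
  rewrite (@ger0_norm _ (cutoff _ _ _)) ?cutoff_ge0 //.
  by apply: ler_pM; [exact: normr_ge0|exact: cutoff_ge0|exact: bU|apply: chiX; exact: bV].
have K0 (m : R) : m1 <= m <= m2 -> 0 <= K m <= dQ0 m.
  move=> hm'; apply/andP; split.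
    by apply: Rintegral_ge0 => t; rewrite /= in_itv /=; exact: dn0.
  rewrite /dQ0.
  have e : - sg * (fm (m, th0) - fm (m, eps) - sg * K m) =
    sg * sg * K m - (sg * fm (m, th0) - sg * fm (m, eps)) by ring.
  rewrite e sg2 mul1r.
  have a1 := fmX m th0 hm' er; have a2 := fmX m eps hm' el.
  have b1 := ler_norm (sg * fm (m, th0)); have b2 := ler_norm (- (sg * fm (m, eps))).
  rewrite normrM sgn mul1r in b1; rewrite normrN normrM sgn mul1r in b2.
  lra.
have mono (x y : R) : m1 <= x -> x <= y -> y <= m2 -> Q0 x <= Q0 y.
  move=> h1 h2 h3.
  rewrite -subr_ge0 -[leLHS](mul0r (y - x)); apply: (@is_derive_ge _ Q0 dQ0) => // z /andP[xz zy].
  have hz : m1 <= z <= m2 by rewrite (le_trans h1 xz) (le_trans zy h3).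
  by have /andP[Kz0 Kz1] := K0 z hz; split; [exact: dQ|exact: le_trans Kz1].
have Phi0 (m : R) : m = m1 \/ m = m2 -> Phi m = 0.
  move=> hm'; rewrite /Phi /Rintegral integral0_eq // => t; rewrite /= in_itv /= => ht.
  case/andP: ht => t1 t2.
  by rewrite /ft /flux_t zero ?mulr0 ?mul0r // t2 andbT (lt_le_trans eps0).
exists (fun m => k^-1 * Q0 m), (fun m => k^-1 * dQ0 m); split.
  rewrite -mulrBr ler_wpM2l ?invr_ge0 ?(ltW k0) //.
  have n1 := mono m1 m1' (lexx _) m11' m12'.
  have n2 := mono m2' m2 m12'' m22' (lexx _).
  (* Monotonicity enlarges the interval to [m1, m2], at whose ends the cutoff makes [Phi] vanish;
     only values of V remain, which are bounded independently of eps. *)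
  apply: (@le_trans _ _ (Q0 m2 - Q0 m1)); first exact: lerB.
  rewrite /Q0 Phi0; last by right.
  rewrite Phi0; last by left.
  have bnd (m t : R) : m1 <= m <= m2 -> eps <= t <= th0 -> - M <= V (st (m, t)) <= M.
    by move=> h1 h2; rewrite -ler_norml; apply: bV; apply: angular_disk; exact: insm.
  have b1 := bnd m1 th0 in1 er; have b2 := bnd m1 eps in1 el.
  have b3 := bnd m2 th0 in2 er; have b4 := bnd m2 eps in2 el.
  rewrite !mulr0 !add0r -mulrBr.
  have -> : 4 * M ^+ 2 * X = M * X * (4 * M) by ring.
  by rewrite ler_wpM2l ?(mulr_ge0 M0 X0) //; exact: four.
move=> m hm'; have hm2 : m1 <= m <= m2.
  by case/andP: hm' => h h'; rewrite (le_trans m11' h) (le_trans h' m22').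
have dm := dQ m hm2.
split; first by solve_derive; rewrite mulr0 addr0.
rewrite ler_pdivlMl //; have /andP[_] := K0 m hm2; apply: le_trans.
have cwt (t : R) : eps <= t <= th0 -> {for t, continuous (fun t => w (st (m, t)) / t)}.
  move=> ht; have ip := insm m t hm2 ht; have /andP[t0 _] := tin t ht.
  have [_ c1] := continuous_slices (continuous_angular (c := c) (sg := sg) ip (cw (angular_disk c sg ip))).
  apply: continuous_mul; first exact: c1.
  by apply: cvgV; [rewrite gt_eqF|exact: cvg_id].
have iw : mu.-integrable `[eps, th0] (EFin \o (fun t => w (st (m, t)) / t)).
  exact: continuous_segment_integrable.
have mab : measurable (`[eps, th0] : set R) by [].
rewrite -RintegralZl //; apply: le_Rintegral => //.
- apply: continuous_segment_integrable => t ht.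
  by apply: continuous_mul; [exact: cvg_cst|exact: cwt].
- apply: continuous_segment_integrable => t ht.
  have [_ _ c1 _ _] := continuous_fluxes c sg hU hV hVx hVy (is_derive_cutoff p q)
    (@cutoff'_continuous R p q) (insm m t hm2 ht).
  by have [] := continuous_slices c1.
move=> t; rewrite /= in_itv /= => ht.
have tr := tin t ht; have /andP[t0 _] := tr.
have J := jacobian_ge (p := (m, t)) hm2 tr.
rewrite /dn /density /k -mulrA.
have wt : 0 <= w (st (m, t)) / t.
  by rewrite divr_ge0 ?w0 ?(ltW t0) //; apply: angular_disk; exact: insm.
apply: ler_pM => //.
- by rewrite exprn_ge0 // ltW.
- by rewrite mulr_ge0 // divr_ge0 ?sqr_ge0.
by apply: lo => //; rewrite t0; case/andP: ht.
Qed.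

End strip_estimate.

Section scaling.
Context {R : realType}.

Lemma C1_2_scale (u ux uy : R * R -> R) (k : R) : C1_2 u ux uy ->
  C1_2 (fun p => k * u p) (fun p => k * ux p) (fun p => k * uy p).
Proof.
move=> hu p /hu[d1 d2 c1 c2]; split.
- by apply: (is_derive_eq (is_derive_mul (is_derive_cst k _ _) d1)); rewrite mulr0 addr0.
- by apply: (is_derive_eq (is_derive_mul (is_derive_cst k _ _) d2)); rewrite mulr0 addr0.
- by apply: continuous_mul => //; exact: cvg_cst.
- by apply: continuous_mul => //; exact: cvg_cst.
Qed.

End scaling.

(** * Bounded weights on some curve at a jump *)

Section jump_side.
Context {R : realType}.
Local Notation mu := (@lebesgue_measure R).
Variables (U Ux Uy V Vx Vy Vxx Vxy Vyx Vyy w : R * R -> R) (c M : R).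
Hypothesis hU : C1_2 U Ux Uy.
Hypothesis hV : C1_2 V Vx Vy.
Hypothesis hVx : C1_2 Vx Vxx Vxy.
Hypothesis hVy : C1_2 Vy Vyx Vyy.
Hypothesis bU : forall p, disk2 p -> `|U p| <= M.
Hypothesis bV : forall p, disk2 p -> `|V p| <= M.
Hypothesis cw : forall p : R * R, disk2 p -> {for p, continuous w}.
Hypothesis w0 : forall p, disk2 p -> 0 <= w p.
Hypothesis wJ : forall p, disk2 p ->
  w p * (Vx p ^+ 2 + Vy p ^+ 2) <= 4 * jacobian Ux Uy Vx Vy p.
Variables (g : R -> R) (gp gm : R).
Hypothesis g_periodic : forall t, g (t + 2 * pi) = g t.
Hypothesis gi0 : mu.-integrable `[0, 2 * pi] (EFin \o g).
Hypothesis V_poisson : forall x s, 0 < x < 1 ->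
  V (radial (1 - x) s) = poisson_integral g (polarC x s).
Hypothesis sm : small_average (step_rest g c gp gm) c.
Hypothesis gpm : gp != gm.

Definition weight (sg m a b : R) : R :=
  \int[mu]_(t in `[a, b]) (w (angular c sg (m, t)) / t).

(** Multiplying U and V by k = - sg (gp - gm) makes V increase with m and multiplies both sides of
    the inequality for w by k^2. The cutoff lives between the curves 1 / 20 and 1 / 5. *)
Lemma side_estimate (sg : R) : sg = 1 \/ sg = -1 ->
  exists C th0 : R, 0 < th0 <= 1 / 2 /\
  forall eps : R, 0 < eps < th0 -> exists Q dQ : R -> R, Q (3 / 20) - Q (1 / 10) <= C /\
    forall m : R, 1 / 10 <= m <= 3 / 20 -> is_derive m 1 Q (dQ m) /\ weight sg m eps th0 <= dQ m.
Proof.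
move=> sg1; pose k := - (sg * (gp - gm)).
have sg2 : sg * sg = 1 by case: sg1 => ->; ring.
have [|||c0 [th1 [c00 th1r hV0]]] := @sector_derive_bound R V Vx Vy g c sg gp gm hV sg1
  g_periodic gi0 V_poisson sm (1 / 20) (1 / 5) _ _ _ gpm; [lra|lra|lra|].
have tE (t : R) : sg * (c + sg * t - c) = t by rewrite addrAC subrr add0r mulrA sg2 mul1r.
have sE (m t : R) : angular c sg (m, t) = sector c sg m (c + sg * t).
  by rewrite /sector tE.
have D00 : disk2 (0 : R * R) by rewrite /disk2 /= !expr0n /= addr0.
have H1 p : disk2 p -> `|k * U p| <= `|k| * M by move=> /bU h; rewrite normrM ler_wpM2l.
have H2 p : disk2 p -> `|k * V p| <= `|k| * M by move=> /bV h; rewrite normrM ler_wpM2l.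
have H3 p : disk2 p -> w p * ((k * Vx p) ^+ 2 + (k * Vy p) ^+ 2) <=
    4 * jacobian (fun p => k * Ux p) (fun p => k * Uy p) (fun p => k * Vx p) (fun p => k * Vy p) p.
  move=> /wJ h; rewrite /jacobian !exprMn.
  have -> : w p * (k ^+ 2 * Vx p ^+ 2 + k ^+ 2 * Vy p ^+ 2) = k ^+ 2 * (w p * (Vx p ^+ 2 + Vy p ^+ 2)) by ring.
  have -> : 4 * (k * Ux p * (k * Vy p) - k * Uy p * (k * Vx p)) = k ^+ 2 * (4 * jacobian Ux Uy Vx Vy p).
    by rewrite /jacobian; ring.
  by rewrite ler_wpM2l ?sqr_ge0.
have H4 (p : R * R) : 1 / 20 <= p.1 <= 1 / 5 -> 0 < p.2 < th1 ->
    c0 <= along_m c sg (fun p => k * Vx p) (fun p => k * Vy p) p.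
  case: p => m t /= h1 h2.
  have := hV0 m (c + sg * t) h1; rewrite tE => /(_ h2) /le_trans; apply.
  rewrite /sector_m tE -sE /along_m /= le_eqVlt; apply/orP; left; apply/eqP.
  by rewrite /k; ring.
have H5 (m : R) : 1 / 20 <= m <= 1 / 5 -> exists eta : R, forall e : R, 0 < e ->
    exists2 d : R, 0 < d & forall t : R, 0 < t < d -> `|k * V (angular c sg (m, t)) - eta| < e.
  move=> h1; have [eta L] := @sector_limit R V g c sg gp gm sg1 g_periodic gi0 V_poisson sm m ltac:(lra).
  exists (k * eta) => e e0.
  have k1 : 0 < `|k| + 1 by rewrite ltr_wpDl.
  have [d d0 hd] := L (e / (`|k| + 1)) (divr_gt0 e0 k1).
  exists d => // t ht; have := hd (c + sg * t); rewrite tE => /(_ ht); rewrite -sE => h.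
  rewrite -mulrBr normrM.
  apply: (@le_lt_trans _ _ (`|k| * (e / (`|k| + 1)))); first by rewrite ler_wpM2l // ltW.
  by rewrite mulrA ltr_pdivrMr // mulrC ltr_pM2l // ltrDl.
have [C [th0 [th0r H]]] := @strip_estimate R (fun p => k * U p) (fun p => k * Ux p) (fun p => k * Uy p)
  (fun p => k * V p) (fun p => k * Vx p) (fun p => k * Vy p) (fun p => k * Vxx p) (fun p => k * Vxy p)
  (fun p => k * Vyx p) (fun p => k * Vyy p) w c sg (`|k| * M)
  (C1_2_scale k hU) (C1_2_scale k hV) (C1_2_scale k hVx) (C1_2_scale k hVy) sg1 H1 H2 cw w0 H3
  (1 / 20) (1 / 10) (3 / 20) (1 / 5) th1 c0 ltac:(split; lra) c00 th1r H4 H5.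
by exists C, th0; split; [lra|].
Qed.

Lemma inside_small (m t : R) : 0 < m <= 1 / 5 -> 0 < t <= 4 -> inside (m, t).
Proof.
move=> h1 h2; rewrite /inside /= mulr_gt0 /=; [|lra|lra].
have : m * t <= 1 / 5 * 4 by apply: ler_pM; lra.
lra.
Qed.

Lemma angular_weight_continuous (sg m t : R) : 0 < m <= 1 / 5 -> 0 < t <= 4 ->
  {for (m, t), continuous (fun p : R * R => w (angular c sg p) / p.2)}.
Proof.
move=> hm ht; have ip := inside_small hm ht.
apply: continuous_mul.
  exact: (continuous_angular (c := c) (sg := sg) ip (cw (angular_disk c sg ip))).
have t0 : t != 0 by rewrite gt_eqF //; lra.
by apply: (@continuous_post _ _ (m, t) (fun p => p.2) (fun y => y^-1)); [exact: continuous_snd2|exact: inv_continuous].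
Qed.

Lemma weight_integrand_continuous (sg m a b : R) : 0 < m <= 1 / 5 -> 0 < a -> b <= 4 ->
  forall t, a <= t <= b -> {for t, continuous (fun t => w (angular c sg (m, t)) / t)}.
Proof.
move=> hm a0 b4 t ht; have [|_] := continuous_slices (@angular_weight_continuous sg m t hm _); first lra.
exact.
Qed.

Lemma weight_ge0 sg m a b : 0 < m <= 1 / 5 -> 0 < a -> b <= 4 -> 0 <= weight sg m a b.
Proof.
move=> hm a0 b4; apply: Rintegral_ge0 => t; rewrite /= in_itv /= => ht.
rewrite divr_ge0 ?w0 //; last lra.
by apply: angular_disk; apply: inside_small => //; lra.
Qed.

Lemma weight_split sg m a b d : 0 < m <= 1 / 5 -> 0 < a -> a <= b -> b <= d -> d <= 4 ->
  weight sg m a d = weight sg m a b + weight sg m b d.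
Proof.
move=> hm a0 ab bd d4; rewrite /weight.
have b0 : 0 < b by lra.
have b4 : b <= 4 by lra.
by have [] := integrable_itvU ab bd
  (continuous_segment_integrable (@weight_integrand_continuous sg m a b hm a0 b4))
  (continuous_segment_integrable (@weight_integrand_continuous sg m b d hm b0 d4)).
Qed.

Lemma weight_mono sg m a b d : 0 < m <= 1 / 5 -> 0 < a -> a <= b -> b <= d -> d <= 4 ->
  weight sg m b d <= weight sg m a d.
Proof.
move=> hm a0 ab bd d4; rewrite (@weight_split sg m a b d) // lerDr weight_ge0 //.
exact: le_trans d4.
Qed.

Lemma weight_continuous sg m a b : 1 / 10 <= m <= 3 / 20 -> 0 < a -> b <= 4 ->
  {for m, continuous (fun m => weight sg m a b)}.
Proof.
move=> hm a0 b4.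
apply: (@continuous_parametric R (fun p => w (angular c sg p) / p.2) (1 / 20) (1 / 5)); first lra.
by move=> [x t] /= h1 h2; apply: angular_weight_continuous; lra.
Qed.

(* If the weights were unbounded for every m, then by compactness of the range of m
   they would all be large for a single eps, against side_estimate. *)
Lemma weight_bounded : exists m B : R, 1 / 10 <= m <= 3 / 20 /\
  forall eps : R, 0 < eps <= pi -> weight 1 m eps pi + weight (-1) m eps pi <= B.
Proof.
have pi0 := pi_gt0 R; have pi2 := @pi_ge2 R.
have pi4 : pi <= 4 :> R by have := pihalf_02 R; lra.
have [C1 [b1 [b1r H1]]] := side_estimate (or_introl erefl).
have [C2 [b2 [b2r H2]]] := side_estimate (or_intror erefl).
pose W (e m : R) : R := weight 1 m e b1 + weight (-1) m e b2.
(* The interval of m has length 1 / 20, so a derivative of at least B0 gives an increase above C1 +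
   C2. *)
pose B0 := 20 * (`|C1| + `|C2| + 1).
have bmin e : 0 < e < Num.min b1 b2 -> 0 < e < b1 /\ 0 < e < b2.
  by rewrite lt_min => /and3P[-> -> ->].
have Wc (e m : R) : 1 / 10 <= m <= 3 / 20 -> 0 < e -> {for m, continuous (W e)}.
  by move=> hm e0; apply: continuous_add; apply: weight_continuous => //; lra.
have Wmono (e e' m : R) : 1 / 10 <= m <= 3 / 20 -> 0 < e -> e <= e' -> e' < Num.min b1 b2 ->
    W e' m <= W e m.
  move=> hm e0 ee h; have [e1 e2] := bmin e' ltac:(lra).
  have m5 : 0 < m <= 1 / 5 by lra.
  by apply: lerD; apply: weight_mono => //; lra.
have [m [hm hB]] : exists m : R, 1 / 10 <= m <= 3 / 20 /\
    forall e : R, 0 < e < Num.min b1 b2 -> W e m <= B0.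
  apply: contrapT => N.
  have {}N (m : R) : 1 / 10 <= m <= 3 / 20 -> exists2 e, 0 < e < Num.min b1 b2 & B0 < W e m.
    move=> hm; apply: contrapT => N'; apply: N; exists m; split => // e he.
    by rewrite leNgt; apply/negP => h; apply: N'; exists e.
  (* [W e] grows as e decreases, so a value e0 that works at x works for all smaller e and, by
     continuity of [W e0], for all m near x. *)
  pose P (e m : R) := 1 / 10 <= m <= 3 / 20 -> 0 < e -> B0 < W e m.
  have cov (x : R) : `[1 / 10, 3 / 20]%classic x -> \forall x' \near x & e \near (0 : R)^'+, P e x'.
    rewrite /= in_itv /= => hx; have [e0 he0 hW] := N x hx.
    exists ([set x' | B0 < W e0 x'], [set e | e < e0]).
      split; last by apply: nbhs_right_lt; lra.
      have e00 : 0 < e0 by lra.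
      by have h := @cvgr_gt R _ (nbhs x) _ (W e0) (W e0 x) (Wc e0 x hx e00) _ hW; exact: h.
    move=> [x' e] /= [h1 h2] hx' e1; apply: lt_le_trans h1 _.
    by apply: Wmono => //; [exact: ltW|lra].
  have nc := (compact_near_coveringP _).1 (@segment_compact R (1 / 10) (3 / 20)) R ((0 : R)^'+)
    P _ cov.
  have small : \forall e \near (0 : R)^'+, e < Num.min b1 b2.
    by apply: nbhs_right_lt; rewrite lt_min; lra.
  have pos : \forall e \near (0 : R)^'+, 0 < e by exact: nbhs_right_gt.
  have [|e [[e1 e2] e3]] := filter_ex (filterI (filterI (nc _) small) pos); first exact: (at_right_proper_filter (0 : R)).
  have [r1 r2] := bmin e ltac:(lra).
  have [Q1 [dQ1 [q1 h1]]] := H1 e r1; have [Q2 [dQ2 [q2 h2]]] := H2 e r2.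
  have := @is_derive_ge R (fun m => Q1 m + Q2 m) (fun m => dQ1 m + dQ2 m) (1 / 10) (3 / 20) B0 ltac:(lra).
  have H (x : R) : 1 / 10 <= x <= 3 / 20 ->
      is_derive x 1 (fun m => Q1 m + Q2 m) (dQ1 x + dQ2 x) /\ B0 <= dQ1 x + dQ2 x.
    move=> hx; have [d1 k1] := h1 x hx; have [d2 k2] := h2 x hx.
    split; first exact: is_derive_add.
    have k : B0 < W e x by apply: e1 => //=; rewrite in_itv.
    by apply: le_trans (ltW k) _; exact: lerD.
  move=> /(_ H); rewrite /B0; have := ler_norm C1; have := ler_norm C2; lra.
have m5 : 0 < m <= 1 / 5 by lra.
have [b1p b2p] : b1 <= pi /\ b2 <= pi by split; lra.
(* The pieces from b1 and b2 up to pi do not depend on e. *)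
have W0 (e : R) : 0 < e < Num.min b1 b2 -> weight 1 m e pi + weight (-1) m e pi <=
    B0 + (weight 1 m b1 pi + weight (-1) m b2 pi).
  move=> he; have [/andP[e0 /ltW e1] /andP[_ /ltW e2]] := bmin e he.
  rewrite (@weight_split 1 m e b1 pi) // (@weight_split (-1) m e b2 pi) // addrACA.
  by rewrite lerD2r; exact: hB.
exists m, (B0 + (weight 1 m b1 pi + weight (-1) m b2 pi)); split => // eps heps.
pose e := Num.min (eps / 2) (Num.min b1 b2 / 2).
have bm : 0 < Num.min b1 b2 by rewrite lt_min; lra.
have he : 0 < e < Num.min b1 b2.
  have h : e <= Num.min b1 b2 / 2 by rewrite ge_min lexx orbT.
  have : 0 < e by rewrite lt_min; lra.
  lra.
have ee : e <= eps by have : e <= eps / 2 by [rewrite ge_min lexx]; lra.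
apply: le_trans (W0 e he).
have /andP[e0 _] := he; have /andP[_ ep] := heps.
by apply: lerD; apply: weight_mono.
Qed.

End jump_side.

(** * From bounded weights to a finite line integral *)

Section side_integral.
Context {R : realType}.
Local Notation mu := (@lebesgue_measure R).

Definition side (c sg a b : R) : set R := [set t | a <= sg * (t - c) <= b].

Lemma sideE (c sg a b : R) : sg = 1 \/ sg = -1 ->
  side c sg a b = if sg == 1 then `[a + c, b + c]%classic else `[- b + c, - a + c]%classic.
Proof.
have n1 : (-1 : R) == 1 = false by apply/eqP; lra.
by case=> ->; rewrite ?eqxx ?n1; apply/seteqP; split => t; rewrite /side /= in_itv /=; lra.
Qed.

Lemma side_measurable (c sg a b : R) : sg = 1 \/ sg = -1 -> measurable (side c sg a b).
Proof. by move=> h; rewrite sideE //; case: ifP. Qed.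

Lemma side_integral (F : R -> R) (c sg a b : R) : sg = 1 \/ sg = -1 -> a <= b ->
  (forall x, a <= x <= b -> {for x, continuous F}) ->
  mu.-integrable (side c sg a b) (EFin \o (fun t => F (sg * (t - c)))) /\
  \int[mu]_(t in side c sg a b) F (sg * (t - c)) = \int[mu]_(x in `[a, b]) F x.
Proof.
move=> sg1 ab cF; rewrite sideE //.
have iF := continuous_segment_integrable cF.
have n1 : (-1 : R) == 1 = false by apply/eqP; lra.
case: sg1 => ->; rewrite ?eqxx ?n1.
  have [i1 e1] := @integral_shift R F c a b iF.
  by under [fun t : R => F _]eq_fun do rewrite mul1r.
have cG x : - b <= x <= - a -> {for x, continuous (fun x => F (- x))}.
  move=> hx; apply: (@continuous_post _ _ x (fun x => - x) F).
    by apply: continuous_opp; exact: cvg_id.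
  by apply: cF; lra.
have [i1 e1] := @integral_shift R (fun x => F (- x)) c (- b) (- a) (continuous_segment_integrable cG).
under [fun t : R => F _]eq_fun do rewrite mulN1r.
split => //; rewrite e1 /Rintegral; congr fine.
rewrite integration_by_substitution_oppr //.
  by apply: eq_integral => x _ /=; rewrite opprK.
apply: continuous_in_subspaceT => x; rewrite inE /= in_itv /= => hx; exact: cG.
Qed.

End side_integral.

Section line_integral_finite.
Context {R : realType}.
Local Notation mu := (@lebesgue_measure R).
Local Notation C := (R[i]^o).
Variables (a : C -> C) (c m B : R).
Let w (p : R * R) : R := 1 - Normc.normc (a (toC p)) ^+ 2.
Hypothesis cw : forall p : R * R, disk2 p -> {for p, continuous w}.
Hypothesis w0 : forall p, disk2 p -> 0 <= w p.
Hypothesis hm : 0 < m <= 1 / 5.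
Hypothesis weight_le : forall eps : R, 0 < eps <= pi ->
  weight w c 1 m eps pi + weight w c (-1) m eps pi <= B.

Let pi4 : (pi : R) < 4. Proof. by have := pihalf_02 R; lra. Qed.

Let ins (t : R) : 0 < t <= pi -> inside (m, t).
Proof.
move=> ht; have p4 := pi4; have hm' := hm; rewrite /inside /= mulr_gt0 /=; [|lra|lra].
have : m * t <= 1 / 5 * 4 by apply: ler_pM; lra.
lra.
Qed.

Let integrand (t : R) : R :=
  (1 - Normc.normc (a (Gamma c m t)) ^+ 2) / (1 - Normc.normc (Gamma c m t) ^+ 2) *
  speed (Gamma c m) t.

Let G (sg t : R) : R := w (angular c sg (m, t)) / (1 - (1 - m * t) ^+ 2) *
  Num.sqrt (m ^+ 2 + (1 - m * t) ^+ 2).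

Let gammaE (sg t : R) : sg = 1 \/ sg = -1 -> 0 <= sg * (t - c) ->
  Gamma c m t = toC (angular c sg (m, sg * (t - c))).
Proof.
move=> sg1 h; have sg2 : sg * sg = 1 by case: sg1 => ->; ring.
have sgn : `|sg| = 1 by case: sg1 => ->; rewrite ?normrN normr1.
have tE : c + sg * (sg * (t - c)) = t by rewrite mulrA sg2 mul1r addrC subrK.
have nE : `|t - c| = sg * (t - c) by rewrite -[LHS]mul1r -sgn -normrM ger0_norm.
rewrite /Gamma /toC /angular /= tE nE /expi.
by apply/eqP; rewrite eq_complex /= !mul0r subr0 addr0 !eqxx.
Qed.

(** The radius changes at rate m and the angle at rate 1. The absolute value in [Gamma] is
    differentiated strictly on one side of c, where it is linear. *)
Let speedE (sg t : R) : sg = 1 \/ sg = -1 -> 0 < sg * (t - c) ->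
  speed (Gamma c m) t = Num.sqrt (m ^+ 2 + (1 - m * (sg * (t - c))) ^+ 2).
Proof.
move=> sg1 h; have sg2 : sg * sg = 1 by case: sg1 => ->; ring.
have pos : \forall s \near t, 0 < sg * (s - c).
  have cs : {for t, continuous (fun s : R => sg * (s - c))} by solve_continuous.
  by have hh := @cvgr_gt R _ (nbhs t) _ _ _ cs _ h; exact: hh.
have nRe : \forall s \near t, (1 - m * (sg * (s - c))) * cos s = complex.Re (Gamma c m s).
  by apply: filterS pos => s hs; rewrite /Gamma -(_ : sg * (s - c) = `|s - c|) /= ?mul0r ?subr0 //;
     case: sg1 hs => -> hs; [rewrite mul1r gtr0_norm|rewrite mulN1r ltr0_norm]; lra.
have nIm : \forall s \near t, (1 - m * (sg * (s - c))) * sin s = complex.Im (Gamma c m s).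
  by apply: filterS pos => s hs; rewrite /Gamma -(_ : sg * (s - c) = `|s - c|) /= ?mul0r ?addr0 //;
     case: sg1 hs => -> hs; [rewrite mul1r gtr0_norm|rewrite mulN1r ltr0_norm]; lra.
set r := 1 - m * (sg * (t - c)).
have d1 : is_derive t 1 (fun s => (1 - m * (sg * (s - c))) * cos s) (- r * sin t - m * sg * cos t).
  by solve_derive; rewrite /= /r; ring.
have d2 : is_derive t 1 (fun s => (1 - m * (sg * (s - c))) * sin s) (r * cos t - m * sg * sin t).
  by solve_derive; rewrite /= /r; ring.
have [_ e1] := near_eq_is_derive nRe d1; have [_ e2] := near_eq_is_derive nIm d2.
rewrite /speed !derive1E e1 e2; congr Num.sqrt.
transitivity ((m ^+ 2 * (sg * sg) + r ^+ 2) * (cos t ^+ 2 + sin t ^+ 2)); first by ring.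
by rewrite cos2Dsin2 sg2 !mulr1.
Qed.

Let integrandE (sg t : R) : sg = 1 \/ sg = -1 -> 0 < sg * (t - c) ->
  integrand t = G sg (sg * (t - c)).
Proof.
move=> sg1 h; rewrite /integrand (gammaE sg1 (ltW h)) (speedE sg1 h) /G /w; congr (_ / _ * _).
rewrite /toC /= sqr_sqrtr ?addr_ge0 ?sqr_ge0 // !exprMn -mulrDr cos2Dsin2 mulr1 //.
Qed.

Let G_continuous (sg t : R) : 0 < t <= pi -> {for t, continuous (G sg)}.
Proof.
move=> ht; have ip := ins ht; have /= ip' := ip; rewrite /inside /= in ip'.
have [_ c1] := continuous_slices (continuous_angular (c := c) (sg := sg) ip (cw (angular_disk c sg ip))).
have c2 : {for t, continuous (fun t : R => 1 - (1 - m * t) ^+ 2)} by solve_continuous.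
have c3 : {for t, continuous (fun t : R => (1 - (1 - m * t) ^+ 2)^-1)}.
  apply: (@continuous_post _ _ t (fun t : R => 1 - (1 - m * t) ^+ 2) (fun y => y^-1)) => //.
  apply: inv_continuous.
  have -> : 1 - (1 - m * t) ^+ 2 = (m * t) * (2 - m * t) by ring.
  by rewrite gt_eqF // mulr_gt0 //; lra.
have c4 : {for t, continuous (fun t : R => Num.sqrt (m ^+ 2 + (1 - m * t) ^+ 2))}.
  apply: (@continuous_post _ _ t (fun t : R => m ^+ 2 + (1 - m * t) ^+ 2) Num.sqrt).
    by solve_continuous.
  exact: sqrt_continuous.
by apply: continuous_mul => //; apply: continuous_mul => //; exact: c1.
Qed.

(** The denominator is m t (2 - m t) >= m t and the speed is at most 2, so the line integrand is
    dominated by a multiple of w / t. *)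
Let G_bounds (sg t : R) : 0 < t <= pi -> 0 <= G sg t <= 2 / m * (w (angular c sg (m, t)) / t).
Proof.
move=> ht; have ip := ins ht; have /= ip' := ip; rewrite /inside /= in ip'.
have D := w0 (angular_disk c sg ip); have m0 : 0 < m by have := hm; lra.
have t0 : 0 < t by lra.
have dE : 1 - (1 - m * t) ^+ 2 = (m * t) * (2 - m * t) by ring.
have d0 : 0 < 1 - (1 - m * t) ^+ 2 by rewrite dE mulr_gt0 //; lra.
have d1 : m * t <= 1 - (1 - m * t) ^+ 2 by rewrite dE ler_peMr; lra.
have s2 : Num.sqrt (m ^+ 2 + (1 - m * t) ^+ 2) <= 2.
  rewrite -[leRHS](@ger0_norm R 2) // -sqrtr_sqr ler_wsqrtr //.
  have h1 : m ^+ 2 <= 1 by apply: exprn_ile1; have := hm; lra.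
  have h2 : (1 - m * t) ^+ 2 <= 1 by apply: exprn_ile1; lra.
  lra.
have -> : 2 / m * (w (angular c sg (m, t)) / t) = w (angular c sg (m, t)) / (m * t) * 2.
  by field; rewrite !gt_eqF.
apply/andP; split; first by rewrite mulr_ge0 ?divr_ge0 ?sqrtr_ge0 // ltW.
apply: ler_pM => //; [by rewrite divr_ge0 // ltW|].
by rewrite ler_wpM2l // lef_pV2 ?posrE // mulr_gt0.
Qed.

Let truncated (eps : R) := side c 1 eps pi `|` side c (-1) eps pi.

Let side_integrandE (eps : R) : 0 < eps <= pi -> forall sg t : R, sg = 1 \/ sg = -1 ->
  side c sg eps pi t -> integrand t = G sg (sg * (t - c)).
Proof. by rewrite /side /= => heps sg t sg1 h; apply: integrandE => //; lra. Qed.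

Let integrand_ge0 (eps t : R) : 0 < eps <= pi -> truncated eps t -> 0 <= integrand t.
Proof.
move=> heps ht.
have [sg [sg1 hs]] : exists sg : R, (sg = 1 \/ sg = -1) /\ side c sg eps pi t.
  by case: ht => h; [exists 1; split => //; left|exists (-1); split => //; right].
rewrite (side_integrandE heps sg1 hs); rewrite /side /= in hs.
by have /andP[] := @G_bounds sg (sg * (t - c)) ltac:(lra).
Qed.

Let truncated_integral (eps : R) : 0 < eps <= pi ->
  measurable_fun (truncated eps) (EFin \o integrand) /\
  (\int[mu]_(t in truncated eps) (integrand t)%:E <= (2 / m * B)%:E)%E.
Proof.
move=> heps; have m0 : 0 < m by have := hm; lra.
have cG sg t : eps <= t <= pi -> {for t, continuous (G sg)} by move=> ht; apply: G_continuous; lra.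
have GE := @side_integrandE _ heps.
have I sg : sg = 1 \/ sg = -1 -> mu.-integrable (side c sg eps pi) (EFin \o integrand) /\
    \int[mu]_(t in side c sg eps pi) integrand t <= 2 / m * weight w c sg m eps pi.
  move=> sg1; have ep : eps <= pi by lra.
  have [i1 e1] := @side_integral R (G sg) c sg eps pi sg1 ep (cG sg); split.
    apply: eq_integrable i1; first exact: side_measurable.
    by move=> t; rewrite inE => ht /=; rewrite -GE.
  rewrite (_ : \int[mu]_(t in _) _ = \int[mu]_(t in side c sg eps pi) G sg (sg * (t - c))).
    have cwt t : eps <= t <= pi -> {for t, continuous (fun t => w (angular c sg (m, t)) / t)}.
      by apply: (@weight_integrand_continuous R w c cw sg m) => //; [lra|exact: ltW].
    have iw := continuous_segment_integrable cwt.
    rewrite e1 /weight -RintegralZl //.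
    apply: le_Rintegral => //.
    - exact: continuous_segment_integrable (cG sg).
    - apply: continuous_segment_integrable => t ht; apply: continuous_mul; [exact: cvg_cst|exact: cwt].
    by move=> t; rewrite /= in_itv /= => ht; have /andP[] := @G_bounds sg t ltac:(lra).
  by apply: eq_Rintegral => t; rewrite inE => ht; exact: GE.
have [i1 b1] := I 1 (or_introl erefl); have [i2 b2] := I (-1) (or_intror erefl).
have s1 := @side_measurable R c 1 eps pi (or_introl erefl).
have s2 := @side_measurable R c (-1) eps pi (or_intror erefl).
have mf : measurable_fun (truncated eps) (EFin \o integrand).
  by apply/measurable_funU => //; split; [exact: measurable_int i1|exact: measurable_int i2].
split => //; rewrite ge0_integral_setU //.
- have W := weight_le heps.
  move: b1 b2; rewrite /Rintegral => b1 b2.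
  rewrite -(@fineK _ (\int[mu]_(t in side c 1 eps pi) _)%E); last exact: integrable_fin_num i1.
  rewrite -(@fineK _ (\int[mu]_(t in side c (-1) eps pi) _)%E); last exact: integrable_fin_num i2.
  rewrite -EFinD lee_fin; apply: le_trans (lerD b1 b2) _.
  by rewrite -mulrDr ler_wpM2l // divr_ge0 // ltW.
- by move=> t ht; rewrite lee_fin; exact: integrand_ge0 ht.
- rewrite disj_set2E; apply/eqP/seteqP; split => t //= -[]; rewrite /side /=; lra.
Qed.

(** Monotone convergence over the truncations at distance 1 / (n + 1) from c, whose integrals share
    the bound 2 B / m. *)
Lemma calL_finite : (calL a c m < +oo)%E.
Proof.
have p4 := pi4; have pi2 := @pi_ge2 R; have m0 : 0 < m by have := hm; lra.
pose eps (n : nat) : R := n.+1%:R^-1.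
have eps0 n : 0 < eps n <= pi.
  rewrite invr_gt0 ltr0n /=; apply: (@le_trans _ _ 1); last lra.
  by rewrite invf_le1 ?ler1n ?ltr0n.
have U : Gamma_range c m = \bigcup_n truncated (eps n).
  (* The range of the parameter ends at pi, since 1 / m >= 5 > pi. *)
  have mp : Num.min pi m^-1 = pi.
    apply/min_idPl; apply: (@le_trans _ _ 5); first lra.
    rewrite -[5]invrK lef_pV2 ?posrE ?invr_gt0 //; have := hm; lra.
  apply/seteqP; split => t.
    rewrite /Gamma_range /= mp => /andP[t0 t1].
    have /ltr_add_invr [n hn] : 0 < `|t - c| := t0.
    exists n => //; rewrite /truncated /side /=.
    move: t1 hn; rewrite add0r -/(eps n); case: (leP 0 (t - c)) => h.
      by rewrite ger0_norm // => h1 h2; left; rewrite mul1r ltW.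
    by rewrite ltr0_norm // => h1 h2; right; rewrite mulN1r ltW.
  case=> n _; have := eps0 n; rewrite /truncated /side /Gamma_range /= mp => h [] h1.
    by rewrite ger0_norm; lra.
  by rewrite ler0_norm; lra.
rewrite /calL /arclength_integral U.
apply: (@le_lt_trans _ _ (2 / m * B)%:E); last exact: ltry.
have nd : {homo (fun n => truncated (eps n)) : n k / (n <= k)%N >-> (n <= k)%O}.
  move=> n k nk; apply/subsetPset => t.
  have : eps k <= eps n by rewrite lef_pV2 ?posrE ?ltr0n // ler_nat.
  by rewrite /truncated /side /= => h [] h1; [left|right]; lra.
have mD n : measurable (truncated (eps n)).
  by apply: measurableU; apply: side_measurable; [left|right].
have mf n : measurable_fun (truncated (eps n)) (EFin \o integrand).
  by have [] := truncated_integral (eps0 n).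
have f0 n t : truncated (eps n) t -> (0 <= (EFin \o integrand) t)%E.
  by move=> ht; rewrite lee_fin; exact: (integrand_ge0 (eps0 n) ht).
have cv := @ge0_nondecreasing_set_cvg_integral _ (measurableTypeR R) R
  (fun n => truncated (eps n)) (EFin \o integrand) (@lebesgue_measure R) nd mD mf f0.
rewrite -(cvg_lim _ cv) //; apply: lime_le; first by apply/cvg_ex; eexists; exact: cv.
by apply: nearW => n; have [] := truncated_integral (eps0 n).
Qed.

End line_integral_finite.

(** * The Beltrami equation and the conclusion *)

Section complex_analysis.
Context {R : realType}.
Local Notation C := (R[i]^o).
Implicit Types (z : C) (f : C -> C).

Lemma normc_Re_le z : `|complex.Re z| <= Normc.normc z.
Proof.
by case: z => x y /=; rewrite -sqrtr_sqr ler_wsqrtr // lerDl sqr_ge0.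
Qed.

Lemma normc_Im_le z : `|complex.Im z| <= Normc.normc z.
Proof.
by case: z => x y /=; rewrite -sqrtr_sqr ler_wsqrtr // lerDr sqr_ge0.
Qed.

Lemma sqr_normc z : Normc.normc z ^+ 2 = complex.Re z ^+ 2 + complex.Im z ^+ 2.
Proof. by case: z => x y /=; rewrite sqr_sqrtr // addr_ge0 ?sqr_ge0. Qed.

Lemma normc_continuous : continuous (@Normc.normc R : C -> R).
Proof.
move=> z A /nbhs_ballP [e /= e0 hA].
have e0' : (0 : R[i]) < e%:C by rewrite ltcR.
have B : nbhs (z : C) (ball (z : C) e%:C) by exact: nbhsx_ballx.
move: B; apply: filterS => y.
rewrite /ball /= lt_normc => h; apply: hA; rewrite /ball /=.
have h1 := le_normcD (z - y) y; have h2 := le_normcD (y - z) z.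
rewrite !subrK in h1 h2.
have h3 : Normc.normc (y - z) = Normc.normc (z - y) by rewrite -normcN opprB.
by rewrite ltr_norml; lra.
Qed.

Lemma bounded_setE (D : set C) : bounded_set D ->
  exists M : R, forall z, D z -> Normc.normc z <= M.
Proof.
move=> [x [xr hx]]; exists (Normc.normc x + 1) => z Dz.
have x1 : x < (Normc.normc x + 1)%:C.
  apply: (le_lt_trans (real_ler_norm xr)).
  by rewrite (lt_normc x) ltrDl.
by have := hx _ x1 z Dz; rewrite /= le_normc.
Qed.

Lemma convex_set_segment (D : set C) (z w : C) (t : R) : convex_set D -> D z -> D w ->
  0 <= t <= 1 -> D (t%:C *: w + (1 - t%:C) *: z).
Proof.
move=> cD Dz Dw /andP[t0 t1].
have t0' : 0 <= (t%:C : R[i]) by rewrite lecR.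
have t1' : (t%:C : R[i]) <= 1 by rewrite lecR.
by have := cD w z (Itv01 t0' t1'); rewrite !inE => /(_ Dw Dz).
Qed.

Lemma analytic_continuous (D : set C) (a : C -> C) z : analytic D a -> D z ->
  {for z, continuous a}.
Proof. by move=> ha Dz; exact/differentiable_continuous/derivable1_diffP/ha. Qed.

(** Let p + i q be f_z and r + i s the conjugate of f_zbar. Then J = |f_z|^2 - |f_zbar|^2 = (1 -
    |al|^2) |f_z|^2, while the squared gradient of either part is at most 2 (|f_z|^2 + |f_zbar|^2)
    <= 4 |f_z|^2. *)
Lemma beltrami_jacobian f (al : C) z : Normc.normc al <= 1 ->
  (wirtinger_bar f z)^* = al * wirtinger f z ->
  let J := partial_x (re_part f) z * partial_y (im_part f) z -
           partial_y (re_part f) z * partial_x (im_part f) z in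
  (1 - Normc.normc al ^+ 2) * (partial_x (re_part f) z ^+ 2 + partial_y (re_part f) z ^+ 2) <= 4 * J /\
  (1 - Normc.normc al ^+ 2) * (partial_x (im_part f) z ^+ 2 + partial_y (im_part f) z ^+ 2) <= 4 * J.
Proof.
move=> al1; have : Normc.normc al ^+ 2 <= 1 by rewrite exprn_ile1 // (le_trans _ (normc_Re_le _)).
rewrite sqr_normc /wirtinger_bar /wirtinger /cpartial_x /cpartial_y.
set ux := partial_x (re_part f) z; set uy := partial_y (re_part f) z.
set vx := partial_x (im_part f) z; set vy := partial_y (im_part f) z.
have h2 : (2 : R[i])^-1 = (2^-1)%:C by rewrite fmorphV rmorph_nat.
case: al al1 => x y _ /= xy.
rewrite !h2 => /eqP; rewrite eq_complex /= => /andP[/eqP e1 /eqP e2].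
have half : (1 + 1) / ((1 + 1) ^+ 2 + (0 + 0) ^+ 2) = 2^-1 :> R by field.
have zero : (0 + 0) / ((1 + 1) ^+ 2 + (0 + 0) ^+ 2) = 0 :> R by rewrite addr0 mul0r.
rewrite half zero in e1 e2.
pose p := (ux + vy) / 2; pose q := (vx - uy) / 2.
pose r := (ux - vy) / 2; pose s := - (vx + uy) / 2.
have rE : r = x * p - y * q by move: e1; rewrite /r /p /q; lra.
have sE : s = x * q + y * p by move: e2; rewrite /s /p /q; lra.
have rs : r ^+ 2 + s ^+ 2 = (x ^+ 2 + y ^+ 2) * (p ^+ 2 + q ^+ 2) by rewrite rE sE; ring.
have pq0 : 0 <= p ^+ 2 + q ^+ 2 by rewrite addr_ge0 ?sqr_ge0.
have rspq : r ^+ 2 + s ^+ 2 <= p ^+ 2 + q ^+ 2 by rewrite rs ler_piMl.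
have J : ux * vy - uy * vx = (1 - (x ^+ 2 + y ^+ 2)) * (p ^+ 2 + q ^+ 2).
  by rewrite mulrBl mul1r -rs /p /q /r /s; field.
rewrite J [4 * _]mulrCA; split; rewrite ler_wpM2l ?subr_ge0 //.
  have -> : ux ^+ 2 + uy ^+ 2 = 2 * (p ^+ 2 + q ^+ 2 + (r ^+ 2 + s ^+ 2)) - ((p - r) ^+ 2 + (q - s) ^+ 2).
    by rewrite /p /q /r /s; field.
  by have := sqr_ge0 (p - r); have := sqr_ge0 (q - s); lra.
have -> : vx ^+ 2 + vy ^+ 2 = 2 * (p ^+ 2 + q ^+ 2 + (r ^+ 2 + s ^+ 2)) - ((p + r) ^+ 2 + (q + s) ^+ 2).
  by rewrite /p /q /r /s; field.
by have := sqr_ge0 (p + r); have := sqr_ge0 (q + s); lra.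
Qed.

End complex_analysis.

Section no_jump.
Context {R : realType}.
Local Notation mu := (@lebesgue_measure R).
Local Notation C := (R[i]^o).
Variables (a : C -> C) (c M : R).
Hypothesis a_analytic : analytic unit_disk a.
Hypothesis a_disk : forall z, unit_disk z -> unit_disk (a z).
Hypothesis L_infinite : forall m : R, 0 < m < pi^-1 -> calL a c m = +oo%E.
Let w (p : R * R) : R := 1 - Normc.normc (a (toC p)) ^+ 2.
Variables (U Ux Uy V Vx Vy Vxx Vxy Vyx Vyy : R * R -> R).
Hypothesis hU : C1_2 U Ux Uy.
Hypothesis hV : C1_2 V Vx Vy.
Hypothesis hVx : C1_2 Vx Vxx Vxy.
Hypothesis hVy : C1_2 Vy Vyx Vyy.
Hypothesis bU : forall p, disk2 p -> `|U p| <= M.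
Hypothesis bV : forall p, disk2 p -> `|V p| <= M.
Hypothesis wJ : forall p, disk2 p ->
  w p * (Vx p ^+ 2 + Vy p ^+ 2) <= 4 * jacobian Ux Uy Vx Vy p.
Variables (g : R -> R) (gp gm : R).
Hypothesis g_periodic : forall t, g (t + 2 * pi) = g t.
Hypothesis gi0 : mu.-integrable `[0, 2 * pi] (EFin \o g).
Hypothesis V_poisson : forall x s, 0 < x < 1 ->
  V (radial (1 - x) s) = poisson_integral g (polarC x s).

Lemma normc_disk (z : C) : unit_disk z -> Normc.normc (a z) < 1.
Proof. by move=> /a_disk; rewrite /unit_disk /= (lt_normc _ 1). Qed.

Lemma no_jump : small_average (step_rest g c gp gm) c -> gp = gm.
Proof.
move=> sm; apply/eqP; apply: contrapT => /negP jump.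
have w0 p : disk2 p -> 0 <= w p.
  move=> /toC_disk /normc_disk h; rewrite /w subr_ge0.
  have n0 : 0 <= Normc.normc (a (toC p)) := le_trans (normr_ge0 _) (normc_Re_le _).
  by rewrite exprn_ile1 // ltW.
have cw (p : R * R) : disk2 p -> {for p, continuous w}.
  move=> /toC_disk D; apply: continuous_add; first exact: cvg_cst.
  apply: continuous_opp.
  have cn : {for p, continuous (fun q : R * R => Normc.normc (a (toC q)))}.
    apply: (@continuous_comp _ _ _ (fun q : R * R => a (toC q)) (@Normc.normc R : C -> R));
      last exact: normc_continuous.
    apply: (@continuous_comp _ _ _ (@toC R) a); first exact: toC_continuous.
    exact: analytic_continuous D.
  exact: (continuous_mul cn cn).
have [m [B [hm hB]]] := weight_bounded hU hV hVx hVy bU bV cw w0 wJ g_periodic gi0 V_poisson sm jump.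
have m5 : 0 < m <= 1 / 5 by lra.
have := calL_finite cw w0 m5 hB; rewrite L_infinite ?ltxx //.
(* The crude bound pi < 4 suffices: m pi < 3 / 20 * 4 < 1, so this m is covered by [L_infinite]. *)
have p4 := pihalf_02 R; have p0 := pi_gt0 R.
rewrite -[pi^-1]mul1r ltr_pdivlMr //.
have : m * pi <= 3 / 20 * 4 by apply: ler_pM; lra.
lra.
Qed.

End no_jump.

Section complex_limits.
Context {R : realType}.
Local Notation mu := (@lebesgue_measure R).
Variables (G : R -> R[i]^o) (c x y : R).

Lemma ess_lim_left_Re_Im :
  (forall e : R, 0 < e -> exists2 d : R, 0 < d &
    {ae mu, forall s, c - d < s < c -> `|complex.Re (G s) - x| < e}) ->
  (forall e : R, 0 < e -> exists2 d : R, 0 < d &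
    {ae mu, forall s, c - d < s < c -> `|complex.Im (G s) - y| < e}) ->
  ess_lim_left G c (x +i* y).
Proof.
move=> Hx Hy e e0; have e20 : 0 < e / 2 by lra.
have [d1 d10 k1] := Hx _ e20; have [d2 d20 k2] := Hy _ e20.
exists (Num.min d1 d2); first by rewrite lt_min d10.
apply: (ae_imp _ (ae_and k1 k2)) => s [q1 q2] /andP[s1 s2].
have m1 : Num.min d1 d2 <= d1 by rewrite ge_min lexx.
have m2 : Num.min d1 d2 <= d2 by rewrite ge_min lexx orbT.
have {}q1 := q1 ltac:(lra); have {}q2 := q2 ltac:(lra).
apply: le_lt_trans (normc_Re_Im _) _.
by move: q1 q2; case: (G s) => p q /=; lra.
Qed.

Lemma ess_lim_right_Re_Im :
  (forall e : R, 0 < e -> exists2 d : R, 0 < d &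
    {ae mu, forall s, c < s < c + d -> `|complex.Re (G s) - x| < e}) ->
  (forall e : R, 0 < e -> exists2 d : R, 0 < d &
    {ae mu, forall s, c < s < c + d -> `|complex.Im (G s) - y| < e}) ->
  ess_lim_right G c (x +i* y).
Proof.
move=> Hx Hy e e0; have e20 : 0 < e / 2 by lra.
have [d1 d10 k1] := Hx _ e20; have [d2 d20 k2] := Hy _ e20.
exists (Num.min d1 d2); first by rewrite lt_min d10.
apply: (ae_imp _ (ae_and k1 k2)) => s [q1 q2] /andP[s1 s2].
have m1 : Num.min d1 d2 <= d1 by rewrite ge_min lexx.
have m2 : Num.min d1 d2 <= d2 by rewrite ge_min lexx orbT.
have {}q1 := q1 ltac:(lra); have {}q2 := q2 ltac:(lra).
apply: le_lt_trans (normc_Re_Im _) _.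
by move: q1 q2; case: (G s) => p q /=; lra.
Qed.

End complex_limits.

Unset Implicit Arguments.

(* theta0 is an argument of the boundary point zeta = expi theta0. *)
Theorem theorem3 (R : realType) (Omega : set R[i]^o)
    (a f fstar : R[i]^o -> R[i]^o) (theta0 : R)
    (Omega_domain : domain Omega)
    (Omega_bounded : bounded_set Omega)
    (Omega_convex : convex_set Omega)
    (Omega_simply_connected : simply_connected Omega)
    (a_analytic : analytic unit_disk a)
    (a_disk : forall z, unit_disk z -> unit_disk (a z))
    (f_harmonic : harmonic_mapping unit_disk f)
    (f_univalent : {in unit_disk &, injective f})
    (f_onto : f @` unit_disk = Omega)
    (f_beltrami : forall z, unit_disk z ->
       (wirtinger_bar f z)^* = a z * wirtinger f z)
    (fstar_boundary : is_boundary_function f fstar)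
    (L_infinite : forall m : R, 0 < m < pi^-1 -> calL a theta0 m = +oo%E) :
  ess_continuous_at fstar theta0.
Proof.
have [M bM] := bounded_setE Omega_bounded.
pose u := re_part f \o @toC R; pose v := im_part f \o @toC R.
pose F (p : R * R) : R * R := (u p, v p).
pose g1 t := re_part fstar (expi t); pose g2 t := im_part fstar (expi t).
have [i1 i2 fP] := fstar_boundary.
have per1 t : g1 (t + 2 * pi) = g1 t by rewrite /g1 expi_periodic.
have per2 t : g2 (t + 2 * pi) = g2 t by rewrite /g2 expi_periodic.
have [[[hu1 hux1 huy1] _] [[hv1 hvx1 hvy1] _]] := f_harmonic.
have hu := C1_on_C1_2 hu1; have hux := C1_on_C1_2 hux1; have huy := C1_on_C1_2 huy1.
have hv := C1_on_C1_2 hv1; have hvx := C1_on_C1_2 hvx1; have hvy := C1_on_C1_2 hvy1.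
have bf p : disk2 p -> Normc.normc (f (toC p)) <= M.
  by move=> /toC_disk D; apply: bM; rewrite -f_onto; exists (toC p).
have bu p : disk2 p -> `|u p| <= M by move=> /bf; apply: le_trans; exact: normc_Re_le.
have bv p : disk2 p -> `|v p| <= M by move=> /bf; apply: le_trans; exact: normc_Im_le.
have radial_in (x s : R) : 0 < x < 1 -> unit_disk (polarC x s).
  by move=> hx; rewrite -toC_radial; apply/toC_disk/radial_disk; lra.
have P1 (x s : R) : 0 < x < 1 -> u (radial (1 - x) s) = poisson_integral g1 (polarC x s).
  by move=> /radial_in D; rewrite /u /= toC_radial /re_part fP.
have P2 (x s : R) : 0 < x < 1 -> v (radial (1 - x) s) = poisson_integral g2 (polarC x s).
  by move=> /radial_in D; rewrite /v /= toC_radial /im_part fP.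
have cF (p : R * R) : disk2 p -> {for p, continuous F}.
  by move=> D; apply: continuous_pair; [exact: (C1_continuous hu D)|exact: (C1_continuous hv D)].
have injF p q : disk2 p -> disk2 q -> F p = F q -> p = q.
  move=> /toC_disk Dp /toC_disk Dq [e1 e2].
  have e : f (toC p) = f (toC q).
    by apply/eqP; rewrite eq_complex; apply/andP; split; apply/eqP.
  have E : toC p = toC q by apply: f_univalent e; rewrite inE.
  by move: E; case: (p) (q) => p1 p2 [q1 q2] [-> ->].
have convexF p q (t : R) : disk2 p -> disk2 q -> 0 <= t <= 1 ->
    exists2 r, disk2 r & F r = F p + t *: (F q - F p).
  move=> /toC_disk Dp /toC_disk Dq ht.
  have : Omega (t%:C *: f (toC q) + (1 - t%:C) *: f (toC p)).
    by apply: convex_set_segment => //; rewrite -f_onto; [exists (toC p)|exists (toC q)].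
  rewrite -f_onto => -[z Dz ez]; exists (complex.Re z, complex.Im z).
    by apply/toC_disk; case: z Dz {ez}.
  have zE : toC (complex.Re z, complex.Im z) = z by case: z {Dz ez}.
  rewrite /F /u /v /= /re_part /im_part zE ez.
  case: (f (toC p)) (f (toC q)) => p1 p2 [q1 q2] /=.
  by congr (_, _); rewrite /= /GRing.scale /=; ring.
have lin1 (p q : R * R) (t : R) : (p + t *: (q - p)).1 = (1 - t) * p.1 + t * q.1.
  by rewrite /= /GRing.scale /=; ring.
have lin2 (p q : R * R) (t : R) : (p + t *: (q - p)).2 = (1 - t) * p.2 + t * q.2.
  by rewrite /= /GRing.scale /=; ring.
pose c := theta0.
have S1 sg sgh := boundary_one_sided cF injF convexF lin1 per1 i1 P1 bu c (sg := sg) sgh.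
have S2 sg sgh := boundary_one_sided cF injF convexF lin2 per2 i2 P2 bv c (sg := sg) sgh.
have [g1p h1p] := S1 1 (or_introl erefl); have [g1m h1m] := S1 (-1) (or_intror erefl).
have [g2p h2p] := S2 1 (or_introl erefl); have [g2m h2m] := S2 (-1) (or_intror erefl).
have toR (g : R -> R) (L : R) : (forall e : R, 0 < e -> exists2 d : R, 0 < d &
    {ae @lebesgue_measure R, forall s, 0 < 1 * (s - c) < d -> `|g s - L| < e}) ->
    forall e : R, 0 < e -> exists2 d : R, 0 < d &
    {ae @lebesgue_measure R, forall s, c < s < c + d -> `|g s - L| < e}.
  by move=> H e /H[d d0 hd]; exists d => //; apply: (ae_imp _ hd) => s hs sd; apply: hs; lra.
have toL (g : R -> R) (L : R) : (forall e : R, 0 < e -> exists2 d : R, 0 < d &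
    {ae @lebesgue_measure R, forall s, 0 < -1 * (s - c) < d -> `|g s - L| < e}) ->
    forall e : R, 0 < e -> exists2 d : R, 0 < d &
    {ae @lebesgue_measure R, forall s, c - d < s < c -> `|g s - L| < e}.
  by move=> H e /H[d d0 hd]; exists d => //; apply: (ae_imp _ hd) => s hs sd; apply: hs; lra.
have r1 := toR _ _ h1p; have l1 := toL _ _ h1m; have r2 := toR _ _ h2p; have l2 := toL _ _ h2m.
have bj p (D : disk2 p) := beltrami_jacobian (ltW (normc_disk a_disk ((toC_disk p).2 D)))
  (f_beltrami (toC p) ((toC_disk p).2 D)).
(* When V is the real part u, the other function is -v: the pair (-v, u) has the Jacobian of (u,
   v). *)
have e1 : g1p = g1m.
  have sm := small_average_ess per1 i1 l1 r1.
  have bv' p : disk2 p -> `|-1 * v p| <= M by move=> /bv; rewrite mulN1r normrN.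
  apply: (no_jump a_analytic a_disk L_infinite (C1_2_scale (-1) hv) hu hux huy bv' bu _ per1 i1 P1 sm).
  move=> p /bj[+ _]; rewrite /jacobian /=; congr (_ <= _); ring.
have e2 : g2p = g2m.
  have sm := small_average_ess per2 i2 l2 r2.
  apply: (no_jump a_analytic a_disk L_infinite hu hv hvx hvy bu bv _ per2 i2 P2 sm).
  by move=> p /bj[].
exists (g1m +i* g2m); split; first exact: ess_lim_left_Re_Im.
by rewrite -e1 -e2; exact: ess_lim_right_Re_Im.
Qed.
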